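(* Let $(f_n)_{n\geq 1}$ be a sequence of holomorphic self-maps of the open unit disc $\mathbb{D}$ such that the left iterated function system $F_n=f_n\circ f_{n-1}\circ\cdots\circ f_1$ converges, as $n\to\infty$, locally uniformly on $\mathbb{D}$ to a constant $z_0\in\mathbb{D}$. Assume that there exist a subsequence $(f_{n_k})_{k\geq 1}$ of $(f_n)$ and Lebesgue measurable sets $E_k\subseteq\mathbb{T}$, $k\geq 1$, with $\limsup_{k\to\infty} \ell(E_k)>0$, such that for every $k$ we have $\lvert f_{n_k}(\zeta)\rvert<1$ for all $\zeta\in E_k$. Then the sequence $(F_n(\zeta))_{n\geq 1}$ converges to $z_0$ for Lebesgue almost every $\zeta\in\mathbb{T}$.
   Context: $\mathbb{D}=\{z\in\mathbb{C}:\lvert z\rvert<1\}$ is the open unit disc, $\mathbb{T}=\partial\mathbb{D}$ is the unit circle, and $\ell$ is the Lebesgue probability measure on $\mathbb{T}$ (normalised arc length). A holomorphic self-map of $\mathbb{D}$ is a holomorphic function $f\colon\mathbb{D}\to\mathbb{D}$ (constants are allowed). For such an $f$ and $\zeta\in\mathbb{T}$, the boundary value $f(\zeta)$ denotes the radial limit $f(\zeta):=\lim_{r\to1^-}f(r\zeta)$, which exists for Lebesgue almost every $\zeta\in\mathbb{T}$ by a theorem of Fatou; it lies in $\overline{\mathbb{D}}$. In particular, $F_n(\zeta)$ denotes the radial limit at $\zeta$ of the holomorphic self-map $F_n$ of $\mathbb{D}$, and for Lebesgue almost every $\zeta\in\mathbb{T}$ it is defined for all $n\in\mathbb{N}$ simultaneously.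 The condition $\lvert f_{n_k}(\zeta)\rvert<1$ for $\zeta\in E_k$ means that the radial limit of $f_{n_k}$ at $\zeta$ exists and has modulus less than $1$. *)

(* Defs.v *)
From HB Require Import structures.
From mathcomp Require Import all_boot all_order all_algebra.
From mathcomp Require Import complex.
From mathcomp Require Import all_classical all_reals all_analysis.

Set Implicit Arguments.
Unset Strict Implicit.
Unset Printing Implicit Defensive.

Import Order.TTheory GRing.Theory Num.Theory numFieldNormedType.Exports.

Local Open Scope classical_set_scope.
Local Open Scope complex_scope.
Local Open Scope ring_scope.

(* The regular module [R[i]^o] carries the library's topology on [R[i]]; norms
   have values in [R[i]], where [`|z| < 1] says that the (real) modulus of [z]
   is less than 1. *)
Notation Cplx R := (R[i]^o)%type.

Section Defs.
Variable R : realType.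
Local Notation C := (Cplx R).

Definition unit_disc : set C := [set z | `|z| < 1].

Definition unit_circle : set C := [set z | `|z| = 1].

Definition holomorphic_on (U : set C) (f : C -> C) : Prop :=
  forall z, U z -> derivable f z 1.

(* Functions are total on [C]; the values outside the disc are irrelevant. *)
Definition disc_selfmap (f : C -> C) : Prop :=
  holomorphic_on unit_disc f /\ (forall z, unit_disc z -> unit_disc (f z)).

(* The sequence is indexed from 0:
   [left_iterate f n = f n \o f n.-1 \o ... \o f 0]. *)
Fixpoint left_iterate (f : nat -> C -> C) (n : nat) : C -> C :=
  match n with
  | 0 => f 0
  | m.+1 => f m.+1 \o left_iterate f m
  end.

Definition locally_uniform_cvg (U : set C) (F : nat -> C -> C) (g : C -> C)
    : Prop :=
  forall z, U z -> exists2 V, nbhs z V & {uniform V `&` U, F @ \oo --> g}.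

Definition on_radius (f : C -> C) (zeta : C) (r : R) : C := f (r%:C * zeta).

Definition has_radial_limit (f : C -> C) (zeta : C) : Prop :=
  cvg (on_radius f zeta r @[r --> 1^'-]).

(* Meaningful only where [has_radial_limit f zeta] holds. *)
Definition radial_limit (f : C -> C) (zeta : C) : C :=
  lim (on_radius f zeta r @[r --> 1^'-]).

Definition circle_param (t : R) : C := cos (2 * pi * t) +i* sin (2 * pi * t).

Definition circle_preimage (A : set C) : set R :=
  `[0, 1[ `&` circle_param @^-1` A.

(* Measurability in Caratheodory's sense for the Lebesgue outer measure, i.e.
   Lebesgue (not only Borel) measurability. *)
Definition circle_measurable (A : set C) : Prop :=
  (wlength (@idfun R))^*%mu.-cara.-measurable (circle_preimage A).

(* Normalised arc length: the push-forward of the Lebesgue measure of [0, 1[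
   by [circle_param]. *)
Definition circle_measure (A : set C) : \bar R :=
  completed_lebesgue_measure (circle_preimage A).

Definition circle_ae (P : C -> Prop) : Prop :=
  exists N : set C, [/\ circle_measurable N, circle_measure N = 0%E &
    forall zeta, unit_circle zeta -> ~ N zeta -> P zeta].

End Defs.

(* Main.v *)
(* Let [w = F_N - z_0]. If [g] is holomorphic with [|g| <= 1], then [1 - |g(z)|^2] is at
   least the Poisson integral of [1 - |g|^2] at [z]. Put [z = F_n(zeta)], multiply by
   [|w(zeta)|^2] and integrate: the Poisson kernel at [F_n] is the real part of a
   holomorphic function tending to a constant near the origin, so [F_n] is asymptotically
   independent of the weight, and with [kappa = (1 - |z_0|) / (1 + |z_0|)]
     liminf_n int (1 - |g(F_n)|^2) |w|^2 >= kappa int (1 - |g|^2) int |w|^2,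
   uniformly in [g]. Take [g = f_{n+1}^m] along the given subsequence and let [m] tend to
   infinity: the factor [int (1 - |g|^2)] tends to the measure of [|f_{n+1}| < 1], which
   stays above some [c > 0], while [g(F_n) = F_{n+1}^m] has modulus 1 on the set [P] where
   [|F_n(zeta)| = 1] for every [n]. Hence
     kappa c int |F_N - z_0|^2 <= int_{complement of P} |F_N - z_0|^2.
   Off [P] some [F_N(zeta)] lies in the disc, and there the tails of the system converge
   to [z_0] by Vitali's theorem; so [F_N(zeta)] tends to [z_0] and the right-hand side
   tends to 0 as [N] grows. The left-hand side is at least
   [kappa c (1 - |z_0|)^2 l(P)], whence [P] is null. *)
Require Import Defs.
From HB Require Import structures.
From mathcomp Require Import all_boot all_order all_algebra.
From mathcomp Require Import complex ring lra.
From mathcomp Require Import all_classical all_reals all_analysis.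
From mathcomp Require Import measurable_realfun.
Set Implicit Arguments.
Unset Strict Implicit.
Unset Printing Implicit Defensive.
Import Order.TTheory GRing.Theory Num.Theory numFieldNormedType.Exports.
Local Open Scope classical_set_scope.
Local Open Scope complex_scope.
Local Open Scope ring_scope.
Import ComplexField.Normc.

(** * The modulus and integrals over the unit interval *)

(** The boundary map of [f_{n+1}] cannot be composed with that of [F_n]: where [|F_n(zeta)| = 1],
    the radial limit of [f_{n+1}] at [F_n(zeta)] may fail to exist. Hence [g] is evaluated at
    [R0 F_n(r zeta)], inside the disc; first [R0] tends to 1, where [g(F_n)] becomes [F_{n+1}^m],
    and only then [r]. The powers are there because [1 - |f|^2] alone weighs a point by the depth of
    its boundary value, whereas the hypothesis bounds only the measure of the points sent inside.
    Taking the limit in [m] at fixed [n] forces the threshold on [n] to be independent of [g]. This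
    uniformity comes from replacing [w] by a Taylor polynomial [p]: integrating a holomorphic
    function against [|p|^2] uses finitely many Taylor coefficients, which can be read off a fixed
    small circle where [F_n] is close to [z_0]. The price is an [L^2] error, uniform in the radius
    by Bessel's identity. The constant [kappa] is Harnack's lower bound for the Poisson kernel at
    [z_0]. *)

Section Modulus.
Variable R : realType.
Local Notation C := R[i].
Implicit Types (x y z : C) (r : R).

Lemma normc_ge0 x : 0 <= normc x.
Proof. by case: x => a b /=; exact: sqrtr_ge0. Qed.

Lemma normcBC x y : normc (x - y) = normc (y - x).
Proof. by rewrite -normcN opprB. Qed.

Lemma le_normcB x y : normc (x - y) <= normc x + normc y.
Proof. by rewrite -(normcN y); exact: le_normcD. Qed.

Lemma normc_triangle y x z : normc (x - z) <= normc (x - y) + normc (y - z).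
Proof. by rewrite -(subrKA y); exact: le_normcD. Qed.

Lemma lerB_normc x y : normc x - normc y <= normc (x - y).
Proof. by rewrite lerBlDr; have := le_normcD (x - y) y; rewrite subrK. Qed.

Lemma lerB_normcD x y : normc x - normc y <= normc (x + y).
Proof. by have := lerB_normc x (- y); rewrite normcN opprK. Qed.

Lemma sqr_normcE x : normc x ^+ 2 = complex.Re x ^+ 2 + complex.Im x ^+ 2.
Proof. by case: x => a b /=; rewrite sqr_sqrtr// addr_ge0// sqr_ge0. Qed.

Lemma normc_realE r : normc r%:C = `|r|.
Proof. by rewrite /= expr0n/= addr0 sqrtr_sqr. Qed.

Lemma normc_eq0 x : (normc x == 0) = (x == 0).
Proof. by apply/eqP/eqP => [/eq0_normc|->//]; rewrite ?normc0. Qed.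

Lemma normc_gt0 x : (0 < normc x) = (x != 0).
Proof. by rewrite lt_def normc_ge0 normc_eq0 andbT. Qed.

Lemma normcX x n : normc (x ^+ n) = normc x ^+ n.
Proof. by elim: n => [|n IH]; rewrite ?expr0 ?normc1// !exprS normcM IH. Qed.

Lemma normcf_div x y : normc (x / y) = normc x / normc y.
Proof. by rewrite normcM normcV. Qed.

Lemma normcJE x : normc (x^*) = normc x.
Proof. by case: x => a b /=; rewrite sqrrN. Qed.

Lemma ler_normRe x : `|complex.Re x| <= normc x.
Proof.
rewrite -(@ler_pXn2r _ 2)// ?nnegrE ?normc_ge0//.
by rewrite sqr_normcE real_normK ?num_real// lerDl sqr_ge0.
Qed.

Lemma ler_normIm x : `|complex.Im x| <= normc x.
Proof.
rewrite -(@ler_pXn2r _ 2)// ?nnegrE ?normc_ge0//.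
by rewrite sqr_normcE real_normK ?num_real// lerDr sqr_ge0.
Qed.

Lemma ler_Re x : complex.Re x <= normc x.
Proof. exact: le_trans (ler_norm _) (ler_normRe x). Qed.

Lemma normc_leD x : normc x <= `|complex.Re x| + `|complex.Im x|.
Proof.
rewrite -(@ler_pXn2r _ 2)// ?nnegrE ?normc_ge0// ?addr_ge0//.
rewrite sqr_normcE sqrrD !real_normK ?num_real//.
by rewrite lerD2r lerDl mulrn_wge0// mulr_ge0.
Qed.

Lemma mulcJ x : x * x^* = (normc x ^+ 2)%:C.
Proof.
by case: x => a b; rewrite sqr_normcE; apply/eqP; rewrite eq_complex /=;
   apply/andP; split; apply/eqP; ring.
Qed.

Lemma complexReD x y : complex.Re (x + y) = complex.Re x + complex.Re y.
Proof. by case: x; case: y. Qed.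

Lemma complexImD x y : complex.Im (x + y) = complex.Im x + complex.Im y.
Proof. by case: x; case: y. Qed.

Lemma complexReN x : complex.Re (- x) = - complex.Re x.
Proof. by case: x. Qed.

Lemma complexImN x : complex.Im (- x) = - complex.Im x.
Proof. by case: x. Qed.

Lemma complexReM x y : complex.Re (x * y) =
  complex.Re x * complex.Re y - complex.Im x * complex.Im y.
Proof. by case: x; case: y. Qed.

Lemma complexImM x y : complex.Im (x * y) =
  complex.Re x * complex.Im y + complex.Im x * complex.Re y.
Proof. by case: x; case: y. Qed.

Lemma complexReJ x : complex.Re (x^*) = complex.Re x.
Proof. by case: x. Qed.

Lemma complexImJ x : complex.Im (x^*) = - complex.Im x.
Proof. by case: x. Qed.

Lemma complexP x y : complex.Re x = complex.Re y -> complex.Im x = complex.Im y -> x = y.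
Proof. by case: x; case: y => ? ? ? ? /= -> ->. Qed.

End Modulus.

(** * Integrals of continuous real functions over the unit interval *)

Section RealIntegral.
Variable R : realType.
Local Notation mu := (@lebesgue_measure R).
Implicit Types (u v : R -> R).

(** Continuity is two-sided even at 0 and 1: the integrands are given by formulas valid around
    [[0, 1]], and pointwise continuity composes without passing to the subspace topology. *)
Definition cont01 u := forall t : R, 0 <= t <= 1 -> {for t, continuous u}.

Definition rint u : R := (\int[mu]_(t in `[0%R, 1%R]) u t)%R.

Lemma cont01_within u : cont01 u -> {within `[0, 1], continuous u}.
Proof.
move=> cu; apply: continuous_in_subspaceT => t.
by rewrite inE/= in_itv/= => t01; exact: cu.
Qed.

Lemma cont01_integrable u : cont01 u -> mu.-integrable `[0%R, 1%R] (EFin \o u).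
Proof.
move=> cu; apply: continuous_compact_integrable; first exact: segment_compact.
exact: cont01_within.
Qed.

Lemma rint_eq u v : (forall t : R, 0 <= t <= 1 -> u t = v t) -> rint u = rint v.
Proof. by move=> uv; apply: eq_Rintegral => t; rewrite inE/= in_itv/=; exact: uv. Qed.

Lemma rintD u v : cont01 u -> cont01 v -> rint (fun t => u t + v t) = rint u + rint v.
Proof. by move=> cu cv; rewrite /rint RintegralD//; exact: cont01_integrable. Qed.

Lemma rintB u v : cont01 u -> cont01 v -> rint (fun t => u t - v t) = rint u - rint v.
Proof. by move=> cu cv; rewrite /rint RintegralB//; exact: cont01_integrable. Qed.

Lemma rintZ u k : cont01 u -> rint (fun t => k * u t) = k * rint u.
Proof. by move=> cu; rewrite /rint RintegralZl//; exact: cont01_integrable. Qed.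

Lemma rint_cst k : rint (fun=> k) = k.
Proof.
rewrite /rint Rintegral_cst//= lebesgue_measure_itv/= lte_fin ltr01/=.
by rewrite oppr0 addr0 mulr1.
Qed.

Lemma ler_rint u v : cont01 u -> cont01 v -> (forall t : R, 0 <= t <= 1 -> u t <= v t) ->
  rint u <= rint v.
Proof.
move=> cu cv uv; by apply: le_Rintegral => //; exact: cont01_integrable.
Qed.

Lemma cont01D u v : cont01 u -> cont01 v -> cont01 (fun t => u t + v t).
Proof. by move=> cu cv t t01; apply: continuousD; [exact: cu|exact: cv]. Qed.

Lemma cont01B u v : cont01 u -> cont01 v -> cont01 (fun t => u t - v t).
Proof. by move=> cu cv t t01; apply: continuousB; [exact: cu|exact: cv]. Qed.

Lemma cont01N u : cont01 u -> cont01 (fun t => - u t).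
Proof. by move=> cu t t01; apply: continuousN; exact: cu. Qed.

Lemma cont01M u v : cont01 u -> cont01 v -> cont01 (fun t => u t * v t).
Proof. by move=> cu cv t t01; apply: continuousM; [exact: cu|exact: cv]. Qed.

Lemma cont01_cst k : cont01 (fun=> k).
Proof. by move=> t t01; exact: cst_continuous. Qed.

Lemma cont01X u n : cont01 u -> cont01 (fun t => u t ^+ n).
Proof.
move=> cu; elim: n => [|n IH]; first exact: cont01_cst.
under eq_fun do rewrite exprS; exact: cont01M.
Qed.

Lemma rint_ge0 u : cont01 u -> (forall t : R, 0 <= t <= 1 -> 0 <= u t) -> 0 <= rint u.
Proof. by move=> cu u0; rewrite -(rint_cst 0); apply: ler_rint => //; exact: cont01_cst. Qed.

Lemma rint_le_cst u k : cont01 u -> (forall t : R, 0 <= t <= 1 -> u t <= k) -> rint u <= k.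
Proof. by move=> cu u0; rewrite -[leRHS]rint_cst; apply: ler_rint => //; exact: cont01_cst. Qed.

Lemma rint_FTC u v : cont01 u -> (forall t : R, 0 <= t <= 1 -> is_derive t 1 v (u t)) ->
  rint u = v 1 - v 0.
Proof.
move=> cu dv; rewrite /rint /Rintegral (@continuous_FTC2 _ u v)//.
- exact: cont01_within.
- have cv : cont01 v.
    move=> t /dv dvt; apply: differentiable_continuous.
    by apply/derivable1_diffP; exact: ex_derive.
  split.
  + move=> t; rewrite in_itv/= => /andP[t0 t1].
    by have := dv t; rewrite (ltW t0) (ltW t1) => /(_ isT) dvt; exact: ex_derive.
  + by apply: cvg_at_right_filter; apply: cv; rewrite lexx ler01.
  + by apply: cvg_at_left_filter; apply: cv; rewrite lexx ler01.
- move=> t; rewrite in_itv/= => /andP[t0 t1].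
  have := dv t; rewrite (ltW t0) (ltW t1) => /(_ isT) dvt.
  by rewrite derive1E; exact: derive_val.
Qed.

Lemma rint_affine u (a : R) : cont01 u -> 0 <= a -> a + 2^-1 <= 1 ->
  (\int[mu]_(t in `[a, (a + 2^-1)%R]) u t)%R = 2^-1 * rint (fun t => u (a + t / 2)).
Proof.
move=> cu a0 a1.
pose F (t : R) := a + t / 2.
have dF (t : R) : is_derive t 1 F 2^-1.
  by apply: is_derive_eq; rewrite ?add0r !scaler0 add0r mul1r /GRing.scale/= mulr1.
have F' : F^`()%classic = fun=> 2^-1.
  by apply/funext => t; rewrite derive1E; apply: derive_val.
have cF (t : R) : {for t, continuous F}.
  by apply: differentiable_continuous; apply/derivable1_diffP; exact: ex_derive.
have FE0 : F 0 = a by rewrite /F mul0r addr0.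
have FE1 : F 1 = a + 2^-1 by rewrite /F mul1r.
have cuF : cont01 (fun t => u (a + t / 2)).
  move=> t /andP[t0 t1]; apply: (@continuous_comp _ _ _ F u) => //.
  by apply: cu; rewrite /F; lra.
rewrite -rintZ// /rint /Rintegral; congr fine.
rewrite -[in LHS]FE1 -[in LHS]FE0.
rewrite (@integration_by_substitution_increasing _ F u)//.
- by apply: eq_integral => t _; rewrite F' /= mulrC.
- by move=> s t _ _ st; rewrite /F; lra.
- by rewrite F' => t _; exact: cst_continuous.
- by rewrite F'; exact: is_cvg_cst.
- by rewrite F'; exact: is_cvg_cst.
- split.
  + by move=> t _; exact: ex_derive.
  + by apply: cvg_at_right_filter; exact: cF.
  + by apply: cvg_at_left_filter; exact: cF.
- apply: continuous_in_subspaceT => t.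
  by rewrite inE/= in_itv/= FE0 FE1 => t01; apply: cu; lra.
Qed.

(** Bisection of the parameter interval, used to cut the edges of a triangle at their midpoints in
    Goursat's theorem. *)
Lemma rint_mid u : cont01 u ->
  rint u = 2^-1 * rint (fun t => u (t / 2)) + 2^-1 * rint (fun t => u (2^-1 + t / 2)).
Proof.
move=> cu.
have := rint_affine cu (lexx 0); rewrite add0r => /(_ _).
have -> : (fun t => u (0 + t / 2)) = (fun t => u (t / 2)).
  by apply/funext => t; rewrite add0r.
move=> <-; last lra.
rewrite -rint_affine//; try lra.
have -> : 2^-1 + 2^-1 = 1 :> R by lra.
rewrite -[X in _ = _ + X]Rintegral_itv_obnd_cbnd.
- rewrite -(@Rintegral_itvB _ u (BLeft 0) (BRight 1) 2^-1)//.
  + by rewrite addrC subrK.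
  + exact: cont01_integrable.
  + by rewrite bnd_simp; lra.
  + by rewrite bnd_simp; lra.
- apply: integrableS (cont01_integrable cu) => //.
  by apply: subset_itvr; rewrite bnd_simp; lra.
Qed.

Lemma rint_rev u : cont01 u -> rint (fun t => u (1 - t)) = rint u.
Proof.
move=> cu; rewrite [RHS]/rint.
rewrite Rintegration_by_substitution_onem ?lexx ?ler01//; first by rewrite /unstable.onem subrr.
exact: cont01_within.
Qed.

End RealIntegral.

(** * Integrals of complex functions over the unit interval, by real and imaginary parts *)

Section ComplexIntegral.
Variable R : realType.
Local Notation C := R[i].
Local Notation Re := (@complex.Re _).
Local Notation Im := (@complex.Im _).
Implicit Types (phi psi : R -> C).

Definition contc phi := cont01 (Re \o phi) /\ cont01 (Im \o phi).

Definition cint phi : C := rint (Re \o phi) +i* rint (Im \o phi).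

Lemma contcD phi psi : contc phi -> contc psi -> contc (fun t => phi t + psi t).
Proof.
move=> [p1 p2] [q1 q2]; split.
- rewrite (_ : _ \o _ = fun t => Re (phi t) + Re (psi t)); first exact: cont01D.
  by apply/funext => t /=; rewrite complexReD.
- rewrite (_ : _ \o _ = fun t => Im (phi t) + Im (psi t)); first exact: cont01D.
  by apply/funext => t /=; rewrite complexImD.
Qed.

Lemma contcM phi psi : contc phi -> contc psi -> contc (fun t => phi t * psi t).
Proof.
move=> [p1 p2] [q1 q2]; split.
- rewrite (_ : _ \o _ = fun t => Re (phi t) * Re (psi t) - Im (phi t) * Im (psi t)).
    by apply: cont01B; exact: cont01M.
  by apply/funext => t; exact: complexReM.
- rewrite (_ : _ \o _ = fun t => Re (phi t) * Im (psi t) + Im (phi t) * Re (psi t)).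
    by apply: cont01D; exact: cont01M.
  by apply/funext => t; exact: complexImM.
Qed.

Lemma contc_cst (k : C) : contc (fun=> k).
Proof. by split; exact: cont01_cst. Qed.

Lemma contcN phi : contc phi -> contc (fun t => - phi t).
Proof.
move=> cp; rewrite (_ : (fun t => - phi t) = fun t => -1 * phi t).
  by apply: contcM => //; exact: contc_cst.
by apply/funext => t; rewrite mulN1r.
Qed.

Lemma contcB phi psi : contc phi -> contc psi -> contc (fun t => phi t - psi t).
Proof. by move=> cp cq; apply: contcD => //; exact: contcN. Qed.

Lemma contcJ phi : contc phi -> contc (fun t => (phi t)^*).
Proof.
move=> [p1 p2]; split.
- rewrite (_ : _ \o _ = Re \o phi)//.
  by apply/funext => t /=; rewrite complexReJ.
- rewrite (_ : _ \o _ = fun t => - Im (phi t)); first exact: cont01N.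
  by apply/funext => t /=; rewrite complexImJ.
Qed.

Lemma contcX phi n : contc phi -> contc (fun t => phi t ^+ n).
Proof.
move=> cp; elim: n => [|n IH]; first exact: contc_cst.
by under eq_fun do rewrite exprS; exact: contcM.
Qed.

Lemma contc_sum n (F : nat -> R -> C) : (forall k, contc (F k)) ->
  contc (fun t => \sum_(k < n) F k t).
Proof.
move=> cF; elim: n => [|n IH].
  by under eq_fun do rewrite big_ord0; exact: contc_cst.
by under eq_fun do rewrite big_ord_recr/=; exact: contcD.
Qed.

Lemma cont01_real u : cont01 u -> contc (fun t : R => (u t)%:C).
Proof. by move=> cu; split => //; exact: cont01_cst. Qed.

Lemma cont01_Re phi : contc phi -> cont01 (fun t => Re (phi t)).
Proof. by case. Qed.

Lemma cont01_sqr_normc phi : contc phi -> cont01 (fun t => normc (phi t) ^+ 2).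
Proof.
move=> [c1 c2]; under eq_fun do rewrite sqr_normcE.
by apply: cont01D; exact: cont01X.
Qed.

Lemma cont01_normc phi : contc phi -> cont01 (fun t => normc (phi t)).
Proof.
move=> /cont01_sqr_normc c2 t t01.
rewrite (_ : (fun t => _) = Num.sqrt \o (fun t => normc (phi t) ^+ 2)).
  by apply: continuous_comp; [exact: c2|exact: sqrt_continuous].
by apply/funext => s /=; rewrite sqrtr_sqr ger0_norm// normc_ge0.
Qed.

Lemma cint_eq phi psi : (forall t : R, 0 <= t <= 1 -> phi t = psi t) ->
  cint phi = cint psi.
Proof. by move=> h; congr (_ +i* _); apply: rint_eq => t /h /= ->. Qed.

Lemma cintD phi psi : contc phi -> contc psi ->
  cint (fun t => phi t + psi t) = cint phi + cint psi.
Proof.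
move=> [p1 p2] [q1 q2]; apply: complexP; rewrite ?complexReD ?complexImD /=.
- by rewrite -rintD//; apply: rint_eq => t _ /=; rewrite complexReD.
- by rewrite -rintD//; apply: rint_eq => t _ /=; rewrite complexImD.
Qed.

Lemma cintZ phi k : contc phi -> cint (fun t => k * phi t) = k * cint phi.
Proof.
move=> [p1 p2]; apply: complexP; rewrite ?complexReM ?complexImM /=.
- rewrite -!rintZ// -rintB; [|by apply: cont01M => //; exact: cont01_cst..].
  by apply: rint_eq => t _; exact: complexReM.
- rewrite -!rintZ// -rintD; [|by apply: cont01M => //; exact: cont01_cst..].
  by apply: rint_eq => t _; exact: complexImM.
Qed.

Lemma cintN phi : contc phi -> cint (fun t => - phi t) = - cint phi.
Proof. by move=> cp; rewrite -mulN1r -cintZ//; apply: cint_eq => t _; rewrite mulN1r. Qed.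

Lemma cintB phi psi : contc phi -> contc psi ->
  cint (fun t => phi t - psi t) = cint phi - cint psi.
Proof. by move=> cp cq; rewrite cintD//; [rewrite cintN|exact: contcN]. Qed.

Lemma cint_cst k : cint (fun=> k) = k.
Proof. by apply: complexP => /=; exact: rint_cst. Qed.

Lemma cintJ phi : contc phi -> cint (fun t => (phi t)^*) = (cint phi)^*.
Proof.
move=> [p1 p2]; apply: complexP; rewrite ?complexReJ ?complexImJ /=.
- by apply: rint_eq => t _ /=; rewrite complexReJ.
- rewrite -mulN1r -rintZ//.
  by apply: rint_eq => t _ /=; rewrite complexImJ mulN1r.
Qed.

Lemma cint_sum n (F : nat -> R -> C) : (forall k, contc (F k)) ->
  cint (fun t => \sum_(k < n) F k t) = \sum_(k < n) cint (F k).
Proof.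
move=> cF; elim: n => [|n IH].
  by rewrite big_ord0; under eq_fun do rewrite big_ord0; exact: cint_cst.
rewrite big_ord_recr/= -IH -cintD//; last exact: contc_sum.
by congr cint; apply/funext => t; rewrite big_ord_recr.
Qed.

Lemma cint_real u : cint (fun t => (u t)%:C) = (rint u)%:C.
Proof. by apply: complexP => //=; exact: rint_cst. Qed.

Lemma Re_cint phi : Re (cint phi) = rint (fun t => Re (phi t)).
Proof. by []. Qed.

(* Rotating so that the integral is real reduces the bound to real parts. *)
Lemma ler_normc_cint phi : contc phi -> normc (cint phi) <= rint (fun t => normc (phi t)).
Proof.
move=> cp; set I := cint phi.
have [->|I0] := eqVneq I 0.
  rewrite normc0; apply: rint_ge0 => [|t _]; [exact: cont01_normc|exact: normc_ge0].
have NI : 0 < normc I by rewrite normc_gt0.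
rewrite -(ler_pM2l NI) -expr2.
have -> : normc I ^+ 2 = Re (cint (fun t => I^* * phi t)).
  by rewrite cintZ// -/I mulrC mulcJ.
rewrite Re_cint -rintZ; last exact: cont01_normc.
apply: ler_rint => [||t _].
- by apply: cont01_Re; apply: contcM => //; exact: contc_cst.
- by apply: cont01M; [exact: cont01_cst|exact: cont01_normc].
- by rewrite (le_trans (ler_Re _))// normcM normcJE.
Qed.

Lemma ler_normc_cint_cst phi (M : R) : contc phi ->
  (forall t : R, 0 <= t <= 1 -> normc (phi t) <= M) -> normc (cint phi) <= M.
Proof.
move=> cp pM; apply: le_trans (ler_normc_cint cp) _.
by apply: rint_le_cst => //; exact: cont01_normc.
Qed.

Lemma cint_FTC phi psi : contc phi ->
  (forall t : R, 0 <= t <= 1 -> is_derive t 1 (Re \o psi) (Re (phi t))) ->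
  (forall t : R, 0 <= t <= 1 -> is_derive t 1 (Im \o psi) (Im (phi t))) ->
  cint phi = psi 1 - psi 0.
Proof.
move=> [p1 p2] d1 d2; apply: complexP; rewrite ?complexReD ?complexReN ?complexImD ?complexImN/=.
- exact: (rint_FTC p1).
- exact: (rint_FTC p2).
Qed.

Lemma cint_mid phi : contc phi -> cint phi =
  2^-1 * cint (fun t => phi (t / 2)) + 2^-1 * cint (fun t => phi (2^-1 + t / 2)).
Proof.
have E : (2^-1 : C) = (2^-1 : R)%:C by rewrite fmorphV/= rmorph_nat.
move=> [p1 p2]; apply: complexP; rewrite E ?complexReD ?complexImD ?complexReM ?complexImM/= !mul0r ?subr0 ?addr0.
- exact: rint_mid.
- exact: rint_mid.
Qed.

Lemma cint_rev phi : contc phi -> cint (fun t => phi (1 - t)) = cint phi.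
Proof. by move=> [p1 p2]; apply: complexP => /=; [exact: (rint_rev p1)|exact: (rint_rev p2)]. Qed.

End ComplexIntegral.

(** * Complex differentiation and Goursat's theorem *)

Section Differentiation.
Variable R : realType.
Local Notation C := R[i].
Local Notation Re := (@complex.Re _).
Local Notation Im := (@complex.Im _).
Implicit Types (f g : C -> C) (z d : C).

Definition cts f z := forall e : R, 0 < e -> exists2 del : R, 0 < del &
  forall w, normc (w - z) < del -> normc (f w - f z) < e.

(* Derivatives and limits are stated with the real modulus [normc]; the norm of
   [R[i]^o] takes its values in [R[i]]. *)
Definition has_deriv f z d := forall e : R, 0 < e -> exists2 del : R, 0 < del &
  forall w, normc (w - z) < del ->
    normc (f w - f z - d * (w - z)) <= e * normc (w - z).

Definition path_deriv (phi : R -> C) (t : R) d := forall e : R, 0 < e ->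
  exists2 del : R, 0 < del &
  forall s, `|s - t| < del -> normc (phi s - phi t - d * (s - t)%:C) <= e * `|s - t|.

Lemma has_deriv_cts f z d : has_deriv f z d -> cts f z.
Proof.
move=> fd e e0; have [del del0 H] := fd 1 ltr01.
have K0 : 0 < 1 + normc d by have := normc_ge0 d; lra.
exists (Num.min del (e / (1 + normc d))); first by rewrite lt_min del0 divr_gt0.
move=> w; rewrite lt_min => /andP[/H wd we].
have : normc (f w - f z) <= (1 + normc d) * normc (w - z).
  rewrite mulrDl -normcM -{1}(subrK (d * (w - z)) (f w - f z)).
  by rewrite (le_trans (le_normcD _ _))// lerD2r.
by move/le_lt_trans; apply; rewrite mulrC -ltr_pdivlMr.
Qed.

Lemma has_deriv_cst k z : has_deriv (fun=> k) z 0.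
Proof.
move=> e e0; exists 1 => // w _.
by rewrite subrr mul0r subrr normc0 mulr_ge0// ?normc_ge0// ltW.
Qed.

Lemma has_deriv_id z : has_deriv id z 1.
Proof.
move=> e e0; exists 1 => // w _.
by rewrite mul1r subrr normc0 mulr_ge0// ?normc_ge0// ltW.
Qed.

Lemma has_derivD f g z d d' : has_deriv f z d -> has_deriv g z d' -> has_deriv (fun w => f w + g w) z (d + d').
Proof.
move=> fd gd e e0; have e2 : 0 < e / 2 by rewrite divr_gt0.
have [a a0 fa] := fd _ e2; have [b b0 gb] := gd _ e2.
exists (Num.min a b); first by rewrite lt_min a0.
move=> w; rewrite lt_min => /andP[/fa A /gb B].
have -> : f w + g w - (f z + g z) - (d + d') * (w - z) =
  (f w - f z - d * (w - z)) + (g w - g z - d' * (w - z)) by ring.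
apply: (le_trans (le_normcD _ _)); move: A B; move: (normc _) => X; nra.
Qed.

Lemma cts_cvg_bound f z : cts f z -> exists2 del : R, 0 < del &
  forall w, normc (w - z) < del -> normc (f w) <= normc (f z) + 1.
Proof.
move=> /(_ 1 ltr01)[del del0 H]; exists del => // w /H wH.
by have := lerB_normc (f w) (f z); lra.
Qed.

Lemma has_derivM f g z d d' : has_deriv f z d -> has_deriv g z d' ->
  has_deriv (fun w => f w * g w) z (d * g z + f z * d').
Proof.
move=> fd gd e e0.
pose K := normc (g z) + normc (f z) + normc d + 1.
have K0 : 0 < K.
  by rewrite /K; have := normc_ge0 (g z); have := normc_ge0 (f z); have := normc_ge0 d; lra.
have e3 : 0 < e / (3 * K) by rewrite divr_gt0// mulr_gt0.
have [a a0 fa] := fd _ e3; have [b b0 gb] := gd _ e3.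
have [c c0 gc] := has_deriv_cts gd e3.
have [c' c'0 gc'] := cts_cvg_bound (has_deriv_cts gd).
exists (Num.min (Num.min a b) (Num.min c c')); first by rewrite !lt_min a0 b0 c0 c'0.
move=> w; rewrite !lt_min => /andP[/andP[/fa A /gb B] /andP[/gc G /gc' G']].
have -> : f w * g w - f z * g z - (d * g z + f z * d') * (w - z) =
  (f w - f z - d * (w - z)) * g w + f z * (g w - g z - d' * (w - z))
  + d * (w - z) * (g w - g z) by ring.
apply: (le_trans (le_normcD _ _)).
have X : normc ((f w - f z - d * (w - z)) * g w + f z * (g w - g z - d' * (w - z)))
  <= e / (3 * K) * normc (w - z) * K + K * (e / (3 * K) * normc (w - z)).
  apply: (le_trans (le_normcD _ _)); rewrite !normcM lerD//.
    apply: ler_pM => //; rewrite ?normc_ge0// (le_trans G')//.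
    by rewrite /K; have := normc_ge0 (f z); have := normc_ge0 d; lra.
  apply: ler_pM => //; rewrite ?normc_ge0//.
  by rewrite /K; have := normc_ge0 (g z); have := normc_ge0 d; lra.
have Y : normc (d * (w - z) * (g w - g z)) <= K * normc (w - z) * (e / (3 * K)).
  rewrite !normcM; apply: ler_pM; rewrite ?mulr_ge0 ?normc_ge0// ?(ltW G)//.
  rewrite ler_wpM2r ?normc_ge0//.
  by rewrite /K; have := normc_ge0 (f z); have := normc_ge0 (g z); lra.
apply: (le_trans (lerD X Y)); rewrite le_eqVlt; apply/orP; left; apply/eqP.
by field; exact: lt0r_neq0.
Qed.

Lemma has_derivZ k f z d : has_deriv f z d -> has_deriv (fun w => k * f w) z (k * d).
Proof.
by move=> fd; have := has_derivM (has_deriv_cst k z) fd; rewrite mul0r add0r.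
Qed.

Lemma has_derivN f z d : has_deriv f z d -> has_deriv (fun w => - f w) z (- d).
Proof.
move=> /(has_derivZ (-1)); rewrite mulN1r.
by under eq_fun do rewrite mulN1r.
Qed.

Lemma has_derivB f g z d d' : has_deriv f z d -> has_deriv g z d' -> has_deriv (fun w => f w - g w) z (d - d').
Proof. by move=> fd gd; apply: has_derivD => //; exact: has_derivN. Qed.

Lemma has_deriv_comp f g z d d' : has_deriv f z d -> has_deriv g (f z) d' ->
  has_deriv (fun w => g (f w)) z (d' * d).
Proof.
move=> fd gd e e0.
pose K := normc d + normc d' + 1.
have K0 : 0 < K by rewrite /K; have := normc_ge0 d; have := normc_ge0 d'; lra.
have e1 : 0 < e / (2 * K) by rewrite divr_gt0// mulr_gt0.
have [b b0 gb] := gd _ e1.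
have [a a0 fa] := fd _ e1; have [a' a'0 fa'] := fd _ ltr01.
have [c c0 fc] := has_deriv_cts fd b0.
exists (Num.min (Num.min a a') c); first by rewrite !lt_min a0 a'0 c0.
move=> w; rewrite !lt_min => /andP[/andP[/fa A /fa' A'] /fc /gb B].
have F : normc (f w - f z) <= K * normc (w - z).
  rewrite -(subrK (d * (w - z)) (f w - f z)) (le_trans (le_normcD _ _))//.
  rewrite normcM /K; move: A'; have := normc_ge0 (w - z); have := normc_ge0 d'.
  by move: (normc _) => X; nra.
have -> : g (f w) - g (f z) - d' * d * (w - z) =
  (g (f w) - g (f z) - d' * (f w - f z)) + d' * (f w - f z - d * (w - z)) by ring.
apply: (le_trans (le_normcD _ _)); rewrite normcM.
have X : normc (g (f w) - g (f z) - d' * (f w - f z)) <= e / (2 * K) * (K * normc (w - z)).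
  by apply: (le_trans B); rewrite ler_wpM2l// ltW.
have Y : normc d' * normc (f w - f z - d * (w - z)) <= K * (e / (2 * K) * normc (w - z)).
  by apply: ler_pM => //; rewrite ?normc_ge0// /K; have := normc_ge0 d; lra.
apply: (le_trans (lerD X Y)); rewrite le_eqVlt; apply/orP; left; apply/eqP.
by field; exact: lt0r_neq0.
Qed.

Lemma has_deriv_inv z : z != 0 -> has_deriv (fun w => w^-1) z (- z ^- 2).
Proof.
move=> z0 e e0; have nz : 0 < normc z by rewrite normc_gt0.
(* Within [normc z / 2] of [z] one has [normc w >= normc z / 2], so the remainder
   [(w - z)^2 / (z^2 w)] is at most [K * normc (w - z) ^+ 2]. *)
pose K := 2 / normc z ^+ 3.
have K0 : 0 < K by rewrite divr_gt0// exprn_gt0.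
exists (Num.min (normc z / 2) (e / K)); first by rewrite lt_min; apply/andP; split; exact: divr_gt0.
move=> w; rewrite lt_min => /andP[wz we].
have nw : normc z / 2 <= normc w.
  by have := lerB_normc z w; rewrite normcBC; lra.
have w0 : w != 0 by rewrite -normc_gt0; lra.
have -> : w^-1 - z^-1 - - z ^- 2 * (w - z) = (w - z) * ((w - z) / (z ^+ 2 * w)).
  by field; rewrite ?z0 ?w0.
rewrite normcM mulrC ler_wpM2r ?normc_ge0//.
rewrite normcf_div normcM normcX ler_pdivrMr; last first.
  by rewrite mulr_gt0 ?exprn_gt0// normc_gt0.
have : normc (w - z) * K <= e by rewrite -ler_pdivlMr// ltW.
have -> : normc (w - z) <= e * (normc z ^+ 2 * normc w) =
  (normc (w - z) / (normc z ^+ 2 * normc w) <= e).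
  by rewrite ler_pdivrMr// mulr_gt0 ?exprn_gt0// normc_gt0.
apply: le_trans; rewrite ler_wpM2l ?normc_ge0// /K.
rewrite -[leLHS]div1r ler_pdivrMr; last by rewrite mulr_gt0 ?exprn_gt0// normc_gt0.
rewrite mulrAC ler_pdivlMr ?exprn_gt0// mul1r exprSr.
by have := exprn_gt0 2 nz; nra.
Qed.

Lemma has_derivV f z d : f z != 0 -> has_deriv f z d ->
  has_deriv (fun w => (f w)^-1) z (- (f z) ^- 2 * d).
Proof. by move=> fz0 fd; apply: (has_deriv_comp fd); exact: has_deriv_inv. Qed.

Lemma has_derivX f z d n : has_deriv f z d -> exists d', has_deriv (fun w => f w ^+ n) z d'.
Proof.
move=> fd; elim: n => [|n [d' IH]]; first by exists 0; exact: has_deriv_cst.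
exists (d * f z ^+ n + f z * d').
by under eq_fun do rewrite exprS; exact: has_derivM fd IH.
Qed.

Lemma has_deriv_unique f z d d' : has_deriv f z d -> has_deriv f z d' -> d = d'.
Proof.
move=> fd fd'; apply/eqP; rewrite -subr_eq0 -normc_eq0; apply/eqP/le_anti.
rewrite normc_ge0 andbT; apply/ler_addgt0Pr => e e0; rewrite add0r.
have e2 : 0 < e / 2 by rewrite divr_gt0.
have [a a0 fa] := fd _ e2; have [b b0 fb] := fd' _ e2.
pose w := z + (Num.min a b / 2)%:C.
have m0 : 0 < Num.min a b by rewrite lt_min a0.
have wz : w - z = (Num.min a b / 2)%:C by rewrite /w addrC addKr.
have nwz : normc (w - z) = Num.min a b / 2 by rewrite wz normc_realE ger0_norm; lra.
have A : normc (w - z) < a.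
  by rewrite nwz; have : Num.min a b <= a; [rewrite ge_min lexx|lra].
have B : normc (w - z) < b.
  by rewrite nwz; have : Num.min a b <= b; [rewrite ge_min lexx orbT|lra].
have {}A := fa _ A; have {}B := fb _ B.
have P : 0 < normc (w - z) by rewrite nwz; lra.
rewrite -(ler_pM2r P) -normcM.
have -> : (d - d') * (w - z) = (f w - f z - d' * (w - z)) - (f w - f z - d * (w - z)) by ring.
by apply: (le_trans (le_normcB _ _)); nra.
Qed.

End Differentiation.

(** * Segment integrals, Goursat's theorem and primitives on a disc *)

Section Goursat.
Variable R : realType.
Local Notation C := R[i].
Local Notation Re := (@complex.Re _).
Local Notation Im := (@complex.Im _).
Implicit Types (f g : C -> C) (a b c z : C).

Lemma continuous_epsP (u : R -> R) (t : R) : {for t, continuous u} <->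
  forall e : R, 0 < e -> exists2 del : R, 0 < del &
    forall s, `|s - t| < del -> `|u s - u t| < e.
Proof.
split=> [cu e e0|H].
- move/cvgrPdist_lt : cu => /(_ e e0)/nbhs_ballP[del /= del0 H].
  exists del => // s st; rewrite distrC; apply: H.
  by rewrite /ball/= distrC.
- apply/cvgrPdist_lt => e e0; have [del del0 {}H] := H e e0.
  apply/nbhs_ballP; exists del => // s; rewrite /ball/= => st.
  by rewrite distrC; apply: H; rewrite distrC.
Qed.

Lemma contc_comp f (phi : R -> C) : (forall t : R, 0 <= t <= 1 -> cts f (phi t)) ->
  contc phi -> contc (fun t => f (phi t)).
Proof.
move=> cf [p1 p2].
have H t : 0 <= t <= 1 -> forall e : R, 0 < e -> exists2 del : R, 0 < del &
    forall s, `|s - t| < del -> normc (f (phi s) - f (phi t)) < e.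
  move=> t01 e /(cf t t01)[d d0 fd].
  have d2 : 0 < d / 2 by rewrite divr_gt0.
  have /continuous_epsP/(_ _ d2)[a a0 A] := p1 t t01.
  have /continuous_epsP/(_ _ d2)[b b0 B] := p2 t t01.
  exists (Num.min a b); first by rewrite lt_min a0.
  move=> s; rewrite lt_min => /andP[/A sa /B sb]; apply: fd.
  apply: (le_lt_trans (normc_leD _)).
  by rewrite complexReD complexImD complexReN complexImN; move: sa sb => /=; lra.
split=> t t01; apply/continuous_epsP => e e0; have [d d0 D] := H t t01 e e0;
  exists d => // s /D; apply: le_lt_trans.
- by apply: le_trans (ler_normRe _); rewrite complexReD complexReN.
- by apply: le_trans (ler_normIm _); rewrite complexImD complexImN.
Qed.

Lemma cont01_id : cont01 (@id R).
Proof. by move=> t _ ; exact: cvg_id. Qed.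

Lemma contc_real_id : contc (fun t : R => t%:C).
Proof. by apply: cont01_real; exact: cont01_id. Qed.

(** Replacing [t] by [1 - t] shows that the integral equals one minus itself. *)
Lemma rint_id : rint (@id R) = 2^-1.
Proof.
have := rint_rev cont01_id; rewrite rintB; [|exact: cont01_cst|exact: cont01_id].
by rewrite rint_cst; move: (rint _) => x; lra.
Qed.

Lemma contc_segment a b : contc (fun t : R => a + t%:C * b).
Proof.
apply: contcD; first exact: contc_cst.
by apply: contcM; [exact: contc_real_id|exact: contc_cst].
Qed.

Lemma segment_disc (rho : R) a b (t : R) : normc a < rho -> normc b < rho ->
  0 <= t <= 1 -> normc (a + t%:C * (b - a)) < rho.
Proof.
move=> ar br /andP[t0 t1].
have -> : a + t%:C * (b - a) = (1 - t)%:C * a + t%:C * b by rewrite rmorphB rmorph1; ring.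
apply: (le_lt_trans (le_normcD _ _)); rewrite !normcM !normc_realE !ger0_norm ?subr_ge0//.
have : Num.max (normc a) (normc b) < rho by rewrite gt_max ar.
have : normc a <= Num.max (normc a) (normc b) by rewrite le_max lexx.
have : normc b <= Num.max (normc a) (normc b) by rewrite le_max lexx orbT.
by move: (normc a) (normc b) (Num.max _ _) => A B M; nra.
Qed.

Lemma segment_dist a b (t : R) : 0 <= t <= 1 ->
  normc (a + t%:C * (b - a) - a) <= normc (b - a).
Proof.
move=> /andP[t0 t1]; rewrite addrAC subrr add0r normcM normc_realE ger0_norm//.
by rewrite ler_piMl// normc_ge0.
Qed.

Definition segint f a b := (b - a) * cint (fun t => f (a + t%:C * (b - a))).

Definition cts_disc (rho : R) f := forall z, normc z < rho -> cts f z.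

Lemma cts_segment rho f a b : cts_disc rho f -> normc a < rho -> normc b < rho ->
  contc (fun t => f (a + t%:C * (b - a))).
Proof.
move=> cf ar br; apply: contc_comp; last exact: contc_segment.
by move=> t t01; apply: cf; exact: segment_disc.
Qed.

Lemma segintB rho f g a b : cts_disc rho f -> cts_disc rho g ->
  normc a < rho -> normc b < rho ->
  segint (fun z => f z - g z) a b = segint f a b - segint g a b.
Proof.
move=> cf cg ar br; rewrite /segint cintB; [by rewrite mulrBr|exact: cts_segment cf _ _|
  exact: cts_segment cg _ _].
Qed.

Lemma ler_normc_segint rho f a b (M : R) : cts_disc rho f ->
  normc a < rho -> normc b < rho ->
  (forall t : R, 0 <= t <= 1 -> normc (f (a + t%:C * (b - a))) <= M) ->
  normc (segint f a b) <= normc (b - a) * M.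
Proof.
move=> cf ar br fM; rewrite normcM ler_wpM2l ?normc_ge0//.
by apply: ler_normc_cint_cst => //; exact: cts_segment cf _ _.
Qed.

(** The midpoint rule is exact on affine integrands. Their integrals around a triangle therefore
    cancel, which lets the affine part of [f] at a point be subtracted for free. *)
Lemma segint_affine (al be : C) a b :
  segint (fun z => al + be * z) a b = (b - a) * (al + be * (a + b) / 2).
Proof.
rewrite /segint; congr (_ * _).
rewrite (@cint_eq _ _ (fun t => (al + be * a) + (be * (b - a)) * t%:C)); last first.
  by move=> t _; ring.
have cid := contc_real_id; have cc k : contc (fun=> k) := contc_cst k.
rewrite cintD//; last exact: contcM.
by rewrite cint_cst cintZ// cint_real rint_id fmorphV/= rmorph_nat; field.
Qed.

Lemma half_C : ((2^-1 : R)%:C) = 2^-1 :> C.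
Proof. by rewrite fmorphV/= rmorph_nat. Qed.

Lemma normc_half z : normc (z / 2) = normc z / 2.
Proof. by rewrite normcM -half_C normc_realE ger0_norm. Qed.

Lemma segint_mid rho f a b : cts_disc rho f -> normc a < rho -> normc b < rho ->
  segint f a b = segint f a ((a + b) / 2) + segint f ((a + b) / 2) b.
Proof.
move=> cf ar br; rewrite /segint (cint_mid (cts_segment cf ar br)) mulrDr.
congr (_ + _).
- have -> : (a + b) / 2 - a = (b - a) / 2 by field.
  rewrite -[in RHS]mulrA; congr (_ * (_ * _)); apply: cint_eq => t _.
  by congr f; rewrite rmorphM/= half_C; field.
- have -> : b - (a + b) / 2 = (b - a) / 2 by field.
  rewrite -[in RHS]mulrA; congr (_ * (_ * _)); apply: cint_eq => t _.
  by congr f; rewrite rmorphD rmorphM/= half_C; field.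
Qed.

Lemma segint_rev rho f a b : cts_disc rho f -> normc a < rho -> normc b < rho ->
  segint f b a = - segint f a b.
Proof.
move=> cf ar br; rewrite /segint -(cint_rev (cts_segment cf ar br)) -mulNr opprB.
congr (_ * _); apply: cint_eq => t _; congr f; rewrite rmorphB rmorph1; ring.
Qed.

Definition triint f a b c := segint f a b + segint f b c + segint f c a.

Lemma triint_affine (al be : C) a b c : triint (fun z => al + be * z) a b c = 0.
Proof. by rewrite /triint !segint_affine; field. Qed.

Lemma midpoint_disc (rho : R) a b : normc a < rho -> normc b < rho -> normc ((a + b) / 2) < rho.
Proof. by move=> ar br; rewrite normc_half; have := le_normcD a b; lra. Qed.

(** All four pieces keep the orientation of the large triangle, so each inner edge is run through
    twice in opposite directions and cancels, leaving the halves of the outer edges. *)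
Lemma triint_split rho f a b c : cts_disc rho f ->
  normc a < rho -> normc b < rho -> normc c < rho ->
  let m1 := (a + b) / 2 in let m2 := (b + c) / 2 in let m3 := (c + a) / 2 in
  triint f a b c = triint f a m1 m3 + triint f m1 b m2 + triint f m3 m2 c + triint f m1 m2 m3.
Proof.
move=> cf ar br cr m1 m2 m3; rewrite /triint.
have m1r : normc m1 < rho by exact: midpoint_disc.
have m2r : normc m2 < rho by exact: midpoint_disc.
have m3r : normc m3 < rho by exact: midpoint_disc.
rewrite (segint_mid cf ar br) (segint_mid cf br cr) (segint_mid cf cr ar) -/m1 -/m2 -/m3.
rewrite (segint_rev cf m1r m2r) (segint_rev cf m2r m3r) (segint_rev cf m3r m1r).
clearbody m1 m2 m3; move: (segint f) => S; clear; ring.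
Qed.

Definition perim a b c := normc (b - a) + normc (c - b) + normc (a - c).

Lemma perim_ge0 a b c : 0 <= perim a b c.
Proof. by rewrite /perim !addr_ge0// normc_ge0. Qed.

(** The intervals of radius [2 * K / 2 ^+ n] around [u n] are nested, because this radius drops by
    exactly [K / 2 ^+ n] at each step; the supremum of their left ends lies in all of them. *)
Lemma geometric_cauchy (u : nat -> R) (K : R) :
  (forall n, `|u n.+1 - u n| <= K / 2 ^+ n) ->
  exists p, forall n, `|u n - p| <= 2 * K / 2 ^+ n.
Proof.
move=> uK.
have K0 : 0 <= K by have := uK 0%N; rewrite expr0 divr1; apply: le_trans.
have P n : 0 < 2 ^+ n :> R by exact: exprn_gt0.
have step n : 2 * K / 2 ^+ n.+1 = K / 2 ^+ n.
  by rewrite exprS; field; exact: lt0r_neq0.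
have twice n : 2 * K / 2 ^+ n = K / 2 ^+ n + K / 2 ^+ n by ring.
pose lo n := u n - 2 * K / 2 ^+ n; pose hi n := u n + 2 * K / 2 ^+ n.
have lo_up n : lo n <= lo n.+1.
  by rewrite /lo step twice; have := uK n; rewrite ler_norml => /andP[]; lra.
have hi_dn n : hi n.+1 <= hi n.
  by rewrite /hi step twice; have := uK n; rewrite ler_norml => /andP[]; lra.
have lohi n : lo n <= hi n.
  by rewrite /lo /hi; have : 0 <= 2 * K / 2 ^+ n; [rewrite divr_ge0// ?mulr_ge0// ltW|lra].
have lo_mono m n : (m <= n)%N -> lo m <= lo n.
  by move=> mn; apply: (@homo_leq _ lo (fun x y => x <= y)) => //; exact: le_trans.
have hi_mono m n : (m <= n)%N -> hi n <= hi m.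
  by move=> mn; apply: (@homo_leq _ hi (fun x y => y <= x)) => // y x z xy yz; exact: le_trans yz xy.
have lh m n : lo m <= hi n.
  apply: (le_trans (lo_mono m (maxn m n) (leq_maxl _ _))).
  by apply: (le_trans (lohi _)); apply: hi_mono; exact: leq_maxr.
pose A := range lo.
have ubA : has_ubound A by exists (hi 0%N) => _ [m _ <-].
have A0 : A !=set0 by exists (lo 0%N), 0%N.
exists (sup A) => n; rewrite ler_norml.
have h1 : lo n <= sup A by apply: ub_le_sup => //; exists n.
have h2 : sup A <= hi n by apply: ge_sup => // _ [m _ <-].
by move: h1 h2; rewrite /lo /hi; lra.
Qed.

Lemma geometric_cauchyC (u : nat -> C) (K : R) :
  (forall n, normc (u n.+1 - u n) <= K / 2 ^+ n) ->
  exists p, forall n, normc (u n - p) <= 4 * K / 2 ^+ n.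
Proof.
move=> uK.
have [|p pP] := @geometric_cauchy (Re \o u) K.
  by move=> n; apply: le_trans (uK n) => /=; rewrite -complexReN -complexReD; exact: ler_normRe.
have [|q qP] := @geometric_cauchy (Im \o u) K.
  by move=> n; apply: le_trans (uK n) => /=; rewrite -complexImN -complexImD; exact: ler_normIm.
exists (p +i* q) => n; apply: (le_trans (normc_leD _)).
rewrite complexReD complexImD complexReN complexImN /=.
by apply: (le_trans (lerD (pP n) (qP n))); rewrite -!mulrA; move: (K / _) => x; lra.
Qed.

Definition holo (rho : R) f := forall z, normc z < rho -> exists d, has_deriv f z d.

Lemma holo_cts rho f : holo rho f -> cts_disc rho f.
Proof. by move=> hf z /hf[d]; exact: has_deriv_cts. Qed.

Lemma exprn_big (e K : R) : 0 < e -> exists n, K / 2 ^+ n < e.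
Proof.
move=> e0.
have [n] : exists n, K / e < n%:R.
  by exists (Num.bound `|K / e|); apply: le_lt_trans (ler_norm _) (archi_boundP _).
move=> p; exists n; rewrite ltr_pdivrMr ?exprn_gt0//.
rewrite mulrC -ltr_pdivrMr//; apply: (lt_le_trans p).
by rewrite -natrX ler_nat ltnW// ltn_expl.
Qed.

(** Bisection: one of the four pieces carries at least a quarter of the integral, at half the
    perimeter. The pieces shrink to a point [p], near which [f] is affine up to [o(|w - p|)]; so the
    [n]-th integral is [o(4^-n)], while it is at least [4^-n] times the original one. *)
Lemma goursat rho f a b c : holo rho f ->
  normc a < rho -> normc b < rho -> normc c < rho -> triint f a b c = 0.
Proof.
move=> hf ar br cr; have cf := holo_cts hf.
(* All vertices stay in the closed disc of radius [r < rho], hence so does their limit [p], where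
   differentiability of [f] is needed. *)
pose r := Num.max (normc a) (Num.max (normc b) (normc c)).
have rrho : r < rho by rewrite !gt_max ar br cr.
pose T (s : C * C * C) := triint f s.1.1 s.1.2 s.2.
pose L (s : C * C * C) := perim s.1.1 s.1.2 s.2.
pose valid (s : C * C * C) := [/\ normc s.1.1 <= r, normc s.1.2 <= r & normc s.2 <= r].
have mid x y : normc x <= r -> normc y <= r -> normc ((x + y) / 2) <= r.
  by move=> xr yr; rewrite normc_half; have := le_normcD x y; lra.
have : forall s, exists s', valid s -> [/\ valid s', normc (T s) <= 4 * normc (T s'),
   L s' = L s / 2 & normc (s'.1.1 - s.1.1) <= L s].
  move=> [[x y] z].
  have [vs|] := pselect (valid (x, y, z)); last by exists (x, y, z).
  case: (vs) => /= xr yr zr.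
  pose m1 := (x + y) / 2; pose m2 := (y + z) / 2; pose m3 := (z + x) / 2.
  have := @triint_split rho f x y z cf (le_lt_trans xr rrho) (le_lt_trans yr rrho) (le_lt_trans zr rrho).
  rewrite -/m1 -/m2 -/m3 /= => E.
  have m1r := mid _ _ xr yr; have m2r := mid _ _ yr zr; have m3r := mid _ _ zr xr.
  have h1 : normc (m1 - x) = normc (y - x) / 2 by rewrite -normc_half; congr normc; rewrite /m1; field.
  have h2 : normc (y - m1) = normc (y - x) / 2 by rewrite -normc_half; congr normc; rewrite /m1; field.
  have h3 : normc (m2 - y) = normc (z - y) / 2 by rewrite -normc_half; congr normc; rewrite /m2; field.
  have h4 : normc (z - m2) = normc (z - y) / 2 by rewrite -normc_half; congr normc; rewrite /m2; field.
  have h5 : normc (m3 - z) = normc (x - z) / 2 by rewrite -normc_half; congr normc; rewrite /m3; field.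
  have h6 : normc (x - m3) = normc (x - z) / 2 by rewrite -normc_half; congr normc; rewrite /m3; field.
  have h7 : normc (m3 - m1) = normc (z - y) / 2 by rewrite -normc_half; congr normc; rewrite /m3 /m1; field.
  have h8 : normc (m1 - m2) = normc (x - z) / 2 by rewrite -normc_half; congr normc; rewrite /m2 /m1; field.
  have h9 : normc (m2 - m3) = normc (y - x) / 2 by rewrite -normc_half; congr normc; rewrite /m2 /m3; field.
  have Lge := perim_ge0 x y z.
  have n1 := normc_ge0 (y - x); have n2 := normc_ge0 (z - y); have n3 := normc_ge0 (x - z).
  (* The first piece that reaches a quarter of the total is kept. If none did, [triint_split] and
     the triangle inequality would contradict each other. *)
  pose X := normc (triint f x y z) / 4.
  have [t1|] := leP X (normc (T (x, m1, m3))).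
    exists (x, m1, m3) => _; split => //=.
    - by move: t1; rewrite /X /T/=; clear; lra.
    - by rewrite /L /perim /= h1 h6 h7; clear; lra.
    - by rewrite subrr normc0.
  have [t2 _|] := leP X (normc (T (m1, y, m2))).
    exists (m1, y, m2) => _; split => //=.
    - by move: t2; rewrite /X /T/=; clear; lra.
    - by rewrite /L /perim /= h2 h3 h8; clear; lra.
    - by rewrite h1 /L /perim/=; move: n1 n2 n3; clear; lra.
  have [t3 _ _|] := leP X (normc (T (m3, m2, z))).
    exists (m3, m2, z) => _; split => //=.
    - by move: t3; rewrite /X /T/=; clear; lra.
    - by rewrite /L /perim /= h9 h4 h5; clear; lra.
    - by rewrite normcBC h6 /L /perim/=; move: n1 n2 n3; clear; lra.
  have [t4 _ _ _|] := leP X (normc (T (m1, m2, m3))).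
    exists (m1, m2, m3) => _; split => //=.
    - by move: t4; rewrite /X /T/=; clear; lra.
    - by rewrite /L /perim /= (normcBC m2 m1) (normcBC m3 m2) (normcBC m1 m3) h7 h8 h9; clear; lra.
    - by rewrite h1 /L /perim/=; move: n1 n2 n3; clear; lra.
  rewrite /T /= => t4 t3 t2 t1; exfalso.
  have := le_normcD (triint f x m1 m3 + triint f m1 y m2 + triint f m3 m2 z) (triint f m1 m2 m3).
  have := le_normcD (triint f x m1 m3 + triint f m1 y m2) (triint f m3 m2 z).
  have := le_normcD (triint f x m1 m3) (triint f m1 y m2).
  by rewrite -E; move: t1 t2 t3 t4; rewrite /X; clear; lra.
move=> /choice[nxt nxtP].
pose s n := iter n nxt (a, b, c).
have sv n : valid (s n).
  elim: n => [|n IH]; last by have [] := nxtP _ IH.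
  by split; rewrite /r !le_max lexx ?orbT.
have sL n : L (s n) = perim a b c / 2 ^+ n.
  elim: n => [|n IH]; first by rewrite expr0 divr1.
  have [_ _ -> _] := nxtP _ (sv n); rewrite IH exprS; field.
  by rewrite expf_neq0.
have sT n : normc (triint f a b c) <= 4 ^+ n * normc (T (s n)).
  elim: n => [|n IH]; first by rewrite expr0 mul1r.
  apply: (le_trans IH); have [_ h _ _] := nxtP _ (sv n).
  by rewrite exprSr -mulrA ler_wpM2l// exprn_ge0.
have [|p pP] := @geometric_cauchyC (fun n => (s n).1.1) (perim a b c).
  by move=> n; have [_ _ _] := nxtP _ (sv n); rewrite sL.
set P := perim a b c in sL pP.
have P0 : 0 <= P by exact: perim_ge0.
have pr : normc p < rho.
  apply: le_lt_trans rrho; apply/ler_addgt0Pr => e e0.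
  have [n nP] := exprn_big (4 * P) e0.
  have [v _ _] := sv n.
  have := lerB_normc p (s n).1.1; rewrite normcBC; have := pP n.
  by lra.
have [d fd] := hf p pr.
suff : normc (triint f a b c) <= 0.
  by rewrite le_eqVlt ltNge normc_ge0 orbF normc_eq0 => /eqP.
apply/ler_addgt0Pr => e e0; rewrite add0r.
have P21 : 0 < P ^+ 2 + 1 by apply: ltr_wpDl => //; exact: sqr_ge0.
(* With [q = P / 2 ^+ n], the first vertex is within [4 * q] of [p] and the edges are within [q] of
   that vertex: hence the 5. Dividing by [P ^+ 2 + 1] absorbs the square of the perimeter and is
   safe for a degenerate triangle. *)
have K0 : 0 < 5 * (P ^+ 2 + 1) by rewrite mulr_gt0.
have eK : 0 < e / (5 * (P ^+ 2 + 1)) by rewrite divr_gt0.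
have [del del0 D] := fd _ eK.
have [n nP] := exprn_big (5 * P) del0.
case: (sv n) => v1 v2 v3.
set x := (s n).1.1 in v1; set y := (s n).1.2 in v2; set z := (s n).2 in v3.
have xr : normc x < rho by exact: le_lt_trans rrho.
have yr : normc y < rho by exact: le_lt_trans rrho.
have zr : normc z < rho by exact: le_lt_trans rrho.
pose al := f p - d * p.
pose g w := f w - (al + d * w).
have caff : cts_disc rho (fun w => al + d * w).
  move=> w _; apply: has_deriv_cts; apply: has_derivD; first exact: has_deriv_cst.
  by apply: has_derivZ; exact: has_deriv_id.
have gT : T (s n) = triint g x y z.
  have := triint_affine al d x y z.
  rewrite /T /g /triint !(segintB cf caff)// => E.
  rewrite -[LHS]subr0 -E -/x -/y -/z; clear; ring.
have Ln : perim x y z = P / 2 ^+ n by rewrite -sL.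
set q := P / 2 ^+ n in Ln.
have q0 : 0 <= q by rewrite divr_ge0// exprn_ge0.
have cg : cts_disc rho g.
  move=> w /hf[dw fw]; apply: has_deriv_cts; apply: has_derivB; first exact: fw.
  apply: has_derivD; first exact: has_deriv_cst.
  by apply: has_derivZ; exact: has_deriv_id.
set eK' := e / _ in eK D.
have bound u v : normc u < rho -> normc v < rho -> normc (u - x) <= q -> normc (v - x) <= q ->
   normc (segint g u v) <= normc (v - u) * (eK' * (5 * q)).
  move=> ur vr ux vx; apply: (ler_normc_segint cg) => // t /andP[t0 t1].
  pose w := u + t%:C * (v - u); rewrite -/w.
  have wx : normc (w - x) <= q.
    have -> : w - x = (1 - t)%:C * (u - x) + t%:C * (v - x).
      by rewrite /w rmorphB rmorph1; ring.
    apply: (le_trans (le_normcD _ _)); rewrite !normcM !normc_realE !ger0_norm ?subr_ge0//.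
    by move: t0 t1 ux vx; clear; nra.
  have wp : normc (w - p) <= 5 * q.
    apply: (le_trans (normc_triangle x _ _)); have := pP n; rewrite -/x.
    by rewrite -mulrA -/q; move: wx; clear; lra.
  have wdel : normc (w - p) < del by apply: (le_lt_trans wp); rewrite /q mulrA.
  have := D w wdel.
  have -> : f w - f p - d * (w - p) = g w by rewrite /g /al; ring.
  by move/le_trans; apply; rewrite ler_wpM2l// ltW.
have n1 := normc_ge0 (y - x); have n2 := normc_ge0 (z - y); have n3 := normc_ge0 (x - z).
have hx : normc (x - x) <= q by rewrite subrr normc0.
have hy : normc (y - x) <= q by move: Ln n2 n3; rewrite /perim; clear; lra.
have hz : normc (z - x) <= q by rewrite normcBC; move: Ln n1 n2; rewrite /perim; clear; lra.
have TB : normc (T (s n)) <= q * (eK' * (5 * q)).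
  rewrite gT /triint; apply: (le_trans (le_normcD _ _)).
  apply: (le_trans (lerD (le_normcD _ _) (lexx _))).
  apply: (le_trans (lerD (lerD (bound _ _ xr yr hx hy) (bound _ _ yr zr hy hz)) (bound _ _ zr xr hz hx))).
  by rewrite -!mulrDl -/(perim x y z) Ln.
apply: (le_trans (sT n)).
apply: (@le_trans _ _ (4 ^+ n * (q * (eK' * (5 * q))))).
  by rewrite ler_wpM2l// exprn_ge0.
have -> : 4 ^+ n * (q * (eK' * (5 * q))) = e * (P ^+ 2 / (P ^+ 2 + 1)).
  rewrite /q /eK' (_ : 4 = 2 ^+ 2 :> R); last by rewrite -natrX.
  rewrite -exprM mulnC exprM; field.
  by rewrite expf_neq0//= lt0r_neq0// P21.
by rewrite ler_piMr ?(ltW e0)// ler_pdivrMr ?mul1r// lerDl.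
Qed.

Lemma segint_chasles rho f a b c : holo rho f ->
  normc a < rho -> normc b < rho -> normc c < rho ->
  segint f a c - segint f a b = segint f b c.
Proof.
move=> hf ar br cr; have := goursat hf ar br cr; rewrite /triint.
rewrite (segint_rev (holo_cts hf) ar cr) => /eqP; rewrite subr_eq0 => /eqP <-; ring.
Qed.

Lemma segint_near rho f a b k (M : R) : cts_disc rho f -> normc a < rho -> normc b < rho ->
  (forall t : R, 0 <= t <= 1 -> normc (f (a + t%:C * (b - a)) - k) <= M) ->
  normc (segint f a b - (b - a) * k) <= normc (b - a) * M.
Proof.
move=> cf ar br fk.
have ck : cts_disc rho (fun=> k) by move=> z _; apply: has_deriv_cts; exact: has_deriv_cst.
have <- : segint (fun=> k) a b = (b - a) * k by rewrite /segint cint_cst.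
rewrite -(segintB cf ck)//; apply: (@ler_normc_segint rho) => //.
move=> z /cf fz e e0; have [del del0 H] := fz e e0.
  by exists del => // w /H; congr (normc _ < _); ring.
Qed.

Definition primitive f z := segint f 0 z.

Lemma primitiveB rho f a b : 0 < rho -> holo rho f -> normc a < rho -> normc b < rho ->
  primitive f b - primitive f a = segint f a b.
Proof. by move=> r0 hf ar br; apply: (segint_chasles hf) => //; rewrite normc0. Qed.

Lemma primitive_has_deriv rho f z : holo rho f -> normc z < rho -> has_deriv (primitive f) z (f z).
Proof.
move=> hf zr e e0; have rho0 : 0 < rho by apply: le_lt_trans zr; exact: normc_ge0.
have cf := holo_cts hf; have [del del0 D] := cf z zr e e0.
exists (Num.min del (rho - normc z)); first by rewrite lt_min del0 subr_gt0.
move=> w; rewrite lt_min => /andP[wd wr].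
have wrho : normc w < rho by have := lerB_normc w z; lra.
rewrite (primitiveB rho0 hf)// mulrC [e * _]mulrC.
apply: (segint_near cf) => // t t01; apply: ltW; apply: D.
exact: le_lt_trans (segment_dist _ _ t01) wd.
Qed.

End Goursat.

(** * Cauchy's formula and Taylor expansions *)

Section Circle.
Variable R : realType.
Local Notation C := R[i].
Local Notation Re := (@complex.Re _).
Local Notation Im := (@complex.Im _).
Implicit Types (f g F G : C -> C) (a b c z : C).

Lemma is_derive_epsP (u : R -> R) (t d : R) : is_derive t 1 u d <->
  forall e : R, 0 < e -> exists2 del : R, 0 < del &
    forall s, `|s - t| < del -> `|u s - u t - d * (s - t)| <= e * `|s - t|.
Proof.
split=> [[du dE] e e0|H].
- have /cvgrPdist_le/(_ e e0) : h^-1 *: (u (h *: (1 : R) + t) - u t) @[h --> 0^'] --> d.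
    by rewrite -dE; exact: du.
  rewrite /dnbhs /within/= => /nbhs_ballP[del /= del0 D].
  exists del => // s st; have [->|st0] := eqVneq s t; first by rewrite !subrr mulr0 subrr normr0 mulr0.
  have := D (s - t); rewrite /ball/= sub0r normrN subr_eq0 st0 => /(_ st isT).
  rewrite /GRing.scale/= mulr1 subrK distrC.
  have st' : 0 < `|s - t| by rewrite normr_gt0 subr_eq0.
  rewrite -[X in X <= _](@mulfK _ `|s - t|) ?gt_eqF// -normrM => h.
  rewrite -ler_pdivrMr//; apply: le_trans h.
  by rewrite ler_pM2r ?invr_gt0// mulrBl mulrAC mulVf ?mul1r// subr_eq0.
- have cv : h^-1 *: (u (h *: (1 : R) + t) - u t) @[h --> 0^'] --> d.
    apply/cvgrPdist_le => e e0; have [del del0 D] := H e e0.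
    rewrite /dnbhs /within/=; apply/nbhs_ballP; exists del => // h /=.
    rewrite /ball/= sub0r normrN => hd h0; rewrite /GRing.scale/= mulr1.
    have := D (h + t); rewrite addrK => /(_ hd).
    rewrite distrC -ler_pdivrMr ?normr_gt0// -normfV -normrM; apply: le_trans.
    by rewrite le_eqVlt; apply/orP; left; apply/eqP; congr `|_|; field.
  apply: DeriveDef; first by apply/cvg_ex; exists d.
  by apply/cvg_lim => //; exact: Rhausdorff.
Qed.

Lemma path_deriv_Re phi (t : R) d : path_deriv phi t d -> is_derive t 1 (Re \o phi) (Re d).
Proof.
move=> H; apply/is_derive_epsP => e e0; have [del del0 D] := H e e0.
exists del => // s /D; apply: le_trans; apply: le_trans (ler_normRe _).
by rewrite !(complexReD, complexReN, complexReM)/= mulr0 subr0.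
Qed.

Lemma path_deriv_Im phi (t : R) d : path_deriv phi t d -> is_derive t 1 (Im \o phi) (Im d).
Proof.
move=> H; apply/is_derive_epsP => e e0; have [del del0 D] := H e e0.
exists del => // s /D; apply: le_trans; apply: le_trans (ler_normIm _).
by rewrite !(complexImD, complexImN, complexImM)/= mulr0 add0r.
Qed.

Lemma path_derivP phi (t : R) d : is_derive t 1 (Re \o phi) (Re d) ->
  is_derive t 1 (Im \o phi) (Im d) -> path_deriv phi t d.
Proof.
move=> /is_derive_epsP H /is_derive_epsP K e e0; have e2 : 0 < e / 2 by rewrite divr_gt0.
have [a a0 A] := H _ e2; have [b b0 B] := K _ e2.
exists (Num.min a b); first by rewrite lt_min a0.
move=> s; rewrite lt_min => /andP[/A {}A /B {}B].
apply: (le_trans (normc_leD _)).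
rewrite !(complexReD, complexReN, complexReM)/= mulr0 subr0.
rewrite !(complexImD, complexImN, complexImM)/= mulr0 add0r.
by move: A B => /=; lra.
Qed.

Lemma has_deriv_path_deriv F (phi : R -> C) (t : R) d d' : has_deriv F (phi t) d -> path_deriv phi t d' ->
  path_deriv (fun s => F (phi s)) t (d * d').
Proof.
move=> Fd pd e e0.
pose K := normc d + normc d' + 1.
have K0 : 0 < K by rewrite /K; have := normc_ge0 d; have := normc_ge0 d'; lra.
have e1 : 0 < e / (2 * K) by rewrite divr_gt0// mulr_gt0.
have [b b0 gb] := Fd _ e1.
have [a a0 fa] := pd _ e1; have [a' a'0 fa'] := pd _ ltr01.
exists (Num.min (Num.min a a') (b / K)); first by rewrite !lt_min a0 a'0 divr_gt0.
move=> s; rewrite !lt_min => /andP[/andP[/fa A /fa' A']]; rewrite ltr_pdivlMr// => sb.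
have P : normc (phi s - phi t) <= K * `|s - t|.
  rewrite -(subrK (d' * (s - t)%:C) (phi s - phi t)) (le_trans (le_normcD _ _))//.
  rewrite normcM normc_realE /K; move: A'; have := normr_ge0 (s - t); have := normc_ge0 d.
  by move: (normc _) => X; nra.
have B : normc (phi s - phi t) < b by rewrite (le_lt_trans P)// mulrC.
have {}B := gb _ B.
have -> : F (phi s) - F (phi t) - d * d' * (s - t)%:C =
  (F (phi s) - F (phi t) - d * (phi s - phi t)) + d * (phi s - phi t - d' * (s - t)%:C) by ring.
apply: (le_trans (le_normcD _ _)); rewrite normcM.
have X : normc (F (phi s) - F (phi t) - d * (phi s - phi t)) <= e / (2 * K) * (K * `|s - t|).
  by apply: (le_trans B); rewrite ler_wpM2l// ltW.
have Y : normc d * normc (phi s - phi t - d' * (s - t)%:C) <= K * (e / (2 * K) * `|s - t|).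
  by apply: ler_pM => //; rewrite ?normc_ge0// /K; have := normc_ge0 d'; lra.
apply: (le_trans (lerD X Y)); rewrite le_eqVlt; apply/orP; left; apply/eqP.
by field; exact: lt0r_neq0.
Qed.

(** This is [exp(2 pi i t)], so that integrals over [[0, 1]] are integrals for normalised arc
    length. *)
Definition ec (t : R) : C := circle_param t.

Lemma normc_ec t : normc (ec t) = 1.
Proof. by rewrite /ec/circle_param/= cos2Dsin2 sqrtr1. Qed.

Lemma ec_neq0 t : ec t != 0.
Proof. by rewrite -normc_gt0 normc_ec. Qed.

Lemma ecV t : (ec t)^-1 = (ec t)^*.
Proof. by apply: (mulfI (ec_neq0 t)); rewrite divff ?ec_neq0// mulcJ normc_ec expr1n. Qed.

Definition twopii : C := 0 +i* (2 * pi).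

Lemma twopii_neq0 : twopii != 0.
Proof. by rewrite eq_complex/= eqxx/= mulf_neq0 ?pnatr_eq0// gt_eqF// pi_gt0. Qed.

Lemma path_deriv_ec (t : R) : path_deriv ec t (twopii * ec t).
Proof.
have dl : is_derive (t : R) (1 : R) (fun s : R => 2 * pi * s) (2 * pi).
  by apply: is_derive_eq; rewrite /GRing.scale/= mulr1.
apply: path_derivP.
- have -> : Re (twopii * ec t) = - sin (2 * pi * t) * (2 * pi) by rewrite complexReM/=; ring.
  exact: (is_derive1_comp (is_derive_cos (2 * pi * t)) dl).
- have -> : Im (twopii * ec t) = cos (2 * pi * t) * (2 * pi) by rewrite complexImM/=; ring.
  exact: (is_derive1_comp (is_derive_sin (2 * pi * t)) dl).
Qed.

Lemma path_deriv_cont phi (t : R) d : path_deriv phi t d ->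
  {for t, continuous (Re \o phi)} /\ {for t, continuous (Im \o phi)}.
Proof.
move=> pd; split; apply: differentiable_continuous; apply/derivable1_diffP.
- by have := path_deriv_Re pd => ?; exact: ex_derive.
- by have := path_deriv_Im pd => ?; exact: ex_derive.
Qed.

Lemma contc_ec : contc ec.
Proof. by split=> t _; have [] := path_deriv_cont (path_deriv_ec t). Qed.

Lemma path_derivD_cst phi (t : R) k d : path_deriv phi t d -> path_deriv (fun s => k * phi s) t (k * d).
Proof.
move=> pd.
by have := has_deriv_path_deriv (has_derivZ k (has_deriv_id (phi t))) pd; rewrite mulr1.
Qed.

Lemma ec0 : ec 0 = 1.
Proof. by rewrite /ec/circle_param mulr0 cos0 sin0. Qed.

Lemma ec1 : ec 1 = 1.
Proof. by rewrite /ec/circle_param mulr1 [2 * pi]mulr_natl cos2pi sin2pi. Qed.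

Definition rad (r : R) (t : R) : C := r%:C * ec t.

Lemma normc_rad (r t : R) : normc (rad r t) = `|r|.
Proof. by rewrite normcM normc_ec mulr1 normc_realE. Qed.

Lemma contc_rad (r : R) : contc (rad r).
Proof. by apply: contcM; [exact: contc_cst|exact: contc_ec]. Qed.

(** Up to the factor [2 pi i r], the integrand is the derivative of [G] along the circle, and the
    circle closes up since [ec 0 = ec 1]. *)
Lemma cint_circle (r : R) G g : 0 < r -> contc (fun t => g (rad r t)) ->
  (forall t : R, 0 <= t <= 1 -> has_deriv G (rad r t) (g (rad r t))) ->
  cint (fun t => g (rad r t) * ec t) = 0.
Proof.
move=> r0 cg Gg.
have ce := contc_ec; have cge := contcM cg ce.
have pd (t : R) : 0 <= t <= 1 ->
    path_deriv (fun s => G (rad r s)) t (r%:C * twopii * (g (rad r t) * ec t)).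
  move=> /Gg Ggt.
  have -> : r%:C * twopii * (g (rad r t) * ec t) = g (rad r t) * (r%:C * (twopii * ec t)) by ring.
  by apply: (has_deriv_path_deriv Ggt); apply: path_derivD_cst; exact: path_deriv_ec.
have k0 : r%:C * twopii != 0.
  by rewrite mulf_neq0 ?twopii_neq0// eq_complex/= eqxx andbT gt_eqF.
apply: (mulfI k0); rewrite mulr0 -cintZ//.
transitivity (G (rad r 1) - G (rad r 0)); last by rewrite /rad ec1 ec0 subrr.
apply: (@cint_FTC _ _ (fun s => G (rad r s))).
- by apply: contcM => //; exact: contc_cst.
- by move=> t /pd; exact: path_deriv_Re.
- by move=> t /pd; exact: path_deriv_Im.
Qed.

Lemma rad_disc (rho r t : R) : 0 < r < rho -> normc (rad r t) < rho.
Proof. by move=> /andP[r0 rr]; rewrite normc_rad gtr0_norm. Qed.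

Lemma holo_contc rho f (r : R) : holo rho f -> 0 < r < rho -> contc (fun t => f (rad r t)).
Proof.
move=> hf rr; apply: contc_comp; last exact: contc_rad.
by move=> t _; apply: (holo_cts hf); exact: rad_disc.
Qed.

Lemma cauchy_circle rho f (r : R) : holo rho f -> 0 < r < rho ->
  cint (fun t => f (rad r t) * ec t) = 0.
Proof.
move=> hf rr; case/andP: (rr) => r0 _.
apply: (@cint_circle r (primitive f)) => //; first exact: holo_contc hf rr.
by move=> t _; apply: (primitive_has_deriv hf); exact: rad_disc.
Qed.

Lemma cint_ecX k : cint (fun t => ec t ^+ k.+1) = 0.
Proof.
rewrite (@cint_eq _ _ (fun t => (rad 1 t) ^+ k * ec t)); last first.
  by move=> t _; rewrite /rad mul1r exprSr.
apply: (@cauchy_circle 2 (fun z => z ^+ k)); last by rewrite ltr01 ltr1n.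
by move=> z _; exact: has_derivX (has_deriv_id z).
Qed.

Lemma cint_ecVX k : cint (fun t => (ec t)^-1 ^+ k.+1) = 0.
Proof.
rewrite (@cint_eq _ _ (fun t => (ec t ^+ k.+1)^*)); last first.
  by move=> t _; rewrite ecV rmorphXn.
rewrite cintJ; first by rewrite cint_ecX rmorph0.
by apply: contcX; exact: contc_ec.
Qed.

Lemma contcV phi : contc phi -> (forall t : R, 0 <= t <= 1 -> phi t != 0) ->
  contc (fun t => (phi t)^-1).
Proof.
move=> cp p0; apply: contc_comp => // t t01.
by apply: has_deriv_cts; apply: has_deriv_inv; exact: p0.
Qed.

Lemma contc_ecV : contc (fun t => (ec t)^-1).
Proof. by apply: contcV => [|t _]; [exact: contc_ec|exact: ec_neq0]. Qed.

(* [cker r a t dt] is [dz / (2 pi i (z - a))] for [z = rad r t]. *)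
Definition cker (r : R) a t : C := rad r t / (rad r t - a).

Lemma rad_ge (r t : R) a : normc a < r -> r - normc a <= normc (rad r t - a).
Proof.
move=> ar; have := lerB_normc (rad r t) a; rewrite normc_rad gtr0_norm//.
exact: le_lt_trans (normc_ge0 _) ar.
Qed.

Lemma rad_neq (r t : R) a : normc a < r -> rad r t - a != 0.
Proof. by move=> ar; rewrite -normc_gt0; have := rad_ge t ar; lra. Qed.

Lemma contc_radV (r : R) a : normc a < r -> contc (fun t => (rad r t - a)^-1).
Proof.
move=> ar; apply: contcV => [|t _]; last exact: rad_neq.
by apply: contcB; [exact: contc_rad|exact: contc_cst].
Qed.

Lemma contc_cker (r : R) a : normc a < r -> contc (cker r a).
Proof. by move=> ar; apply: contcM; [exact: contc_rad|exact: contc_radV]. Qed.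

Lemma ler_cker (r t : R) a : normc a < r -> normc (cker r a t) <= r / (r - normc a).
Proof.
move=> ar; have r0 : 0 < r by exact: le_lt_trans (normc_ge0 _) ar.
rewrite normcf_div normc_rad gtr0_norm// ler_wpM2l ?(ltW r0)// lef_pV2 ?posrE ?subr_gt0//.
  exact: rad_ge.
by rewrite normc_gt0 rad_neq.
Qed.

(** [cker r a t] is [1 / (1 - x)] for [x = a / rad r t]. The finite geometric sum is kept with its
    exact remainder, so that it can be integrated term by term without any convergence of series. *)
Lemma cker_geometric (r t : R) a n : normc a < r ->
  cker r a t = \sum_(k < n) (a / r%:C) ^+ k * (ec t)^-1 ^+ k
    + (a / r%:C) ^+ n * ((ec t)^-1 ^+ n * cker r a t).
Proof.
move=> ar; have r0 : 0 < r by exact: le_lt_trans (normc_ge0 _) ar.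
have rc0 : r%:C != 0 :> C by rewrite eq_complex/= eqxx andbT gt_eqF.
elim: n => [|n {1}->]; first by rewrite big_ord0 add0r !expr0 !mul1r.
rewrite big_ord_recr/= -addrA; congr (_ + _).
rewrite !exprS /cker /rad; set X := (a / r%:C) ^+ n; set Y := (ec t)^-1 ^+ n.
by field; rewrite ec_neq0 rc0 -/(rad r t) rad_neq.
Qed.

Lemma exprn_to0 (x : R) : 0 <= x < 1 -> forall e : R, 0 < e ->
  exists N, forall n, (N <= n)%N -> x ^+ n < e.
Proof.
move=> /andP[x0 x1] e e0.
have : x ^+ n @[n --> \oo] --> (0 : R) by apply: cvg_expr; rewrite ger0_norm.
move=> /cvgrPdist_lt/(_ e e0)[N _ H]; exists N => n Nn.
have := H n Nn; rewrite sub0r normrN ger0_norm//; exact: exprn_ge0.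
Qed.

Lemma normc_div_real (r : R) a : 0 < r -> normc (a / r%:C) = normc a / r.
Proof. by move=> r0; rewrite normcf_div normc_realE gtr0_norm. Qed.

(** In the geometric expansion only the constant term has nonzero mean, and the remainder is at most
    [(normc a / r)^n] times [r / (r - normc a)]. *)
Lemma cint_cker (r : R) a : normc a < r -> cint (cker r a) = 1.
Proof.
move=> ar; have r0 : 0 < r by exact: le_lt_trans (normc_ge0 _) ar.
apply/eqP; rewrite -subr_eq0 -normc_eq0; apply/eqP/le_anti; rewrite normc_ge0 andbT.
apply/ler_addgt0Pr => e e0; rewrite add0r.
have d0 : 0 < r / (r - normc a) by rewrite divr_gt0// subr_gt0.
have q01 : 0 <= normc a / r < 1.
  by rewrite divr_ge0 ?normc_ge0 ?(ltW r0)//= ltr_pdivrMr// mul1r.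
have [N /(_ N.+1 (leqnSn _)) HN] := exprn_to0 q01 (divr_gt0 e0 d0).
have cV := contc_ecV; have cc k : contc (fun=> k) := contc_cst k.
have ck := contc_cker ar.
have -> : cint (cker r a) = 1 + cint (fun t =>
    (a / r%:C) ^+ N.+1 * ((ec t)^-1 ^+ N.+1 * cker r a t)).
  rewrite [LHS](cint_eq (fun t _ => @cker_geometric r t a N.+1 ar)) cintD.
  - congr (_ + _); rewrite (@cint_sum _ N.+1 (fun k t => (a / r%:C) ^+ k * (ec t)^-1 ^+ k)); last first.
      by move=> k; apply: contcM => //; exact: contcX.
    rewrite big_ord_recl expr0 big1 ?addr0.
      by rewrite -[RHS]cint_cst; apply: cint_eq => t _; rewrite expr0 mul1r.
    move=> k _; rewrite cintZ; last exact: contcX.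
    by rewrite /bump/= cint_ecVX mulr0.
  - apply: (@contc_sum _ N.+1 (fun k t => (a / r%:C) ^+ k * (ec t)^-1 ^+ k)) => k.
    by apply: contcM => //; exact: contcX.
  - by apply: contcM => //; apply: contcM => //; exact: contcX.
rewrite addrC addKr; apply: ler_normc_cint_cst.
  by apply: contcM => //; apply: contcM => //; exact: contcX.
move=> t _; have := ler_cker t ar; move: (cker r a t) => X HX.
rewrite !normcM normcX normc_div_real// normcX normcV normc_ec invr1 expr1n mul1r.
move: HN; rewrite ltr_pdivlMr// => /ltW; apply: le_trans.
by apply: ler_wpM2l; [apply: exprn_ge0; case/andP: q01|].
Qed.

Lemma has_deriv_near f g z d (del : R) : 0 < del ->
  (forall w, normc (w - z) < del -> f w = g w) -> has_deriv g z d -> has_deriv f z d.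
Proof.
move=> del0 fg gd e e0; have [a a0 A] := gd e e0.
exists (Num.min a del); first by rewrite lt_min a0.
move=> w; rewrite lt_min => /andP[wa wd]; rewrite !fg//; first exact: A.
by rewrite subrr normc0.
Qed.

(* The difference quotient of a primitive [F] of [f] is differentiable at [a] itself:
   its increment is a segment integral of the first order remainder of [f]. *)
Lemma holo_quotient rho f F a : holo rho f -> normc a < rho ->
  (forall u v, normc u < rho -> normc v < rho -> F v - F u = segint f u v) ->
  (forall z, normc z < rho -> has_deriv F z (f z)) ->
  holo rho (fun z => if z == a then f a else (F z - F a) / (z - a)).
Proof.
move=> hf ar Fs Fd z zr; have cf := holo_cts hf.
have [->{zr z}|za] := eqVneq z a; last first.
  have za0 : z - a != 0 by rewrite subr_eq0.
  have zan : 0 < normc (z - a) by rewrite normc_gt0.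
  eexists; apply: (has_deriv_near zan); last first.
    apply: (has_derivM (g := fun w => (w - a)^-1)).
      by apply: has_derivB; [exact: Fd zr|exact: has_deriv_cst (F a) z].
    by apply: has_derivV => //; apply: has_derivB; [exact: has_deriv_id|exact: has_deriv_cst].
  move=> w; have [->|//] := eqVneq w a.
  by rewrite normcBC ltxx.
have [d fd] := hf a ar; exists (d / 2) => e e0.
have [del del0 D] := fd _ e0.
exists (Num.min del (rho - normc a)); first by rewrite lt_min del0 subr_gt0.
move=> w; rewrite lt_min => /andP[wd wr]; rewrite eqxx.
have [->|wa] := eqVneq w a; first by rewrite !subrr mulr0 subrr normc0 mulr0.
have wa0 : w - a != 0 by rewrite subr_eq0.
have wrho : normc w < rho by have := lerB_normc w a; lra.
pose al := f a - d * a.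
have caff : cts_disc rho (fun w => al + d * w).
  move=> x _; apply: has_deriv_cts; apply: has_derivD; first exact: has_deriv_cst.
  by apply: has_derivZ; exact: has_deriv_id.
have cg : cts_disc rho (fun w => f w - (al + d * w)).
  move=> x /hf[dw fw]; apply: has_deriv_cts; apply: has_derivB; first exact: fw.
  apply: has_derivD; first exact: has_deriv_cst.
  by apply: has_derivZ; exact: has_deriv_id.
have -> : (F w - F a) / (w - a) - f a - d / 2 * (w - a) =
    segint (fun w => f w - (al + d * w)) a w / (w - a).
  rewrite (segintB cf caff)// segint_affine Fs// /al; field; exact: wa0.
rewrite normcf_div ler_pdivrMr ?normc_gt0// mulrC.
apply: (ler_normc_segint cg) => // t t01; set x := a + _.
have xd : normc (x - a) <= normc (w - a) by exact: segment_dist.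
have := D x (le_lt_trans xd wd).
have -> : f x - f a - d * (x - a) = f x - (al + d * x) by rewrite /al; ring.
by move/le_trans; apply; rewrite ler_pM2l.
Qed.

(** Cauchy's theorem is applied to the difference quotient of [F] at [a]: on the circle its
    integrand is [(F - F a) / r] times the Cauchy kernel, whose integral is 1. *)
Lemma cauchy_formula_primitive rho f F a (r : R) : holo rho f -> normc a < r < rho ->
  (forall u v, normc u < rho -> normc v < rho -> F v - F u = segint f u v) ->
  (forall z, normc z < rho -> has_deriv F z (f z)) ->
  cint (fun t => F (rad r t) * cker r a t) = F a.
Proof.
move=> hf /andP[ar rr] Fs Fd; have r0 : 0 < r by exact: le_lt_trans (normc_ge0 _) ar.
have r0r : 0 < r < rho by rewrite r0.
have hQ := holo_quotient hf (lt_trans ar rr) Fs Fd.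
have := cauchy_circle hQ r0r.
rewrite (@cint_eq _ _ (fun t => r%:C^-1 * (F (rad r t) * cker r a t - F a * cker r a t))); last first.
  move=> t _; have := rad_neq t ar; rewrite subr_eq0 => /negbTE ->.
  rewrite /cker /rad; field; rewrite -/(rad r t) rad_neq// eq_complex/= eqxx andbT gt_eqF//.
have hF : holo rho F by move=> z /Fd Fz; exists (f z).
have cF := holo_contc hF r0r.
have ck := contc_cker ar; have cc k : contc (fun=> k) := contc_cst k.
rewrite cintZ; last by apply: contcB; exact: contcM.
rewrite cintB; [|exact: contcM..]; rewrite (cintZ _ ck) cint_cker// mulr1.
move=> /eqP; rewrite mulf_eq0 invr_eq0 => /orP[|]; first by rewrite eq_complex/= eqxx andbT gt_eqF.
by rewrite subr_eq0 => /eqP.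
Qed.

(** Differentiation under the integral sign, for a density [phi] that is merely continuous: the
    first order error of the kernel is [(b - a)^2] times a function bounded uniformly in [t]. *)
Lemma has_deriv_cauchy_transform phi (r : R) a : contc phi -> normc a < r ->
  has_deriv (fun b => cint (fun t => phi t * cker r b t)) a
    (cint (fun t => phi t * (rad r t / (rad r t - a) ^+ 2))).
Proof.
move=> cp ar e e0; have r0 : 0 < r by exact: le_lt_trans (normc_ge0 _) ar.
(* For [b] within [q] of [a] both denominators [rad r t - a] and [rad r t - b] have modulus at least
   [q]; three such factors give the [q ^+ 3] in [K]. *)
pose q := (r - normc a) / 2; have q0 : 0 < q by rewrite divr_gt0// subr_gt0.
pose M := rint (fun t => normc (phi t)).
have M0 : 0 <= M by apply: rint_ge0 => [|t _]; [exact: cont01_normc|exact: normc_ge0].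
pose K := M * (r / q ^+ 3) + 1.
have K0 : 0 < K by rewrite /K ltr_wpDl// mulr_ge0// divr_ge0 ?exprn_ge0 ?ltW.
exists (Num.min q (e / K)); first by rewrite lt_min q0 divr_gt0.
move=> b; rewrite lt_min => /andP[bq]; rewrite ltr_pdivlMr// => be.
have br : normc b < r by have := lerB_normc b a; move: bq; rewrite /q; lra.
have cc k : contc (fun=> k) := contc_cst k.
have cb := contc_cker br; have ca := contc_cker ar.
have c2 : contc (fun t => rad r t / (rad r t - a) ^+ 2).
  apply: contcM; first exact: contc_rad.
  under eq_fun do rewrite -exprVn.
  by apply: contcX; exact: contc_radV.
rewrite -cintB; [|exact: contcM..].
rewrite (mulrC (cint _) (b - a)) -cintZ; last exact: contcM.
rewrite -cintB; [|by apply: contcB; exact: contcM|by apply: contcM => //; exact: contcM].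
pose g t := rad r t / (rad r t - b) / (rad r t - a) ^+ 2.
have cg : contc g.
  apply: contcM; first exact: cb.
  under eq_fun do rewrite -exprVn.
  by apply: contcX; exact: contc_radV.
rewrite (@cint_eq _ _ (fun t => (b - a) ^+ 2 * (phi t * g t))); last first.
  move=> t _; rewrite /cker /g; field; rewrite !rad_neq//.
rewrite cintZ; last exact: contcM.
rewrite normcM normcX expr2 -mulrA mulrC ler_wpM2r ?normc_ge0//.
apply: le_trans (ltW be); rewrite ler_wpM2l ?normc_ge0//.
apply: (le_trans (ler_normc_cint _)); first exact: contcM.
rewrite /K; apply: (@le_trans _ _ (M * (r / q ^+ 3))); last by rewrite lerDl.
rewrite /M mulrC -rintZ; last exact: cont01_normc.
apply: ler_rint => [||t _].
- by apply: cont01_normc; exact: contcM.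
- by apply: cont01M; [exact: cont01_cst|exact: cont01_normc].
rewrite normcM mulrC ler_wpM2r ?normc_ge0// /g normcf_div normcf_div normc_rad gtr0_norm//.
rewrite normcX -mulrA -invfM ler_wpM2l ?(ltW r0)// lef_pV2 ?posrE ?exprn_gt0//; last first.
  by rewrite mulr_gt0 ?exprn_gt0// normc_gt0 rad_neq.
have h1 : q <= normc (rad r t - b).
  by have := rad_ge t br; have := lerB_normc b a; move: bq; rewrite /q; lra.
have h2 : q <= normc (rad r t - a) by have := rad_ge t ar; move: q0; rewrite /q; lra.
rewrite exprS; apply: ler_pM; rewrite ?exprn_ge0 ?(ltW q0)//.
by apply: lerXn2r => //; rewrite nnegrE ?normc_ge0 ?(ltW q0).
Qed.

(* Cauchy's formula holds for a primitive [F] by Goursat's theorem for its difference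
   quotient. Differentiating it in [a] and integrating by parts gives the formula for
   [f], without knowing beforehand that [f] is infinitely differentiable. *)
Lemma cauchy_formula rho f a (r : R) : holo rho f -> normc a < r < rho ->
  cint (fun t => f (rad r t) * cker r a t) = f a.
Proof.
move=> hf arr; case/andP: (arr) => ar rr.
have r0 : 0 < r by exact: le_lt_trans (normc_ge0 _) ar.
have r0r : 0 < r < rho by rewrite r0.
have rho0 := lt_trans r0 rr.
pose F := primitive f.
have Fs u v : normc u < rho -> normc v < rho -> F v - F u = segint f u v.
  exact: primitiveB.
have Fd z : normc z < rho -> has_deriv F z (f z) by exact: primitive_has_deriv.
have hF : holo rho F by move=> z /Fd Fz; exists (f z).
have cF := holo_contc hF r0r; have cf := holo_contc hf r0r.
have ck := contc_cker ar.
have c2 : contc (fun t => (rad r t - a)^-1) := contc_radV ar.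
have c22 : contc (fun t => (rad r t - a) ^- 2).
  by under eq_fun do rewrite -exprVn; exact: contcX.
have crad := contc_rad r.
have D := has_deriv_cauchy_transform cF ar.
have E : f a = cint (fun t => F (rad r t) * (rad r t / (rad r t - a) ^+ 2)).
  apply: has_deriv_unique (Fd a (lt_trans ar rr)) _.
  have q0 : 0 < r - normc a by rewrite subr_gt0.
  apply: (has_deriv_near q0) D => b ba.
  rewrite (cauchy_formula_primitive hf _ Fs Fd)// rr andbT.
  by have := lerB_normc b a; lra.
rewrite E; apply/eqP; rewrite -subr_eq0 -cintB; [|exact: contcM..|by apply: contcM => //; exact: contcM].
(* This is the derivative of [F z / (z - a)], in the shape delivered by the product and inverse
   rules. Its vanishing integral around the circle is the integration by parts. *)
pose g z := f z * (z - a)^-1 + F z * (- (z - a) ^- 2 * (1 - 0)).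
have gE : (fun t => g (rad r t)) = (fun t => f (rad r t) * (rad r t - a)^-1 +
   - (F (rad r t) * (rad r t - a) ^- 2)).
  by apply/funext => t; rewrite /g; ring.
have cg : contc (fun t => g (rad r t)).
  by rewrite gE; apply: contcD; [exact: contcM|apply: contcN; exact: contcM].
rewrite (@cint_eq _ _ (fun t => r%:C * (g (rad r t) * ec t))); last first.
  move=> t _; have -> : r%:C * (g (rad r t) * ec t) = g (rad r t) * rad r t by rewrite /rad; ring.
  by rewrite /g /cker; field; exact: rad_neq.
rewrite cintZ; last by apply: contcM => //; exact: contc_ec.
rewrite (@cint_circle r (fun z => F z * (z - a)^-1) g)// ?mulr0// => t _.
apply: has_derivM; first by apply: Fd; exact: rad_disc.
apply: has_derivV; first exact: rad_neq.
by apply: has_derivB; [exact: has_deriv_id|exact: has_deriv_cst].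
Qed.

End Circle.

(** * Taylor coefficients, Bessel's identity and mean square approximation *)

Section Taylor.
Variable R : realType.
Local Notation C := R[i].
Local Notation Re := (@complex.Re _).
Local Notation Im := (@complex.Im _).
Implicit Types (f g : C -> C) (a b c z : C).

Lemma cont01_bounded (u : R -> R) : cont01 u ->
  exists B, forall t : R, 0 <= t <= 1 -> u t <= B.
Proof.
move=> /cont01_within cu; have [c _ H] := EVT_max ler01 cu.
by exists (u c) => t t01; apply: H; rewrite in_itv.
Qed.

Lemma real_neq0 (r : R) : 0 < r -> r%:C != 0 :> C.
Proof. by move=> r0; rewrite eq_complex/= eqxx andbT gt_eqF. Qed.

Lemma cint_ec_orth j k : cint (fun t : R => ec t ^+ j * (ec t)^-1 ^+ k) = (j == k)%:R.
Proof.
have E t : ec t * (ec t)^-1 = 1 :> C by rewrite divff// ec_neq0.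
have [jk|kj|->] := ltngtP j k.
- rewrite (@cint_eq _ _ (fun t => (ec t)^-1 ^+ (k - j).-1.+1)); first by rewrite cint_ecVX.
  move=> t _; rewrite prednK ?subn_gt0// -{1}(subnKC (ltnW jk)) exprD mulrA -exprMn E.
  by rewrite expr1n mul1r.
- rewrite (@cint_eq _ _ (fun t => ec t ^+ (j - k).-1.+1)); first by rewrite cint_ecX.
  move=> t _; rewrite prednK ?subn_gt0// -{1}(subnK (ltnW kj)) exprD -mulrA -exprMn E.
  by rewrite expr1n mulr1.
- rewrite (@cint_eq _ _ (fun=> 1)) ?cint_cst// => t _.
  by rewrite -exprMn E expr1n.
Qed.

Definition circle_coef f (r : R) k := cint (fun t => f (rad r t) * (ec t)^-1 ^+ k) / r%:C ^+ k.

Lemma contc_ecVX k : contc (fun t : R => (ec t)^-1 ^+ k : C).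
Proof. by apply: contcX; exact: contc_ecV. Qed.

(** The geometric expansion of the Cauchy kernel is inserted into Cauchy's formula; its exact
    remainder gives the error term. *)
Lemma taylor rho f a (r B : R) n : holo rho f -> normc a < r < rho ->
  (forall t : R, 0 <= t <= 1 -> normc (f (rad r t)) <= B) ->
  normc (f a - \sum_(k < n) circle_coef f r k * a ^+ k) <= B * ((normc a / r) ^+ n * (r / (r - normc a))).
Proof.
move=> hf arr fB; case/andP: (arr) => ar rr.
have r0 : 0 < r by exact: le_lt_trans (normc_ge0 _) ar.
have r0r : 0 < r < rho by rewrite r0.
have cf := holo_contc hf r0r; have ck := contc_cker ar.
have cc k : contc (fun=> k) := contc_cst k; have cV := contc_ecVX.
rewrite -(cauchy_formula hf arr).
rewrite (@cint_eq _ _ (fun t => \sum_(k < n) ((a / r%:C) ^+ k * (f (rad r t) * (ec t)^-1 ^+ k))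
    + (a / r%:C) ^+ n * (f (rad r t) * ((ec t)^-1 ^+ n * cker r a t)))); last first.
  move=> t _; rewrite {1}(cker_geometric t n ar) mulrDr mulr_sumr; congr (_ + _); last by rewrite mulrCA.
  by apply: eq_bigr => k _; rewrite mulrCA.
rewrite cintD; last 2 first.
- apply: (@contc_sum _ n (fun k t => (a / r%:C) ^+ k * (f (rad r t) * (ec t)^-1 ^+ k))) => k.
  by apply: contcM => //; exact: contcM.
- by apply: contcM => //; apply: contcM => //; exact: contcM.
rewrite (@cint_sum _ n (fun k t => (a / r%:C) ^+ k * (f (rad r t) * (ec t)^-1 ^+ k))); last first.
  by move=> k; apply: contcM => //; exact: contcM.
rewrite (eq_bigr (fun k : 'I_n => circle_coef f r k * a ^+ k)); last first.
  move=> k _; rewrite cintZ; last exact: contcM.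
  by rewrite /circle_coef expr_div_n; ring.
rewrite addrC addKr; apply: ler_normc_cint_cst.
  by apply: contcM => //; apply: contcM => //; exact: contcM.
move=> t t01; have := ler_cker t ar; move: (cker r a t) => X HX.
rewrite !normcM normcX normc_div_real// normcX normcV normc_ec invr1 expr1n mul1r.
rewrite mulrCA; apply: ler_pM => //.
- exact: normc_ge0.
- by rewrite mulr_ge0 ?normc_ge0// exprn_ge0// divr_ge0 ?normc_ge0// ltW.
- exact: fB.
- by rewrite ler_wpM2l// exprn_ge0// divr_ge0 ?normc_ge0// ltW.
Qed.

Lemma holo_bounded rho f (r : R) : holo rho f -> 0 < r < rho ->
  exists B, forall t : R, 0 <= t <= 1 -> normc (f (rad r t)) <= B.
Proof. by move=> hf rr; apply: cont01_bounded; apply: cont01_normc; exact: holo_contc hf rr. Qed.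

Lemma contc_rad_poly (r : R) (c : nat -> C) n : contc (fun t => \sum_(k < n) c k * rad r t ^+ k).
Proof.
apply: (@contc_sum _ n (fun k t => c k * rad r t ^+ k)) => k.
by apply: contcM; [exact: contc_cst|apply: contcX; exact: contc_rad].
Qed.

Lemma moment_poly (r : R) (c : nat -> C) n k : cint (fun t =>
  (\sum_(j < n) c j * rad r t ^+ j) * (ec t)^-1 ^+ k) = if (k < n)%N then c k * r%:C ^+ k else 0.
Proof.
rewrite (@cint_eq _ _ (fun t => \sum_(j < n) (c j * r%:C ^+ j) * (ec t ^+ j * (ec t)^-1 ^+ k))); last first.
  move=> t _; rewrite mulr_suml; apply: eq_bigr => j _.
  by rewrite /rad exprMn; ring.
have co j : contc (fun t : R => ec t ^+ j * (ec t)^-1 ^+ k : C).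
  by apply: contcM; [apply: contcX; exact: contc_ec|exact: contc_ecVX].
rewrite (@cint_sum _ n (fun j t => (c j * r%:C ^+ j) * (ec t ^+ j * (ec t)^-1 ^+ k))); last first.
  by move=> j; apply: contcM => //; exact: contc_cst.
rewrite (eq_bigr (fun j : 'I_n => if j == k :> nat then c k * r%:C ^+ k else 0)); last first.
  move=> j _; rewrite cintZ// cint_ec_orth.
  by case: eqVneq => [->|]; rewrite ?mulr1 ?mulr0.
rewrite -big_mkcond/=; case: ltnP => kn.
  by rewrite (big_pred1 (Ordinal kn)).
by rewrite big_pred0// => j; apply/negbTE; rewrite neq_ltn (leq_trans (ltn_ord j) kn).
Qed.

(** On the smaller circle [f] is uniformly close to its Taylor polynomials with coefficients taken
    at radius [r], and for these orthogonality gives the moment exactly once the degree passes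
    [k]. *)
Lemma moment rho f (s r : R) k : holo rho f -> 0 < s < r -> r < rho ->
  cint (fun t => f (rad s t) * (ec t)^-1 ^+ k) = circle_coef f r k * s%:C ^+ k.
Proof.
move=> hf /andP[s0 sr] rr; have r0 := lt_trans s0 sr.
have [B HB] : exists B, forall t : R, 0 <= t <= 1 -> normc (f (rad r t)) <= B.
  by apply: holo_bounded hf _; rewrite r0.
have B0 : 0 <= B by apply: le_trans (HB 0 _); rewrite ?normc_ge0// lexx ler01.
apply/eqP; rewrite -subr_eq0 -normc_eq0; apply/eqP/le_anti; rewrite normc_ge0 andbT.
apply/ler_addgt0Pr => e e0; rewrite add0r.
have q01 : 0 <= s / r < 1 by rewrite divr_ge0 ?(ltW s0) ?(ltW r0)//= ltr_pdivrMr// mul1r.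
pose K := B * (r / (r - s)) + 1.
have K0 : 0 < K by rewrite ltr_wpDl// mulr_ge0// divr_ge0 ?(ltW r0)// subr_ge0 ltW.
have [N HN] := exprn_to0 q01 (divr_gt0 e0 K0).
pose n := maxn N k.+1.
have cf : contc (fun t => f (rad s t)).
  by apply: holo_contc hf _; rewrite s0 (lt_trans sr).
have cV := contc_ecVX.
have := moment_poly s (circle_coef f r) n k; rewrite leq_max leqnn orbT => <-.
have cp := contc_rad_poly s (circle_coef f r) n.
rewrite -cintB; [|exact: contcM..].
rewrite (@cint_eq _ _ (fun t => (f (rad s t) - \sum_(j < n) circle_coef f r j * rad s t ^+ j) *
    (ec t)^-1 ^+ k)); last by move=> t _; rewrite mulrBl.
apply: ler_normc_cint_cst; first by apply: contcM => //; exact: contcB.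
move=> t t01; rewrite normcM normcX normcV normc_ec invr1 expr1n mulr1.
have ns : normc (rad s t) = s by rewrite normc_rad gtr0_norm.
have tr : normc (rad s t) < r < rho by rewrite ns sr.
apply: (le_trans (taylor n hf tr HB)); rewrite ns.
have := HN n (leq_maxl _ _); rewrite ltr_pdivlMr// /K => H; apply: le_trans (ltW H).
have X0 : 0 <= (s / r) ^+ n by rewrite exprn_ge0//; case/andP: q01.
by rewrite mulrCA ler_wpM2l// lerDl.
Qed.

(* The radius is immaterial by [circle_coef_indep]. *)
Definition taylor_coef f k := circle_coef f 2^-1 k.

Lemma half_lt1 : 2^-1 < 1 :> R. Proof. lra. Qed.

Lemma half_gt0 : 0 < 2^-1 :> R. Proof. lra. Qed.

(** Both radii are compared with one circle smaller than either. *)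
Lemma circle_coef_indep f (r : R) k : holo 1 f -> 0 < r < 1 -> circle_coef f r k = taylor_coef f k.
Proof.
move=> hf /andP[r0 r1].
pose s := Num.min r 2^-1 / 2.
have m0 : 0 < Num.min r 2^-1 by rewrite lt_min r0 half_gt0.
have mr : Num.min r 2^-1 <= r by rewrite ge_min lexx.
have mh : Num.min r 2^-1 <= 2^-1 by rewrite ge_min lexx orbT.
have sr : 0 < s < r by rewrite /s; apply/andP; split; lra.
have sh : 0 < s < 2^-1 by rewrite /s; apply/andP; split; lra.
have := moment k hf sr r1; rewrite (moment k hf sh half_lt1).
case/andP: sr => s0 _ E; apply/esym; apply: mulIf E.
by rewrite expf_neq0// real_neq0.
Qed.

Lemma taylor_coef_moment f (r : R) k : holo 1 f -> 0 < r < 1 ->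
  cint (fun t => f (rad r t) * (ec t)^-1 ^+ k) = taylor_coef f k * r%:C ^+ k.
Proof.
move=> hf r01; rewrite -(circle_coef_indep k hf r01) /circle_coef divfK//.
by case/andP: r01 => r0 _; rewrite expf_neq0// real_neq0.
Qed.

Lemma taylor_remainder f a (r B : R) n : holo 1 f -> normc a < r < 1 ->
  (forall t : R, 0 <= t <= 1 -> normc (f (rad r t)) <= B) ->
  normc (f a - \sum_(k < n) taylor_coef f k * a ^+ k) <= B * ((normc a / r) ^+ n * (r / (r - normc a))).
Proof.
move=> hf ar HB; rewrite (eq_bigr (fun k : 'I_n => circle_coef f r k * a ^+ k)).
  exact: taylor hf ar HB.
move=> k _; rewrite circle_coef_indep//; case/andP: ar => ar ->; rewrite andbT.
exact: le_lt_trans (normc_ge0 _) ar.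
Qed.

(** Integration against a polynomial sees only the first [n] moments of [V], so this form of
    Parseval's identity is a finite computation. *)
Lemma pairing V (p : nat -> C) n (r : R) : holo 1 V -> 0 < r < 1 ->
  cint (fun t => V (rad r t) * (\sum_(k < n) p k * rad r t ^+ k)^*) =
  \sum_(k < n) (p k)^* * taylor_coef V k * r%:C ^+ k.*2.
Proof.
have radJ t : (rad r t)^* = r%:C * (ec t)^-1.
  by rewrite ecV; apply: complexP; rewrite ?(complexReJ, complexImJ, complexReM, complexImM)/=; ring.
move=> hV r01; have cV := holo_contc hV r01; have ce := contc_ecVX.
have E t : (\sum_(k < n) p k * rad r t ^+ k)^* = \sum_(k < n) ((p k)^* * r%:C ^+ k) * (ec t)^-1 ^+ k.
  rewrite rmorph_sum; apply: eq_bigr => k _.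
  have H : (p k * rad r t ^+ k)^* = (p k)^* * ((rad r t)^*) ^+ k by rewrite rmorphM rmorphXn.
  by apply: (etrans H); rewrite radJ exprMn mulrA.
rewrite (@cint_eq _ _ (fun t => \sum_(k < n) ((p k)^* * r%:C ^+ k) * (V (rad r t) * (ec t)^-1 ^+ k))); last first.
  by move=> t _; rewrite E mulr_sumr; apply: eq_bigr => k _; ring.
rewrite (@cint_sum _ n (fun k t => ((p k)^* * r%:C ^+ k) * (V (rad r t) * (ec t)^-1 ^+ k))); last first.
  by move=> k; apply: contcM; [exact: contc_cst|exact: contcM].
apply: eq_bigr => k _; rewrite cintZ; last exact: contcM.
by rewrite taylor_coef_moment// -addnn exprD; ring.
Qed.

Lemma holo_cst rho (k : C) : holo rho (fun=> k).
Proof. by move=> z _; exists 0; exact: has_deriv_cst. Qed.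

Lemma holoD rho f g : holo rho f -> holo rho g -> holo rho (fun z => f z + g z).
Proof. by move=> hf hg z zr; have [d fd] := hf z zr; have [d' gd] := hg z zr;
  exists (d + d'); exact: has_derivD. Qed.

Lemma holoB rho f g : holo rho f -> holo rho g -> holo rho (fun z => f z - g z).
Proof. by move=> hf hg z zr; have [d fd] := hf z zr; have [d' gd] := hg z zr;
  exists (d - d'); exact: has_derivB. Qed.

Lemma holoM rho f g : holo rho f -> holo rho g -> holo rho (fun z => f z * g z).
Proof. by move=> hf hg z zr; have [d fd] := hf z zr; have [d' gd] := hg z zr;
  exists (d * g z + f z * d'); exact: has_derivM. Qed.

Lemma holoX rho f n : holo rho f -> holo rho (fun z => f z ^+ n).
Proof. by move=> hf z zr; have [d fd] := hf z zr; exact: has_derivX fd. Qed.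

Lemma holoV rho f : holo rho f -> (forall z, normc z < rho -> f z != 0) ->
  holo rho (fun z => (f z)^-1).
Proof. by move=> hf f0 z zr; have [d fd] := hf z zr; exists (- (f z) ^- 2 * d); apply: has_derivV => //; exact: f0. Qed.

Lemma holo_id rho : holo rho (@id C).
Proof. by move=> z _; exists 1; exact: has_deriv_id. Qed.

Lemma holo_comp rho rho' f g : holo rho f -> (forall z, normc z < rho -> normc (f z) < rho') ->
  holo rho' g -> holo rho (fun z => g (f z)).
Proof.
move=> hf fr hg z zr; have [d fd] := hf z zr; have [d' gd] := hg _ (fr z zr).
by exists (d' * d); exact: has_deriv_comp.
Qed.

Lemma holo_sum rho n (p : nat -> C) : holo rho (fun z => \sum_(k < n) p k * z ^+ k).
Proof.
elim: n => [|n IH].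
  by under eq_fun do rewrite big_ord0; exact: holo_cst.
under eq_fun do rewrite big_ord_recr/=.
by apply: holoD => //; apply: holoM; [exact: holo_cst|apply: holoX; exact: holo_id].
Qed.

Lemma sqr_normc_re z : ((normc z) ^+ 2)%:C = z * z^* :> C.
Proof. by rewrite mulcJ. Qed.

Lemma ler_normc_sum n (F : 'I_n -> C) : normc (\sum_(k < n) F k) <= \sum_(k < n) normc (F k).
Proof.
elim/big_rec2 : _ => [|k y x _ IH]; first by rewrite normc0.
by apply: (le_trans (le_normcD _ _)); rewrite lerD2l.
Qed.

Lemma conjcKE a : (a^*)^* = a :> C.
Proof. by apply: complexP; case: a => ? ? //=; rewrite opprK. Qed.

Lemma conjcM a b : (a * b)^* = a^* * b^* :> C.
Proof. by case: a b => ? ? [? ?]; apply: complexP => /=; ring. Qed.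

Lemma conjcB a b : (a - b)^* = a^* - b^* :> C.
Proof. by case: a b => ? ? [? ?]; apply: complexP => /=; ring. Qed.

Definition psum f n z := \sum_(k < n) taylor_coef f k * z ^+ k.

(** Pythagoras: [psum f n] is the orthogonal projection of [f] on the polynomials of degree below
    [n], simultaneously on all circles because the coefficients do not depend on the radius. *)
Lemma bessel f (r : R) n : holo 1 f -> 0 < r < 1 ->
  rint (fun t => normc (f (rad r t) - psum f n (rad r t)) ^+ 2) =
  rint (fun t => normc (f (rad r t)) ^+ 2) - \sum_(k < n) normc (taylor_coef f k) ^+ 2 * r ^+ k.*2.
Proof.
move=> hf r01; have cf := holo_contc hf r01.
have cp : contc (fun t => psum f n (rad r t)) := contc_rad_poly r (taylor_coef f) n.
have hp : holo 1 (psum f n) := holo_sum (rho:=1) n (taylor_coef f).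
have cJ phi := @contcJ R phi.
apply: (@complexI R); rewrite -cint_real rmorphB/= -cint_real.
have P1 := pairing (taylor_coef f) n hf r01.
have P2 := pairing (taylor_coef f) n hp r01.
have r0 : 0 < r by case/andP: r01.
have tcp k : (k < n)%N -> taylor_coef (psum f n) k = taylor_coef f k.
  move=> kn; have := taylor_coef_moment k hp r01; rewrite /psum moment_poly kn => E; apply/esym; apply: mulIf E.
  by rewrite expf_neq0// real_neq0.
have S : \sum_(k < n) (taylor_coef f k)^* * taylor_coef (psum f n) k * r%:C ^+ k.*2 =
    \sum_(k < n) (taylor_coef f k)^* * taylor_coef f k * r%:C ^+ k.*2.
  by apply: eq_bigr => k _; rewrite tcp.
have S' : (\sum_(k < n) normc (taylor_coef f k) ^+ 2 * r ^+ k.*2)%:C =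
    \sum_(k < n) (taylor_coef f k)^* * taylor_coef f k * r%:C ^+ k.*2.
  rewrite rmorph_sum; apply: eq_bigr => k _.
  by rewrite rmorphM/= sqr_normc_re rmorphXn/= [taylor_coef f k * _]mulrC.
have S'' : (\sum_(k < n) (taylor_coef f k)^* * taylor_coef f k * r%:C ^+ k.*2)^* =
    \sum_(k < n) (taylor_coef f k)^* * taylor_coef f k * r%:C ^+ k.*2.
  by rewrite -S'; apply: complexP => /=; rewrite ?oppr0.
rewrite (@cint_eq _ _ (fun t => (f (rad r t) * (f (rad r t))^* - f (rad r t) * (psum f n (rad r t))^*)
   - ((f (rad r t) * (psum f n (rad r t))^*)^* - psum f n (rad r t) * (psum f n (rad r t))^*))); last first.
  by move=> t _; cbv beta; rewrite sqr_normc_re conjcB conjcM conjcKE; ring.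
have c1 : contc (fun t => f (rad r t) * (f (rad r t))^*) by apply: contcM => //; exact: cJ.
have c2 : contc (fun t => f (rad r t) * (psum f n (rad r t))^*) by apply: contcM => //; exact: cJ.
have c3 : contc (fun t => psum f n (rad r t) * (psum f n (rad r t))^*) by apply: contcM => //; exact: cJ.
have c4 := cJ _ c2.
rewrite cintB; [|exact: contcB..]; rewrite !cintB// cintJ//.
rewrite [cint (fun t => f _ * (psum f n _)^*)]P1 [cint (fun t => psum f n _ * _)]P2 S S'' S'.
rewrite subrr subr0; congr (_ - _).
by apply: cint_eq => t _; cbv beta; rewrite sqr_normc_re.
Qed.

Lemma bernoulli_ineq (x : R) n : 0 <= x <= 1 -> 1 - n%:R * x <= (1 - x) ^+ n.
Proof.
move=> /andP[x0 x1]; elim: n => [|n IH]; first by rewrite mul0r subr0 expr0.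
rewrite exprS; apply: (@le_trans _ _ ((1 - x) * (1 - n%:R * x))); last by rewrite ler_wpM2l// subr_ge0.
rewrite -natr1; have : 0 <= n%:R :> R by []. nra.
Qed.

Lemma sum_coef_le f (B : R) n : holo 1 f -> 0 <= B -> (forall z, normc z < 1 -> normc (f z) <= B) ->
  \sum_(k < n) normc (taylor_coef f k) ^+ 2 <= B ^+ 2.
Proof.
move=> hf B0 fB; set S := \sum_(k < n) _.
have S0 : 0 <= S by apply: sumr_ge0 => k _; exact: sqr_ge0.
have main (r : R) : 0 < r < 1 -> S * r ^+ n.*2 <= B ^+ 2.
  move=> r01; have /andP[r0 r1] := r01.
  have : 0 <= rint (fun t => normc (f (rad r t) - psum f n (rad r t)) ^+ 2).
    apply: rint_ge0 => [|t _]; last exact: sqr_ge0.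
    apply: cont01_sqr_normc; apply: contcB; first exact: holo_contc hf r01.
    exact: contc_rad_poly.
  rewrite bessel// subr_ge0 => H.
  apply: (@le_trans _ _ (\sum_(k < n) normc (taylor_coef f k) ^+ 2 * r ^+ k.*2)).
    rewrite mulr_suml; apply: ler_sum => k _; rewrite ler_wpM2l ?sqr_ge0//.
    by rewrite ler_wiXn2l ?(ltW r0) ?(ltW r1)// leq_double ltnW.
  apply: (le_trans H); apply: rint_le_cst.
    by apply: cont01_sqr_normc; exact: holo_contc hf r01.
  move=> t _; rewrite lerXn2r ?nnegrE ?normc_ge0// fB// normc_rad gtr0_norm//.
apply/ler_addgt0Pr => e e0.
(* The radius is [1 - x]. By Bernoulli's inequality its power [n.*2] loses at most [n.*2 * x], and
   [x] is chosen so that this loss times [S] is at most [e]. *)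
pose x := Num.min 2^-1 (e / (n.*2%:R * S + 1)).
have D0 : 0 < n.*2%:R * S + 1 by rewrite ltr_wpDl// mulr_ge0.
have x0 : 0 < x by rewrite /x lt_min half_gt0 divr_gt0.
have x1 : x <= 2^-1 by rewrite /x ge_min lexx.
have r01 : 0 < 1 - x < 1 by apply/andP; split; lra.
have := main _ r01 => H.
have : S * (1 - n.*2%:R * x) <= B ^+ 2.
  apply: le_trans H; rewrite ler_wpM2l//; apply: bernoulli_ineq.
  by apply/andP; split; lra.
have : x * (n.*2%:R * S + 1) <= e by rewrite -ler_pdivlMr// /x ge_min lexx orbT.
nra.
Qed.

(** The order [n] serves all radii at once: by Bessel's identity the error is a tail of the
    coefficient series weighted by powers of [r], hence at most the unweighted tail, which is below
    [e] for a suitable [n]. *)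
Lemma h2_approx f (B e : R) : holo 1 f -> 0 <= B -> (forall z, normc z < 1 -> normc (f z) <= B) ->
  0 < e -> exists n, forall r : R, 0 < r < 1 ->
    rint (fun t => normc (f (rad r t) - psum f n (rad r t)) ^+ 2) <= e.
Proof.
move=> hf B0 fB e0.
pose S n := \sum_(k < n) normc (taylor_coef f k) ^+ 2.
pose A := range S.
have supA : has_sup A.
  split; first by exists (S 0%N), 0%N.
  by exists (B ^+ 2) => _ [n _ <-]; exact: sum_coef_le.
have [_ [n _ <-] Sn] := sup_adherent e0 supA.
exists n => r r01; have /andP[r0 r1] := r01.
(* The errors of orders [n] and [m] differ by a block of coefficients of total at most [e]. With [r]
   fixed, the error of order [m] is then made arbitrarily small by the Taylor remainder. *)
have tail m : (n <= m)%N -> rint (fun t => normc (f (rad r t) - psum f n (rad r t)) ^+ 2) <=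
    rint (fun t => normc (f (rad r t) - psum f m (rad r t)) ^+ 2) + e.
  move=> nm; rewrite !bessel//.
  have : S m <= sup A by apply: ub_le_sup; [by case: supA|exists m].
  rewrite /S -!(big_mkord xpredT (fun k => normc (taylor_coef f k) ^+ 2)) in Sn *.
  rewrite -!(big_mkord xpredT (fun k => normc (taylor_coef f k) ^+ 2 * r ^+ k.*2)).
  rewrite !(big_cat_nat (leq0n n) nm)/= => Sm.
  have : \sum_(n <= k < m) normc (taylor_coef f k) ^+ 2 * r ^+ k.*2 <= \sum_(n <= k < m) normc (taylor_coef f k) ^+ 2.
    apply: ler_sum => k _; rewrite ler_piMr ?sqr_ge0//.
    by rewrite exprn_ile1 ?(ltW r0) ?(ltW r1).
  lra.
apply/ler_addgt0Pr => e' e'0.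
pose q := (1 + r) / 2.
have rq : r < q < 1 by rewrite /q; apply/andP; split; lra.
have /andP[rq' q1] := rq; have q0 : 0 < q by exact: lt_trans rq'.
have q01 : 0 <= r / q < 1 by rewrite divr_ge0 ?(ltW r0) ?(ltW q0)//= ltr_pdivrMr// mul1r.
pose K := B * (q / (q - r)) + 1.
have K0 : 0 < K by rewrite ltr_wpDl// mulr_ge0// divr_ge0 ?(ltW q0)// subr_ge0 ltW.
pose e1 := Num.min 1 e'; have e10 : 0 < e1 by rewrite lt_min ltr01.
have [N HN] := exprn_to0 q01 (divr_gt0 e10 K0).
apply: (le_trans (tail (maxn n N) (leq_maxl _ _))); rewrite addrC lerD2l.
apply: rint_le_cst.
  apply: cont01_sqr_normc; apply: contcB; first exact: holo_contc hf r01.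
  exact: contc_rad_poly.
move=> t _.
have nr : normc (rad r t) = r by rewrite normc_rad gtr0_norm.
have X : normc (f (rad r t) - psum f (maxn n N) (rad r t)) <= e1.
  have tr : normc (rad r t) < q < 1 by rewrite nr.
  have BB (s : R) : 0 <= s <= 1 -> normc (f (rad q s)) <= B.
    by move=> _; apply: fB; rewrite normc_rad gtr0_norm.
  apply: (le_trans (taylor_remainder _ hf tr BB)); rewrite nr.
  have := HN (maxn n N) (leq_maxr _ _); rewrite ltr_pdivlMr// /K => H; apply: le_trans (ltW H).
  have X0 : 0 <= (r / q) ^+ maxn n N by rewrite exprn_ge0//; case/andP: q01.
  by rewrite mulrCA ler_wpM2l// lerDl.
have e11 : e1 <= 1 by rewrite /e1 ge_min lexx.
have e1e : e1 <= e' by rewrite /e1 ge_min lexx orbT.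
apply: le_trans e1e; have := normc_ge0 (f (rad r t) - psum f (maxn n N) (rad r t)).
move: X; move: (normc _) => y; nra.
Qed.

(* The integral of [U |p|^2] only involves the first [n] Taylor coefficients of [U p],
   so it is controlled by the values of [U] on any fixed circle of radius [rho < 1]. *)
Lemma key_pairing (p : nat -> C) n (rho : R) : 0 < rho < 1 -> exists2 A : R, 0 <= A &
  forall U (k0 : C) (del r : R), holo 1 U -> 0 < r < 1 -> 0 <= del ->
  (forall t : R, 0 <= t <= 1 -> normc (U (rad rho t) - k0) <= del) ->
  `|rint (fun t => Re (U (rad r t)) * normc (\sum_(k < n) p k * rad r t ^+ k) ^+ 2) -
    Re k0 * rint (fun t => normc (\sum_(k < n) p k * rad r t ^+ k) ^+ 2)| <= A * del.
Proof.
move=> rho01; have /andP[rho0 rho1] := rho01.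
pose P := \sum_(k < n) normc (p k).
(* Cauchy's estimate on the circle of radius [rho] bounds the [k]-th coefficient of [V] by
   [del * P / rho ^+ k]; pairing with [p] sums these bounds. *)
pose A := \sum_(k < n) normc (p k) * P / rho ^+ k.
have P0 : 0 <= P by apply: sumr_ge0 => k _; exact: normc_ge0.
have A0 : 0 <= A.
  by apply: sumr_ge0 => k _; rewrite mulr_ge0 ?mulr_ge0 ?normc_ge0// invr_ge0 exprn_ge0// ltW.
exists A => // U k0 del r hU r01 del0 Udel; have /andP[r0 r1] := r01.
pose q z := \sum_(k < n) p k * z ^+ k.
have hq : holo 1 q := @holo_sum 1 n p.
pose V z := (U z - k0) * q z.
have hV : holo 1 V by apply: holoM => //; apply: holoB => //; exact: holo_cst.
have cV := holo_contc hV r01; have cq : contc (fun t => q (rad r t)) := contc_rad_poly r p n.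
have cU := holo_contc hU r01.
have -> : rint (fun t => Re (U (rad r t)) * normc (q (rad r t)) ^+ 2) -
    Re k0 * rint (fun t => normc (q (rad r t)) ^+ 2) =
    Re (cint (fun t => V (rad r t) * (q (rad r t))^*)).
  have c2 := cont01_sqr_normc cq.
  rewrite -rintZ// -rintB; last 2 first.
  - by apply: cont01M => //; exact: cont01_Re.
  - by apply: cont01M => //; exact: cont01_cst.
  rewrite Re_cint; apply: rint_eq => t _.
  rewrite /V -[in RHS]mulrA mulcJ complexReM/= mulr0 subr0 complexReD complexReN; ring.
apply: (le_trans (ler_normRe _)); rewrite (pairing p n hV r01).
apply: (le_trans (@ler_normc_sum n _)).
rewrite /A mulr_suml; apply: ler_sum => k _.
have tV : normc (taylor_coef V k) <= del * P / rho ^+ k.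
  rewrite -(circle_coef_indep k hV rho01) /circle_coef normcf_div normcX normc_realE gtr0_norm//.
  rewrite ler_wpM2r ?invr_ge0 ?exprn_ge0 ?(ltW rho0)//.
  apply: ler_normc_cint_cst.
    by apply: contcM; [exact: holo_contc hV rho01|exact: contc_ecVX].
  move=> t t01; rewrite normcM normcX normcV normc_ec invr1 expr1n mulr1 /V normcM.
  apply: ler_pM; rewrite ?normc_ge0//; first exact: Udel.
  rewrite /q (le_trans (@ler_normc_sum n _))//; apply: ler_sum => j _.
  rewrite normcM normcX normc_rad gtr0_norm// ler_piMr ?normc_ge0//.
  by rewrite exprn_ile1// ?ltW.
move: (taylor_coef V k) tV => T tV; rewrite !normcM normcJE normcX normc_realE gtr0_norm//.
apply: (@le_trans _ _ (normc (p k) * (del * P / rho ^+ k))).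
  rewrite -[leRHS]mulr1; apply: ler_pM; rewrite ?mulr_ge0 ?normc_ge0 ?exprn_ge0 ?(ltW r0)//.
    by apply: ler_wpM2l => //; exact: normc_ge0.
  by rewrite exprn_ile1// ?ltW.
by rewrite le_eqVlt; apply/orP; left; apply/eqP; ring.
Qed.

End Taylor.

(** * The Poisson kernel and asymptotic independence *)

Section Tonelli.
Variable R : realType.
Local Notation mu := (@lebesgue_measure R).
Local Notation D := (`[0%R, 1%R]%classic : set R).

Lemma rintE (u : R -> R) : cont01 u -> (rint u)%:E = (\int[mu]_(t in D) (u t)%:E)%E.
Proof.
move=> cu; rewrite /rint /Rintegral fineK//.
by apply: integrable_fin_num => //; exact: cont01_integrable.
Qed.

Lemma cont01_measurable (u : R -> R) : cont01 u -> measurable_fun D u.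
Proof. by move=> cu; apply/measurable_EFinP; have /integrableP[] := cont01_integrable cu. Qed.

Lemma itv01P (t : R) : D t <-> 0 <= t <= 1.
Proof. by rewrite /= in_itv. Qed.

Lemma integral_square (k : R -> R -> R) :
  (\int[mu]_t \int[mu]_s (k t s * \1_D t * \1_D s)%:E = \int[mu]_(t in D) \int[mu]_(s in D) (k t s)%:E)%E.
Proof.
rewrite [RHS]integral_mkcond; apply: eq_integral => t _; rewrite patchE.
case: ifPn => [tD|/negbTE tD].
  rewrite [RHS]integral_mkcond; apply: eq_integral => s _; rewrite patchE !indicE tD mulr1.
  by case: ifPn => [sD|/negbTE sD]; rewrite ?sD ?mulr1 ?mulr0.
by under eq_integral do rewrite indicE tD mulr0 mul0r; rewrite integral0.
Qed.

(** Tonelli's theorem wants joint measurability on the plane, while [k] is continuous in each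
    variable separately on the square; [k'] is a measurable function on the plane that agrees with
    it there. The continuous bounds [a] and [b] stand in for the inner integrals. *)
Lemma rint_tonelli_le (k k' : R -> R -> R) (a b : R -> R) :
  measurable_fun setT (fun x : R * R => k' x.1 x.2) ->
  (forall t s : R, 0 <= t <= 1 -> 0 <= s <= 1 -> k' t s = k t s) ->
  (forall t s : R, 0 <= t <= 1 -> 0 <= s <= 1 -> 0 <= k t s) ->
  cont01 a -> cont01 b -> (forall s : R, 0 <= s <= 1 -> 0 <= b s) ->
  (forall t : R, 0 <= t <= 1 -> cont01 (k t)) ->
  (forall s : R, 0 <= s <= 1 -> cont01 (k ^~ s)) ->
  (forall t : R, 0 <= t <= 1 -> rint (k t) <= a t) ->
  (forall s : R, 0 <= s <= 1 -> b s <= rint (k ^~ s)) ->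
  rint b <= rint a.
Proof.
move=> mk kk' k0 ca cb b0 c1 c2 ka kb.
have mi : measurable_fun setT (\1_D : R -> R) by exact: measurable_indic.
pose f (x : R * R) := (k' x.1 x.2 * \1_D x.1 * \1_D x.2)%:E.
have mf : measurable_fun setT f.
  apply/measurable_EFinP; apply: measurable_funM; first apply: measurable_funM => //.
  - by apply: (measurableT_comp mi); exact: measurable_fst.
  - by apply: (measurableT_comp mi); exact: measurable_snd.
have f0 x : (0 <= f x)%E.
  rewrite lee_fin !indicE; case: x => t s /=.
  have [tD|tD] := boolP (t \in D); last by rewrite mulr0 mul0r.
  have [sD|sD] := boolP (s \in D); last by rewrite mulr0.
  by rewrite !mulr1 kk'; first apply: k0; apply/itv01P; rewrite -inE.
have := fubini_tonelli (m1 := mu) (m2 := mu) f mf f0; rewrite /f/= integral_square.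
have -> : (\int[mu]_y \int[mu]_x (k' x y * \1_D x * \1_D y)%:E =
    \int[mu]_(s in D) \int[mu]_(t in D) (k' t s)%:E)%E.
  rewrite -(integral_square (fun s t => k' t s)).
  by apply: eq_integral => s _; apply: eq_integral => t _; rewrite mulrAC.
move=> E; rewrite -lee_fin !rintE//.
have mF : measurable_fun D (fun t => \int[mu]_(s in D) (k' t s)%:E)%E.
  have := measurable_fun_fubini_tonelli_F (m2 := mu) f mf f0; rewrite /fubini_F => H.
  apply: (@eq_measurable_fun _ _ _ _ _ (fun x => \int[mu]_y f (x, y))%E); last exact: measurable_funTS H.
  move=> t; rewrite inE => /= tD; rewrite [RHS]integral_mkcond; apply: eq_integral => s _.
  rewrite patchE /f /= !indicE mem_set//= mulr1.
  by case: ifPn => sD; rewrite ?sD ?(negbTE sD) ?mulr1 ?mulr0.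
have mG : measurable_fun D (fun s => \int[mu]_(t in D) (k' t s)%:E)%E.
  have := measurable_fun_fubini_tonelli_G (m1 := mu) f mf f0; rewrite /fubini_G => H.
  apply: (@eq_measurable_fun _ _ _ _ _ (fun y => \int[mu]_x f (x, y))%E); last exact: measurable_funTS H.
  move=> s; rewrite inE => /= sD; rewrite [RHS]integral_mkcond; apply: eq_integral => t _.
  rewrite patchE /f /= !indicE [s \in _]mem_set//= mulr1.
  by case: ifPn => tD; rewrite ?tD ?(negbTE tD) ?mulr1 ?mulr0.
have k0D t s : D t -> D s -> (0 <= (k' t s)%:E)%E.
  by move=> /itv01P tD /itv01P sD; rewrite lee_fin kk'//; exact: k0.
apply: (@le_trans _ _ (\int[mu]_(s in D) \int[mu]_(t in D) (k' t s)%:E)%E).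
  apply: ge0_le_integral; [exact: measurable_itv| | |exact: mG|].
  - by move=> s /itv01P sD; rewrite lee_fin; exact: b0.
  - by apply/measurable_EFinP; exact: cont01_measurable.
  - move=> s /itv01P sD.
    rewrite (_ : (\int[mu]_(t in D) (k' t s)%:E = \int[mu]_(t in D) (k t s)%:E)%E).
      by rewrite -(rintE (c2 s sD)) lee_fin; exact: kb.
    by apply: eq_integral => t; rewrite inE => /itv01P tD; rewrite kk'.
rewrite -E; apply: ge0_le_integral; [exact: measurable_itv| |exact: mF| |].
- by move=> t tD; apply: integral_ge0 => s sD; exact: k0D.
- by apply/measurable_EFinP; exact: cont01_measurable.
- move=> t /itv01P tD.
  rewrite (_ : (\int[mu]_(s in D) (k' t s)%:E = \int[mu]_(s in D) (k t s)%:E)%E).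
    by rewrite -(rintE (c1 t tD)) lee_fin; exact: ka.
  by apply: eq_integral => s; rewrite inE => /itv01P sD; rewrite kk'.
Qed.

End Tonelli.

(** * The Poisson integral formula and its inequality for squared moduli *)

Section Poisson.
Variable R : realType.
Local Notation C := R[i].
Local Notation Re := (@complex.Re _).
Local Notation Im := (@complex.Im _).
Implicit Types (f g : C -> C) (a b c z : C).

Definition poisson_kernel z (t : R) : R := (1 - normc z ^+ 2) / normc (ec t - z) ^+ 2.

(** Its real part is the Poisson kernel, but it is holomorphic in [z]: composed with [F n] it has
    Taylor coefficients, and [key_pairing] applies. *)
Definition herglotz (t : R) z : C := (ec t + z) / (ec t - z).

Lemma ec_sub_neq0 z (t : R) : normc z < 1 -> ec t - z != 0.
Proof. by move=> z1; have := rad_neq t z1; rewrite /rad rmorph1 mul1r. Qed.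

Lemma poisson_kernel_gt0 z (t : R) : normc z < 1 -> 0 < poisson_kernel z t.
Proof.
move=> z1; rewrite divr_gt0 ?exprn_gt0 ?normc_gt0 ?ec_sub_neq0// subr_gt0.
by rewrite expr_lt1// normc_ge0.
Qed.

(** Harnack's bound, from [normc (ec t - z) <= 1 + normc z]. At [z0] it is the source of the factor
    [kappa]. *)
Lemma poisson_kernel_ge z (t : R) : normc z < 1 -> (1 - normc z) / (1 + normc z) <= poisson_kernel z t.
Proof.
move=> z1; have z0 := normc_ge0 z.
have H : normc (ec t - z) <= 1 + normc z by rewrite (le_trans (le_normcB _ _))// normc_ec.
have N : 0 < normc (ec t - z) by rewrite normc_gt0 ec_sub_neq0.
rewrite /poisson_kernel ler_pdivlMr ?exprn_gt0// mulrAC ler_pdivrMr; last by lra.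
have : normc (ec t - z) ^+ 2 <= (1 + normc z) ^+ 2 by rewrite lerXn2r ?nnegrE; lra.
move: (normc (ec t - z) ^+ 2) => Y; move: (normc z) z0 z1 => x; nra.
Qed.

Lemma Re_herglotz z (t : R) : normc z < 1 -> Re (herglotz t z) = poisson_kernel z t.
Proof.
move=> z1; have n0 := ec_sub_neq0 t z1.
have -> : herglotz t z = ((ec t + z) * (ec t - z)^*) * ((normc (ec t - z) ^+ 2)^-1)%:C.
  rewrite /herglotz -mulrA; congr (_ * _); apply: (mulfI n0).
  rewrite divff// mulrA mulcJ -rmorphM/= divff// ?rmorph1// expf_eq0/= normc_eq0 n0//.
rewrite complexReM/= mulr0 subr0 /poisson_kernel; congr (_ / _).
have := normc_ec t; move=> /(congr1 (fun x => x ^+ 2)); rewrite sqr_normcE expr1n => <-.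
rewrite sqr_normcE; case: (ec t) z {z1 n0} => e1 e2 [z1 z2] /=; ring.
Qed.

Lemma cont01_poisson_kernel z : normc z < 1 -> cont01 (poisson_kernel z).
Proof.
move=> z1.
have c : contc (fun t : R => ec t - z) by apply: contcB; [exact: contc_ec|exact: contc_cst].
move=> t t01; apply: continuousM; first exact: cst_continuous.
apply: continuousV; first by rewrite expf_neq0// normc_eq0 ec_sub_neq0.
exact: (cont01_sqr_normc c).
Qed.

Lemma conj_pole z (t : R) : normc z < 1 -> 1 - z^* * ec t != 0.
Proof.
move=> z1; rewrite -normc_gt0.
by have := lerB_normc 1 (z^* * ec t); rewrite normcM normc_ec normcJE mulr1 normc1; lra.
Qed.

(** The Poisson kernel is the Cauchy kernel at [z] plus a reflected kernel with pole at
    [1 / conj z], outside the closed disc. Cauchy's formula handles the first summand and Cauchy's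
    theorem annihilates the second. *)
Lemma poisson_formula rho g z : 1 < rho -> holo rho g -> normc z < 1 ->
  cint (fun t => g (ec t) * (poisson_kernel z t)%:C) = g z.
Proof.
move=> rho1 hg z1; have z0 := normc_ge0 z.
have ar : normc z < 1 < rho by rewrite z1.
have cf := cauchy_formula hg ar.
(* Since [normc z * 2 / (1 + normc z) < 1], the reflected pole stays outside the disc of radius
   [rho'], which still contains the closed unit disc. *)
pose rho' := Num.min rho (2 / (1 + normc z)).
have rho'1 : 1 < rho' by rewrite lt_min rho1/= ltr_pdivlMr; lra.
have zr' : normc z * rho' < 1.
  apply: (@le_lt_trans _ _ (normc z * (2 / (1 + normc z)))).
    by rewrite ler_wpM2l// /rho' ge_min lexx orbT.
  by rewrite mulrA ltr_pdivrMr; lra.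
pose h w := g w * (z^* * (1 - z^* * w)^-1).
have hh : holo rho' h.
  apply: holoM; first by move=> w wr; apply: hg; apply: (lt_le_trans wr); rewrite ge_min lexx.
  apply: holoM; first exact: holo_cst.
  apply: holoV.
    by apply: holoB; [exact: holo_cst|apply: holoM; [exact: holo_cst|exact: holo_id]].
  move=> w wr; rewrite -normc_gt0.
  have := lerB_normc 1 (z^* * w); rewrite normcM normcJE normc1.
  have : normc z * normc w <= normc z * rho' by rewrite ler_wpM2l// ltW.
  lra.
have r1 : (0 : R) < 1 < rho' by apply/andP; split; [exact: ltr01|].
have := cauchy_circle hh r1 => ch.
have radE t : rad 1 t = ec t :> C by rewrite /rad mul1r.
rewrite -[RHS]addr0 -ch -cf -cintD; last 2 first.
- by apply: contcM; [apply: holo_contc hg _; rewrite ltr01|exact: contc_cker].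
- by apply: contcM; [exact: holo_contc hh r1|exact: contc_ec].
apply: cint_eq => t _; rewrite /h /cker radE.
have n0 := ec_sub_neq0 t z1; have p0 := conj_pole t z1; have e0 := ec_neq0 t.
have -> : (poisson_kernel z t)%:C = (1 - z * z^*) / ((ec t - z) * ((ec t)^-1 - z^*)).
  rewrite /poisson_kernel rmorphM fmorphV rmorphB rmorph1/= !sqr_normc_re conjcB ecV//.
have p1 : (ec t)^-1 - z^* != 0.
  by apply: contra p0 => /eqP H; apply/eqP; rewrite -(mulVf e0) -mulrBl H mul0r.
have -> : (ec t)^-1 - z^* = (ec t)^-1 * (1 - z^* * ec t) by field.
by field; rewrite e0 p0 n0.
Qed.

Lemma rint_poisson_kernel z : normc z < 1 -> rint (poisson_kernel z) = 1.
Proof.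
move=> z1; apply: (@complexI R); rewrite -cint_real rmorph1.
have two1 : (1 : R) < 2 by rewrite ltr1n.
rewrite -[RHS](poisson_formula two1 (holo_cst 1) z1).
by apply: cint_eq => t _; rewrite mul1r.
Qed.

(** A variance is nonnegative: expand the square in the Poisson average of [|g - g(z)|^2], the
    average of [g] being [g z]. *)
Lemma poisson_jensen rho g z : 1 < rho -> holo rho g -> normc z < 1 ->
  normc (g z) ^+ 2 <= rint (fun t => normc (g (ec t)) ^+ 2 * poisson_kernel z t).
Proof.
move=> rho1 hg z1.
have cg : contc (fun t => g (ec t)).
  have -> : (fun t => g (ec t)) = (fun t => g (rad 1 t)) by apply/funext => t; rewrite /rad mul1r.
  by apply: holo_contc hg _; rewrite ltr01.
have cp := cont01_poisson_kernel z1; have c2 := cont01_sqr_normc cg.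
have cgp : contc (fun t => g (ec t) * (poisson_kernel z t)%:C) by apply: contcM => //; exact: cont01_real.
have : 0 <= rint (fun t => normc (g (ec t) - g z) ^+ 2 * poisson_kernel z t).
  apply: rint_ge0 => [|t _].
    by apply: cont01M => //; apply: cont01_sqr_normc; apply: contcB => //; exact: contc_cst.
  by rewrite mulr_ge0 ?sqr_ge0// ltW// poisson_kernel_gt0.
rewrite (@rint_eq _ _ (fun t => normc (g (ec t)) ^+ 2 * poisson_kernel z t + normc (g z) ^+ 2 * poisson_kernel z t -
    2 * Re ((g z)^* * (g (ec t) * (poisson_kernel z t)%:C)))); last first.
  move=> t _; rewrite !sqr_normcE; move: (g (ec t)) (g z) (poisson_kernel z t) => [x y] [x' y'] p /=; ring.
have cz : contc (fun t => (g z)^* * (g (ec t) * (poisson_kernel z t)%:C)) by apply: contcM => //; exact: contc_cst.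
have cRz := cont01_Re cz.
have cc1 : cont01 (fun=> normc (g z) ^+ 2) by exact: cont01_cst.
have rp : rint (fun t => poisson_kernel z t) = 1 := rint_poisson_kernel z1.
have cc2 : cont01 (fun=> 2 : R) by exact: cont01_cst.
rewrite rintB; [|by apply: cont01D; exact: cont01M|exact: cont01M].
rewrite rintD; [|exact: cont01M..]; rewrite (rintZ _ cp) (rintZ _ cRz) rp mulr1 -Re_cint cintZ//.
rewrite (poisson_formula rho1 hg z1) [(g z)^* * _]mulrC mulcJ /=; lra.
Qed.

Lemma normc_ec_sub z (s : R) : normc (ec s - z) ^+ 2 =
  1 + normc z ^+ 2 - 2 * (Re z * cos (2 * pi * s) + Im z * sin (2 * pi * s)).
Proof.
have := cos2Dsin2 (2 * pi * s); rewrite !sqr_normcE; case: z => x y /=.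
move: (cos _) (sin _) => u v E.
have -> : 1 + (x ^+ 2 + y ^+ 2) - 2 * (x * u + y * v) =
  (u ^+ 2 + v ^+ 2) + (x ^+ 2 + y ^+ 2) - 2 * (x * u + y * v) by rewrite E.
ring.
Qed.

(** Dilating by [R0] makes [g] holomorphic across the circle, so that [poisson_jensen] applies; the
    kernel has mean 1. *)
Lemma poisson_minorant g (R0 : R) z : holo 1 g -> (forall w, normc w < 1 -> normc (g w) <= 1) ->
  0 < R0 < 1 -> normc z < 1 ->
  rint (fun s => (1 - normc (g (rad R0 s)) ^+ 2) * poisson_kernel z s) <= 1 - normc (g (R0%:C * z)) ^+ 2.
Proof.
move=> hg g1 /andP[R00 R01] z1.
have rho1 : 1 < R0^-1 by rewrite invf_gt1.
have hG : holo R0^-1 (fun w => g (R0%:C * w)).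
  apply: (holo_comp (rho' := 1)) => //.
    by apply: holoM; [exact: holo_cst|exact: holo_id].
  by move=> w; rewrite normcM normc_realE gtr0_norm// mulrC -ltr_pdivlMr// div1r.
have := poisson_jensen rho1 hG z1 => J.
have cp := cont01_poisson_kernel z1.
have cg : contc (fun s => g (rad R0 s)) by apply: holo_contc hg _; rewrite R00.
rewrite (@rint_eq _ _ (fun s => poisson_kernel z s - normc (g (rad R0 s)) ^+ 2 * poisson_kernel z s)); last first.
  by move=> s _; ring.
rewrite rintB//; last by apply: cont01M => //; exact: cont01_sqr_normc.
have rp : rint (fun t => poisson_kernel z t) = 1 := rint_poisson_kernel z1.
by rewrite rp lerD2l lerN2.
Qed.

End Poisson.

(** * Asymptotic independence with explicit error terms *)

Section Key.
Variable R : realType.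
Local Notation C := R[i].
Local Notation Re := (@complex.Re _).
Local Notation Im := (@complex.Im _).
Local Notation D := (`[0%R, 1%R]%classic : set R).
Implicit Types (f g : C -> C) (a b c z : C).

(** The difference is [2 ec t (z - z0)] over two denominators, of modulus at least [1 - normc z0]
    and half of that: hence the 4, and a bound independent of the boundary point. *)
Lemma herglotz_lip (t : R) z z0 : normc z0 < 1 -> normc (z - z0) <= (1 - normc z0) / 2 ->
  normc (herglotz t z - herglotz t z0) <= 4 * normc (z - z0) / (1 - normc z0) ^+ 2.
Proof.
move=> z01 zz0; have z0p := normc_ge0 z0.
have q0 : 0 < 1 - normc z0 by lra.
have nz : normc z <= (1 + normc z0) / 2 by have := lerB_normc z z0; lra.
have z1 : normc z < 1 by lra.
have n0 := ec_sub_neq0 t z01; have n1 := ec_sub_neq0 t z1.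
have -> : herglotz t z - herglotz t z0 = 2 * ec t * (z - z0) / ((ec t - z) * (ec t - z0)).
  by rewrite /herglotz; field; rewrite n0 n1.
have b0 : 1 - normc z0 <= normc (ec t - z0) by have := lerB_normc (ec t) z0; rewrite normc_ec.
have b1 : (1 - normc z0) / 2 <= normc (ec t - z).
  by have := lerB_normc (ec t) z; rewrite normc_ec; lra.
rewrite normcf_div !normcM normc_ec mulr1.
have -> : normc (2 : C) = 2 :> R.
  by rewrite -(rmorph_nat (real_complex R)) normc_realE ger0_norm.
have P : (1 - normc z0) ^+ 2 / 2 <= normc (ec t - z) * normc (ec t - z0).
  have -> : (1 - normc z0) ^+ 2 / 2 = (1 - normc z0) / 2 * (1 - normc z0) by field.
  by apply: ler_pM => //; lra.
have Q : 0 < (1 - normc z0) ^+ 2 / 2 by rewrite divr_gt0// exprn_gt0.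
rewrite ler_pdivrMr; last exact: lt_le_trans P.
apply: (@le_trans _ _ (4 * normc (z - z0) / (1 - normc z0) ^+ 2 * ((1 - normc z0) ^+ 2 / 2))).
  rewrite le_eqVlt; apply/orP; left; apply/eqP; field; exact: lt0r_neq0.
by rewrite ler_wpM2l// divr_ge0 ?mulr_ge0 ?normc_ge0// ltW// exprn_gt0.
Qed.

(** Here [|x^2 - y^2| <= d (4 + d)], and the linear term is absorbed by [4 d <= tau + 4 d^2 / tau].
    The result involves only [d ^+ 2], so it can be integrated against a mean square error. *)
Lemma sqr_perturb (x y d tau : R) : 0 <= x <= 2 -> 0 <= y -> 0 < tau ->
  `|x - y| <= d -> `|x ^+ 2 - y ^+ 2| <= tau + (1 + 4 / tau) * d ^+ 2.
Proof.
move=> /andP[x0 x2] y0 tau0 xyd.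
have d0 : 0 <= d by exact: le_trans xyd.
have H : `|x ^+ 2 - y ^+ 2| <= d * (4 + d).
  rewrite subr_sqr normrM (ger0_norm (addr_ge0 x0 y0)); apply: ler_pM; rewrite ?addr_ge0//.
  by move: xyd; rewrite ler_norml => /andP[]; lra.
apply: (le_trans H).
have -> : tau + (1 + 4 / tau) * d ^+ 2 = d * (4 + d) + (tau - 2 * d) ^+ 2 / tau.
  by field; exact: lt0r_neq0.
by rewrite lerDl divr_ge0 ?sqr_ge0 ?ltW.
Qed.

(** The reciprocal is written as a power with exponent -1, a measurable function on the whole line,
    and the given functions are cut off outside [[0, 1]], where nothing is known about them. *)
Lemma measurable_poisson_kernel (u v N X Y : R -> R) :
  cont01 u -> cont01 v -> cont01 N -> cont01 X -> cont01 Y ->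
  measurable_fun setT (fun x : R * R => (u \_ D) x.2 * ((1 - (N \_ D) x.1) *
   (1 + (N \_ D) x.1 - 2 * ((X \_ D) x.1 * cos (2 * pi * x.2) + (Y \_ D) x.1 * sin (2 * pi * x.2)))
     `^ (-1)) * (v \_ D) x.1).
Proof.
have mr (w : R -> R) : cont01 w -> measurable_fun setT (w \_ D).
  by move=> /cont01_measurable mw; apply/(measurable_restrictT _ _).1.
have m1 (w : R -> R) : measurable_fun setT w -> measurable_fun setT (fun x : R * R => w x.1).
  by move=> mw; apply: (measurableT_comp mw); exact: measurable_fst.
have m2 (w : R -> R) : measurable_fun setT w -> measurable_fun setT (fun x : R * R => w x.2).
  by move=> mw; apply: (measurableT_comp mw); exact: measurable_snd.
have mcos : measurable_fun setT (fun s : R => cos (2 * pi * s)).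
  apply: continuous_measurable_fun => s; apply: (@continuous_comp _ _ _ (fun s : R => 2 * pi * s)).
    by apply: continuousM; [exact: cst_continuous|exact: cvg_id].
  exact: continuous_cos.
have msin : measurable_fun setT (fun s : R => sin (2 * pi * s)).
  apply: continuous_measurable_fun => s; apply: (@continuous_comp _ _ _ (fun s : R => 2 * pi * s)).
    by apply: continuousM; [exact: cst_continuous|exact: cvg_id].
  exact: continuous_sin.
move=> /mr/m2 mu' /mr/m1 mv /mr/m1 mN /mr/m1 mX /mr/m1 mY.
move: mcos msin => /m2 mc /m2 ms.
apply: measurable_funM => //; apply: measurable_funM => //; apply: measurable_funM.
  by apply: measurable_funB => //; exact: measurable_cst.
apply: (measurableT_comp (measurable_powR (-1))).
apply: measurable_funB.
  by apply: measurable_funD => //; exact: measurable_cst.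
apply: measurable_funM; first exact: measurable_cst.
by apply: measurable_funD; exact: measurable_funM.
Qed.

Lemma holo_herglotz (F : C -> C) (s : R) : holo 1 F -> (forall z, normc z < 1 -> normc (F z) < 1) ->
  holo 1 (fun z => herglotz s (F z)).
Proof.
move=> hF F1; apply: holoM; first by apply: holoD => //; exact: holo_cst.
apply: holoV; first by apply: holoB => //; exact: holo_cst.
by move=> z /F1; exact: ec_sub_neq0.
Qed.

(* Integrate the minorant of [1 - |g(R0 F)|^2] given by the Poisson integral against
   [|p|^2] and exchange the integrals. *)
Lemma poisson_average (F g : C -> C) (p : nat -> C) K (r R0 c : R) :
  holo 1 F -> (forall z, normc z < 1 -> normc (F z) < 1) ->
  holo 1 g -> (forall z, normc z < 1 -> normc (g z) <= 1) ->
  0 < r < 1 -> 0 < R0 < 1 -> 0 <= c ->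
  (forall s : R, 0 <= s <= 1 ->
     c <= rint (fun t => Re (herglotz s (F (rad r t))) *
       normc (\sum_(k < K) p k * rad r t ^+ k) ^+ 2)) ->
  c * rint (fun s => 1 - normc (g (rad R0 s)) ^+ 2) <=
  rint (fun t => (1 - normc (g (R0%:C * F (rad r t))) ^+ 2) *
       normc (\sum_(k < K) p k * rad r t ^+ k) ^+ 2).
Proof.
move=> hF F1 hg g1 r01 R01 c0 Hc; have /andP[r0 r1] := r01; have /andP[R00 R1] := R01.
have cF := holo_contc hF r01; have cg := holo_contc hg R01.
have cp := contc_rad_poly r p K.
have nF t : normc (F (rad r t)) < 1 by apply: F1; rewrite normc_rad gtr0_norm.
pose u s := 1 - normc (g (rad R0 s)) ^+ 2.
pose v t := normc (\sum_(k < K) p k * rad r t ^+ k) ^+ 2.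
have u0 s : 0 <= u s.
  rewrite /u subr_ge0 expr_le1// ?normc_ge0// g1// normc_rad gtr0_norm//.
have v0 t : 0 <= v t by exact: sqr_ge0.
have cu : cont01 u by apply: cont01B; [exact: cont01_cst|exact: cont01_sqr_normc].
have cv : cont01 v by exact: cont01_sqr_normc.
rewrite -rintZ//.
pose k t s := u s * poisson_kernel (F (rad r t)) s * v t.
have cN := cont01_sqr_normc cF.
have cX := cont01_Re cF; have cY : cont01 (fun t => Im (F (rad r t))) by case: cF.
pose N t := normc (F (rad r t)) ^+ 2; pose X t := Re (F (rad r t)).
pose Y t := Im (F (rad r t)).
pose k' t s := (u \_ D) s * ((1 - (N \_ D) t) *
   (1 + (N \_ D) t - 2 * ((X \_ D) t * cos (2 * pi * s) + (Y \_ D) t * sin (2 * pi * s)))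
     `^ (-1)) * (v \_ D) t.
apply: (@rint_tonelli_le _ k k').
- exact: (measurable_poisson_kernel cu cv cN cX cY).
- move=> t s t01 s01; rewrite /k' !patchE !mem_set//.
  rewrite /k /poisson_kernel -normc_ec_sub powR_inv1//; exact: sqr_ge0.
- by move=> t s _ _; apply: mulr_ge0 => //; apply: mulr_ge0 => //; apply/ltW/poisson_kernel_gt0.
- apply: cont01M => //; apply: cont01B; first exact: cont01_cst.
  apply: cont01_sqr_normc.
  have hG : holo 1 (fun z => g (R0%:C * F z)).
    apply: (holo_comp (rho' := 1) _ _ hg).
      by apply: holoM => //; exact: holo_cst.
    move=> z /F1 Fz; rewrite normcM normc_realE gtr0_norm//.
    have := normc_ge0 (F z); nra.
  exact: (holo_contc hG r01).
- by apply: cont01M => //; exact: cont01_cst.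
- by move=> s _; apply: mulr_ge0 => //; exact: u0.
- move=> t t01; apply: cont01M; last exact: cont01_cst.
  by apply: cont01M => //; exact: cont01_poisson_kernel (nF t).
- move=> s s01; apply: cont01M => //; apply: cont01M; first exact: cont01_cst.
  have -> : (fun t => poisson_kernel (F (rad r t)) s) = (fun t => Re (herglotz s (F (rad r t)))).
    by apply/funext => t; rewrite Re_herglotz.
  by apply: cont01_Re; exact: (holo_contc (holo_herglotz s hF F1) r01).
- move=> t t01; rewrite /k; under eq_fun do rewrite mulrC.
  rewrite rintZ; last by apply: cont01M => //; exact: cont01_poisson_kernel (nF t).
  apply: (@le_trans _ _ (v t * (1 - normc (g (R0%:C * F (rad r t))) ^+ 2))); last by rewrite mulrC.
  by apply: ler_wpM2l => //; exact: poisson_minorant.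
- move=> s s01; rewrite /k; under eq_fun do rewrite -mulrA.
  have cpk : cont01 (fun t => poisson_kernel (F (rad r t)) s * v t).
    have -> : (fun t => poisson_kernel (F (rad r t)) s * v t) = (fun t => Re (herglotz s (F (rad r t))) * v t).
      by apply/funext => t; rewrite Re_herglotz.
    apply: cont01M => //.
    by apply: cont01_Re; exact: (holo_contc (holo_herglotz s hF F1) r01).
  rewrite rintZ//; apply: (@le_trans _ _ (u s * c)); first by rewrite mulrC.
  apply: ler_wpM2l => //; apply: le_trans (Hc s s01) _.
  rewrite le_eqVlt; apply/orP; left; apply/eqP; apply: rint_eq => t _.
  by rewrite Re_herglotz.
Qed.

(* Asymptotic independence: [F n] forgets the weight [|w|^2] because [herglotz s (F n)]
   tends to a constant near the origin, uniformly in [s]. *)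
Lemma key_inequality (w : C -> C) (F : nat -> C -> C) z0 (rho : R) :
  holo 1 w -> (forall z, normc z < 1 -> normc (w z) <= 2) ->
  (forall n, holo 1 (F n)) -> (forall n z, normc z < 1 -> normc (F n z) < 1) ->
  normc z0 < 1 -> 0 < rho < 1 ->
  (forall del : R, 0 < del -> exists n0, forall n, (n0 <= n)%N ->
     forall z, normc z <= rho -> normc (F n z - z0) <= del) ->
  forall eps : R, 0 < eps -> exists n0, forall n, (n0 <= n)%N ->
    forall g, holo 1 g -> (forall z, normc z < 1 -> normc (g z) <= 1) ->
    forall r R0 : R, 0 < r < 1 -> 0 < R0 < 1 ->
    (1 - normc z0) / (1 + normc z0) * rint (fun s => 1 - normc (g (rad R0 s)) ^+ 2) *
      rint (fun t => normc (w (rad r t)) ^+ 2) - eps <=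
    rint (fun t => (1 - normc (g (R0%:C * F n (rad r t))) ^+ 2) * normc (w (rad r t)) ^+ 2).
Proof.
move=> hw w2 hF F1 z01 rho01 Fcvg eps eps0; have /andP[rho0 rho1] := rho01.
set kap := (1 - normc z0) / _; have z0p := normc_ge0 z0.
have kap0 : 0 <= kap by rewrite divr_ge0; lra.
have kap1 : kap <= 1 by rewrite ler_pdivrMr; lra.
(* Error budget: exchanging [|w|^2] and [|p|^2] costs [2 * tau] on each side, in all [eps / 2], and
   replacing the Herglotz kernel by its value at [z0] costs [A * del <= eps / 2]. The degree [K]
   makes the mean square error at most [tau / (1 + 4 / tau)], as [sqr_perturb] requires. *)
pose tau := eps / 8; have tau0 : 0 < tau by rewrite divr_gt0.
have T0 : 0 < 1 + 4 / tau by rewrite ltr_wpDr// ltW// divr_gt0.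
have [K HK] := h2_approx hw (ler0n _ 2) w2 (divr_gt0 tau0 T0).
have [A A0 HA] := key_pairing (taylor_coef w) K rho01.
pose del := eps / (2 * (A + 1)).
have A1 : 0 < 2 * (A + 1) by lra.
have del0 : 0 < del by rewrite divr_gt0.
have Adel : A * del <= eps / 2.
  have -> : A * del = eps / 2 * (A / (A + 1)) by rewrite /del; field; lra.
  by rewrite ler_piMr ?divr_ge0 ?(ltW eps0)// ler_pdivrMr; lra.
pose q := 1 - normc z0; have q0 : 0 < q by rewrite /q; lra.
(* The first entry is the range of [herglotz_lip], the second the distance at which its bound falls
   to [del]. *)
pose del1 := Num.min (q / 2) (del * q ^+ 2 / 4).
have del10 : 0 < del1.
  by rewrite lt_min; apply/andP; split; rewrite divr_gt0// mulr_gt0// exprn_gt0.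
have [n0 Hn0] := Fcvg del1 del10.
exists n0 => n n0n g hg g1 r R0 r01 R01; have /andP[r0 r1] := r01; have /andP[R00 R1] := R01.
set I := rint _; set W := rint _.
pose p z := psum w K z.
have cp : contc (fun t => p (rad r t)) := contc_rad_poly r (taylor_coef w) K.
have cw := holo_contc hw r01.
pose P := rint (fun t => normc (p (rad r t)) ^+ 2).
have P0 : 0 <= P by apply: rint_ge0 => [|t _]; [exact: cont01_sqr_normc|exact: sqr_ge0].
have cg := holo_contc hg R01.
have I0 : 0 <= I.
  apply: rint_ge0 => [|s _].
    by apply: cont01B; [exact: cont01_cst|exact: cont01_sqr_normc].
  by rewrite subr_ge0 expr_le1// ?normc_ge0// g1// normc_rad gtr0_norm.
have I1 : I <= 1.
  apply: rint_le_cst => [|s _].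
    by apply: cont01B; [exact: cont01_cst|exact: cont01_sqr_normc].
  by rewrite gerBl sqr_ge0.
pose Th t := 1 - normc (g (R0%:C * F n (rad r t))) ^+ 2.
have GF t : normc (R0%:C * F n (rad r t)) < 1.
  have : normc (F n (rad r t)) < 1 by apply: F1; rewrite normc_rad gtr0_norm.
  rewrite normcM normc_realE gtr0_norm//.
  by move: R00 R1 (normc_ge0 (F n (rad r t))); clear; nra.
have cTh : cont01 Th.
  apply: cont01B; first exact: cont01_cst.
  apply: cont01_sqr_normc.
  have hG : holo 1 (fun z => g (R0%:C * F n z)).
    apply: (holo_comp (rho' := 1) _ _ hg).
      by apply: holoM; [exact: holo_cst|exact: hF].
    move=> z /(F1 n) Fz; rewrite normcM normc_realE gtr0_norm//.
    by move: Fz R00 R1 (normc_ge0 (F n z)); clear; nra.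
  exact: (holo_contc hG r01).
have Th01 t : 0 <= Th t <= 1.
  rewrite /Th subr_ge0 expr_le1 ?normc_ge0//= g1//= gerBl sqr_ge0//.
have cw2 := cont01_sqr_normc cw; have cp2 := cont01_sqr_normc cp.
have cd2 : cont01 (fun t => normc (w (rad r t) - p (rad r t)) ^+ 2).
  by apply: cont01_sqr_normc; exact: contcB.
pose E t := tau + (1 + 4 / tau) * normc (w (rad r t) - p (rad r t)) ^+ 2.
have cE : cont01 E.
  by apply: cont01D; [exact: cont01_cst|apply: cont01M => //; exact: cont01_cst].
have IE : rint E <= 2 * tau.
  rewrite /E rintD; [|exact: cont01_cst|by apply: cont01M => //; exact: cont01_cst].
  rewrite rint_cst rintZ//; have := HK r r01.
  by rewrite ler_pdivlMr//; rewrite -/p => H; lra.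
have ptw t : `|normc (w (rad r t)) ^+ 2 - normc (p (rad r t)) ^+ 2| <= E t.
  apply: sqr_perturb => //; rewrite ?normc_ge0//=.
    by apply: w2; rewrite normc_rad gtr0_norm.
  rewrite ler_norml; apply/andP; split; last exact: lerB_normc.
  by rewrite lerNl opprB normcBC; exact: lerB_normc.
have WP : W <= P + 2 * tau.
  apply: (@le_trans _ _ (P + rint E)); last by rewrite lerD2l.
  rewrite -rintD//; apply: ler_rint => //; first exact: cont01D.
  by move=> t _; have := ptw t; rewrite ler_norml => /andP[]; clear; lra.
have ThWP : rint (fun t => Th t * normc (p (rad r t)) ^+ 2) <=
    rint (fun t => Th t * normc (w (rad r t)) ^+ 2) + 2 * tau.
  have cTw : cont01 (fun t => Th t * normc (w (rad r t)) ^+ 2) by exact: cont01M.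
  apply: (@le_trans _ _ (rint (fun t => Th t * normc (w (rad r t)) ^+ 2) + rint E)); last by rewrite lerD2l.
  rewrite -rintD//; apply: ler_rint => //; [exact: cont01M|exact: cont01D|].
  move=> t _; have := ptw t; rewrite ler_norml => /andP[]; have /andP[] := Th01 t.
  by move: (Th t) (normc _ ^+ 2) (normc _ ^+ 2) (E t) => x y z e; clear; nra.
have main : I * (kap * P - A * del) <= rint (fun t => Th t * normc (p (rad r t)) ^+ 2).
  (* [poisson_average] takes a nonnegative constant; for a negative one the left side is at most
     0. *)
  have [c0|c0] := leP 0 (kap * P - A * del); last first.
    apply: (@le_trans _ _ 0); first by rewrite mulr_ge0_le0// ltW.
    apply: rint_ge0 => [|t _]; first exact: cont01M.
    by rewrite mulr_ge0 ?sqr_ge0//; case/andP: (Th01 t).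
  rewrite [I * _]mulrC.
  apply: (@poisson_average (F n) g (taylor_coef w) K r R0 (kap * P - A * del)) => // [|s s01].
    exact: F1.
  have hU : holo 1 (fun z => herglotz s (F n z)).
    by apply: holo_herglotz; [exact: hF|exact: F1].
  have Ud (t : R) : 0 <= t <= 1 -> normc (herglotz s (F n (rad rho t)) - herglotz s z0) <= del.
    move=> _; have H : normc (F n (rad rho t) - z0) <= del1.
      by apply: Hn0 => //; rewrite normc_rad gtr0_norm.
    have h1 : del1 <= q / 2 by rewrite /del1 ge_min lexx.
    have h2 : del1 <= del * q ^+ 2 / 4 by rewrite /del1 ge_min lexx orbT.
    apply: (le_trans (herglotz_lip s z01 (le_trans H h1))); rewrite -/q.
    by rewrite ler_pdivrMr ?exprn_gt0//; move: H h2; clear; lra.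
  have := HA _ _ del r hU r01 (ltW del0) Ud; rewrite ler_norml => /andP[+ _].
  have := poisson_kernel_ge s z01; rewrite -Re_herglotz// -/kap => H.
  have : kap * P <= Re (herglotz s z0) * P by rewrite ler_wpM2r.
  rewrite /P /p /psum; clear; lra.
move: ThWP main WP; rewrite /Th; set L1 := rint _; set L2 := rint _ => ThWP main WP.
have k1 : kap * W <= kap * P + 2 * tau.
  apply: (@le_trans _ _ (kap * (P + 2 * tau))); first by rewrite ler_wpM2l.
  by rewrite mulrDr lerD2l ler_piMl// mulr_ge0// ltW.
have : I * (kap * W) <= I * (kap * P) + 2 * tau.
  apply: (@le_trans _ _ (I * (kap * P + 2 * tau))); first by rewrite ler_wpM2l.
  by rewrite mulrDr lerD2l ler_piMl// mulr_ge0// ltW.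
have : I * (A * del) <= eps / 2.
  by apply: le_trans Adel; rewrite ler_piMl// mulr_ge0// ltW.
rewrite mulrBr in main; rewrite [kap * I]mulrC -(mulrA I kap W).
move: ThWP main; rewrite /tau; lra.
Qed.

End Key.

(** * Fatou's theorem *)

Section BoundedMeasurable.
Variable R : realType.
Local Notation mu := (@lebesgue_measure R).
Local Notation D := (`[0%R, 1%R]%classic : set R).
Implicit Types (u v : R -> R).

Lemma ae_mono (P Q : R -> Prop) : (forall t, P t -> Q t) ->
  {ae mu, forall t, P t} -> {ae mu, forall t, Q t}.
Proof. by move=> PQ; apply: (@filterS _ _ (ae_filter_ringOfSetsType mu)). Qed.

Lemma ae_and (P Q : R -> Prop) :
  {ae mu, forall t, P t} -> {ae mu, forall t, Q t} -> {ae mu, forall t, P t /\ Q t}.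
Proof. by move=> hP hQ; apply: (@filterS2 _ _ (ae_filter_ringOfSetsType mu) _ _ _ _ hP hQ). Qed.

(** Radial limits are bounded and measurable but not continuous, so the rules for [rint] are stated
    again for this class. *)
Definition bmeas u := measurable_fun D u /\ exists B, forall t : R, 0 <= t <= 1 -> `|u t| <= B.

Lemma bmeas_integrable u : bmeas u -> mu.-integrable D (EFin \o u).
Proof.
move=> [mu_ [B uB]]; apply: measurable_bounded_integrable => //.
  by rewrite /= lebesgue_measure_itv/= lte_fin ltr01/= -EFinB ltry.
exists B; split; first exact: num_real.
move=> M BM t /itv01P t01; apply: (le_trans (uB t t01)); exact: ltW.
Qed.

Lemma cont01_bmeas u : cont01 u -> bmeas u.
Proof.
move=> cu; split; first exact: cont01_measurable.
apply: cont01_bounded => t t01.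
by apply: (@continuous_comp _ _ _ u); [exact: cu|exact: norm_continuous].
Qed.

Lemma bmeasD u v : bmeas u -> bmeas v -> bmeas (fun t => u t + v t).
Proof.
move=> [mu_ [B uB]] [mv [B' vB]]; split; first exact: measurable_funD.
exists (B + B') => t t01; apply: (le_trans (ler_normD _ _)); apply: lerD; [exact: uB|exact: vB].
Qed.

Lemma bmeasM u v : bmeas u -> bmeas v -> bmeas (fun t => u t * v t).
Proof.
move=> [mu_ [B uB]] [mv [B' vB]]; split; first exact: measurable_funM.
by exists (B * B') => t t01; rewrite normrM; apply: ler_pM => //; [exact: uB|exact: vB].
Qed.

Lemma bmeas_cst k : bmeas (fun=> k).
Proof. by apply: cont01_bmeas; exact: cont01_cst. Qed.

Lemma bmeasB u v : bmeas u -> bmeas v -> bmeas (fun t => u t - v t).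
Proof.
move=> bu bv; under eq_fun do rewrite -[- v _]mulN1r.
by apply: bmeasD => //; apply: bmeasM => //; exact: bmeas_cst.
Qed.

Lemma bmeas_norm u : bmeas u -> bmeas (fun t => `|u t|).
Proof.
move=> [mu_ [B uB]]; split; first exact: measurableT_comp.
by exists B => t t01; rewrite normr_id; exact: uB.
Qed.

Lemma bmeas_indic (A : set R) : measurable A -> bmeas (\1_A).
Proof.
move=> mA; split; first exact: measurable_indic.
by exists 1 => t _; rewrite indicE; case: (_ \in _); rewrite ?normr1 ?normr0.
Qed.

Lemma brintD u v : bmeas u -> bmeas v -> rint (fun t => u t + v t) = rint u + rint v.
Proof. by move=> cu cv; rewrite /rint RintegralD//; exact: bmeas_integrable. Qed.

Lemma brintB u v : bmeas u -> bmeas v -> rint (fun t => u t - v t) = rint u - rint v.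
Proof. by move=> cu cv; rewrite /rint RintegralB//; exact: bmeas_integrable. Qed.

Lemma brintZ u k : bmeas u -> rint (fun t => k * u t) = k * rint u.
Proof. by move=> cu; rewrite /rint RintegralZl//; exact: bmeas_integrable. Qed.

Lemma ler_brint u v : bmeas u -> bmeas v -> (forall t : R, 0 <= t <= 1 -> u t <= v t) ->
  rint u <= rint v.
Proof. by move=> cu cv uv; apply: le_Rintegral => //; exact: bmeas_integrable. Qed.

Lemma brint_ge0 u : (forall t : R, 0 <= t <= 1 -> 0 <= u t) -> 0 <= rint u.
Proof. by move=> u0; apply: Rintegral_ge0. Qed.

Lemma brint_norm u : bmeas u -> `|rint u| <= rint (fun t => `|u t|).
Proof. by move=> bu; apply: le_normr_Rintegral => //; exact: bmeas_integrable. Qed.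

Lemma brint_EFin u : bmeas u -> (rint u)%:E = (\int[mu]_(t in D) (u t)%:E)%E.
Proof.
move=> bu; rewrite /rint /Rintegral fineK//.
by apply: integrable_fin_num => //; exact: bmeas_integrable.
Qed.

Lemma brint_sum n (F : nat -> R -> R) : (forall k, bmeas (F k)) ->
  bmeas (fun t => \sum_(k < n) F k t) /\
  rint (fun t => \sum_(k < n) F k t) = \sum_(k < n) rint (F k).
Proof.
move=> bF; elim: n => [|n [b IH]].
  under eq_fun do rewrite big_ord0; split; first exact: bmeas_cst.
  by rewrite big_ord0 rint_cst.
under eq_fun do rewrite big_ord_recr/=; split; first exact: bmeasD.
by rewrite brintD// IH big_ord_recr.
Qed.

Lemma rint_dct (u_ : nat -> R -> R) u (B : R) : (forall n, measurable_fun D (u_ n)) ->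
  measurable_fun D u -> (forall n t, 0 <= t <= 1 -> `|u_ n t| <= B) ->
  {ae mu, forall t, 0 <= t <= 1 -> u_ ^~ t @ \oo --> u t} ->
  rint (u_ n) @[n --> \oo] --> rint u.
Proof.
move=> mu_ mu' uB cv.
have bc : mu.-integrable D (EFin \o (fun=> B)) by apply: bmeas_integrable; exact: bmeas_cst.
have [] := @dominated_convergence _ _ _ mu D (measurable_itv _) (fun n => EFin \o u_ n) (EFin \o u) (EFin \o (fun=> B)).
- by move=> n; apply/measurable_EFinP; exact: mu_.
- exact/measurable_EFinP.
- apply: ae_mono cv => t H /itv01P tD; apply: cvg_EFin; last exact: H.
  exact: nearW.
- exact: bc.
- by apply: aeW => t n /itv01P tD /=; rewrite lee_fin; exact: uB.
move=> iu _ H; apply: fine_cvg.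
by rewrite fineK; [exact: H|exact: integrable_fin_num].
Qed.

(** By monotone convergence the full series has integral at most 2, hence is finite almost
    everywhere and bounds its partial sums. *)
Lemma ae_bounded_sums (d : nat -> R -> R) : (forall n, cont01 (d n)) ->
  (forall n t, 0 <= d n t) -> (forall n, rint (d n) <= 2 ^- n) ->
  {ae mu, forall t, 0 <= t <= 1 -> exists K, forall n, \sum_(0 <= j < n) d j t <= K}.
Proof.
move=> cd d0 dn.
pose g t := (\sum_(0 <= n <oo) (d n t)%:E)%E.
have md n : measurable_fun D (fun t => (d n t)%:E).
  by apply/measurable_EFinP; exact: cont01_measurable.
have g0 t : (0 <= g t)%E by apply: nneseries_ge0 => n _ _; rewrite lee_fin.
have mg : measurable_fun D g.
  have := @ge0_emeasurable_sum _ _ _ D (fun n t => (d n t)%:E) xpredT.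
  by apply => // k x _ _; rewrite lee_fin.
have ig : mu.-integrable D g.
  apply/integrableP; split => //.
  under eq_integral do rewrite gee0_abs//.
  rewrite integral_nneseries//; last by move=> n t _; rewrite lee_fin.
  apply: (@le_lt_trans _ _ 2%:E); last by rewrite ltry.
  apply: lime_le.
    by apply: is_cvg_nneseries => n _ _; apply: integral_ge0 => t _; rewrite lee_fin.
  apply: nearW => n.
  have -> : (\sum_(0 <= i < n) \int[mu]_(t in D) (d i t)%:E = (\sum_(0 <= i < n) rint (d i))%:E)%E.
    by rewrite -sumEFin; apply: eq_bigr => i _; rewrite brint_EFin//; exact: cont01_bmeas.
  rewrite lee_fin.
  have H : \sum_(0 <= i < n) (2 : R) ^- i = 2 - 2 * 2 ^- n.
    elim: n => [|n IH]; first by rewrite big_nil expr0 invr1; ring.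
    rewrite big_nat_recr//= IH exprS; field.
    by rewrite expf_neq0.
  apply: (@le_trans _ _ (\sum_(0 <= i < n) (2 : R) ^- i)); first exact: ler_sum.
  by rewrite H gerBl mulr_ge0// invr_ge0 exprn_ge0.
have := @integrable_ae _ _ _ mu D (measurable_itv _) g ig; apply: ae_mono => t H /itv01P/H gf.
exists (fine (g t)) => n; rewrite -lee_fin fineK//.
rewrite -sumEFin.
exact: (@nneseries_lim_ge R (fun j => (d j t)%:E) xpredT 0 n (fun _ _ _ => d0 _ _)).
Qed.

Lemma cvg_of_bounded_sums (u d : nat -> R) (K : R) :
  (forall n, `|u n.+1 - u n| <= d n) -> (forall n, \sum_(0 <= j < n) d j <= K) -> cvgn u.
Proof.
move=> ud dK; have d0 n : 0 <= d n by exact: le_trans (ud n).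
have cd : cvgn (series d).
  apply: nondecreasing_is_cvgn.
    by apply: nondecreasing_series => n _ _; exact: d0.
  by exists K => _ [n _ <-]; exact: dK.
have cn : cvgn [normed series (fun n => u n.+1 - u n)].
  by apply: (series_le_cvg _ d0 ud cd) => n; exact: normr_ge0.
have : cvgn (series (fun n => u n.+1 - u n)) by exact: normed_cvg.
have -> : series (fun n => u n.+1 - u n) = fun n => u n - u 0%N.
  by apply/funext => n; rewrite /series/= telescope_sumr.
move: (u 0%N) => a /cvg_ex[l Hl]; apply/cvg_ex; exists (l + a).
have Hc : (fun=> a) n @[n --> \oo] --> a by exact: cvg_cst.
rewrite (_ : u = (fun n => u n - a) + (fun=> a)); first exact: (cvgD Hl Hc).
by apply/funext => n; rewrite /= addrfctE subrK.
Qed.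

End BoundedMeasurable.

(** * Mean square Cauchy property along radii *)

Section RadialCauchy.
Variable R : realType.
Local Notation mu := (@lebesgue_measure R).
Local Notation D := (`[0%R, 1%R]%classic : set R).
Local Notation C := R[i].
Local Notation Re := (@complex.Re _).
Local Notation Im := (@complex.Im _).
Implicit Types (f g : C -> C) (a b c z : C).

(** Bernoulli's inequality keeps [r ^+ k] and [s ^+ k] between [1 - k * del] and 1, so the
    polynomial moves by at most [M * del], whatever the angle. *)
Lemma psum_radial f n (e : R) : 0 < e -> exists2 del : R, 0 < del &
  forall r s t : R, 1 - del <= r -> r < 1 -> 1 - del <= s -> s < 1 -> 0 < r -> 0 < s ->
  normc (psum f n (rad r t) - psum f n (rad s t)) <= e.
Proof.
move=> e0; pose M := \sum_(k < n) normc (taylor_coef f k) * k%:R.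
have M0 : 0 <= M by apply: sumr_ge0 => k _; rewrite mulr_ge0 ?normc_ge0.
have M1 : 0 < M + 1 by lra.
exists (Num.min 1 (e / (M + 1))); first by rewrite lt_min ltr01 divr_gt0.
set del := Num.min _ _ => r s t r1 r1' s1 s1' r0 s0.
have del0 : 0 < del by rewrite lt_min ltr01 divr_gt0.
have del1 : del <= 1 by rewrite ge_min lexx.
have dele : del * (M + 1) <= e by rewrite -ler_pdivlMr// ge_min lexx orbT.
have pw x k : 1 - del <= x -> 0 < x -> x < 1 -> 1 - k%:R * del <= x ^+ k <= 1.
  move=> xd x0 x1; apply/andP; split; last by rewrite exprn_ile1 ?ltW.
  apply: (@le_trans _ _ ((1 - del) ^+ k)).
    by apply: bernoulli_ineq; rewrite (ltW del0).
  by apply: lerXn2r => //; rewrite nnegrE ?subr_ge0// ltW.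
apply: (@le_trans _ _ (M * del)); last first.
  by apply: le_trans dele; rewrite mulrC ler_wpM2l ?(ltW del0)// lerDl.
rewrite /psum -sumrB (le_trans (@ler_normc_sum R n _))// mulr_suml.
apply: ler_sum => k _; rewrite -mulrBr normcM -mulrA ler_wpM2l ?normc_ge0//.
rewrite /rad !exprMn -mulrBl normcM normcX normc_ec expr1n mulr1.
have -> : r%:C ^+ k - s%:C ^+ k = (r ^+ k - s ^+ k)%:C by rewrite rmorphB !rmorphXn.
rewrite normc_realE.
have /andP[] := pw r k r1 r0 r1'; have /andP[] := pw s k s1 s0 s1'.
by rewrite ler_norml => a b a' b'; apply/andP; split; lra.
Qed.

Lemma sqr_normc_three a b c z : normc (a - b) ^+ 2 <=
  3 * normc (a - c) ^+ 2 + 3 * normc (b - z) ^+ 2 + 3 * normc (c - z) ^+ 2.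
Proof.
have T : normc (a - b) <= normc (a - c) + normc (c - z) + normc (b - z).
  rewrite -addrA (le_trans (normc_triangle c _ _))// lerD2l.
  by rewrite (le_trans (normc_triangle z _ _))// lerD2l (normcBC z).
have := normc_ge0 (a - b); move: T.
move: (normc (a - b)) (normc (a - c)) (normc (c - z)) (normc (b - z)) => x y w v T x0.
have : x ^+ 2 <= (y + w + v) ^+ 2 by apply: lerXn2r => //; rewrite nnegrE// (le_trans x0).
have : 0 <= (y - w) ^+ 2 + (w - v) ^+ 2 + (y - v) ^+ 2 by rewrite !addr_ge0// sqr_ge0.
lra.
Qed.

Lemma rint_three (u v w : R -> R) (e : R) : cont01 u -> cont01 v -> cont01 w ->
  (forall t, w t <= 3 * u t + 3 * v t + 3 * e) -> rint u <= e -> rint v <= e -> rint w <= 9 * e.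
Proof.
move=> cu cv cw H ue ve; have c3 : cont01 (fun=> 3 : R) := @cont01_cst _ 3.
have c3u := cont01M c3 cu; have c3v := cont01M c3 cv.
have ce : cont01 (fun=> 3 * e) := @cont01_cst _ (3 * e).
apply: (@le_trans _ _ (3 * rint u + 3 * rint v + 3 * e)); last lra.
rewrite -(rintZ 3 cu) -(rintZ 3 cv) -[X in _ + X](rint_cst (3 * e)).
rewrite -(rintD c3u c3v) -(rintD (cont01D c3u c3v) ce).
by apply: ler_rint => //; apply: cont01D => //; exact: cont01D.
Qed.

Lemma h2_cauchy f (B e : R) : holo 1 f -> 0 <= B -> (forall z, normc z < 1 -> normc (f z) <= B) ->
  0 < e -> exists2 r0 : R, 0 < r0 < 1 & forall r s : R, r0 <= r < 1 -> r0 <= s < 1 ->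
    rint (fun t => normc (f (rad r t) - f (rad s t)) ^+ 2) <= e.
Proof.
move=> hf B0 fB e0.
have e9 : 0 < e / 9 by rewrite divr_gt0.
have [n Hn] := h2_approx hf B0 fB e9.
pose e1 := Num.min 1 (e / 9); have e10 : 0 < e1 by rewrite lt_min ltr01.
have [del del0 Hd] := psum_radial f n e10.
pose r0 := Num.max 2^-1 (1 - del).
have r00 : 0 < r0 by rewrite lt_max half_gt0.
have r01 : r0 < 1 by rewrite gt_max half_lt1/=; lra.
exists r0; first by rewrite r00.
move=> r s /andP[rr r1] /andP[sr s1].
have r_0 := lt_le_trans r00 rr; have s_0 := lt_le_trans r00 sr.
have h1 : 0 < r < 1 by rewrite r_0. have h2 : 0 < s < 1 by rewrite s_0.
have dr : 1 - del <= r by apply: le_trans rr; rewrite /r0 le_max lexx orbT.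
have ds : 1 - del <= s by apply: le_trans sr; rewrite /r0 le_max lexx orbT.
have cr := holo_contc hf h1; have cs := holo_contc hf h2.
have pr : contc (fun t => psum f n (rad r t)) := contc_rad_poly r (taylor_coef f) n.
have ps : contc (fun t => psum f n (rad s t)) := contc_rad_poly s (taylor_coef f) n.
have c1 := cont01_sqr_normc (contcB cr pr); have c2 := cont01_sqr_normc (contcB cs ps).
have c0 := cont01_sqr_normc (contcB cr cs).
have -> : e = 9 * (e / 9) by field.
apply: (rint_three c1 c2 c0 _ (Hn r h1) (Hn s h2)) => t; apply: (le_trans (sqr_normc_three _ _ (psum f n (rad r t)) (psum f n (rad s t)))).
rewrite lerD2l ler_pM2l//.
have H := Hd r s t dr r1 ds s1 r_0 s_0.
have e11 : e1 <= 1 by rewrite /e1 ge_min lexx.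
have e1e : e1 <= e / 9 by rewrite /e1 ge_min lexx orbT.
have := normc_ge0 (psum f n (rad r t) - psum f n (rad s t)); move: H.
by move: (normc (psum f n (rad r t) - psum f n (rad s t))) => x; nra.
Qed.

(* Along radii with [int |f_{r_{n+1}} - f_{r_n}|^2 <= 4^-n] the increments are summable
   almost everywhere. *)
Lemma radial_subsequence f (B : R) : holo 1 f -> 0 <= B ->
  (forall z, normc z < 1 -> normc (f z) <= B) ->
  exists2 r : nat -> R, (forall n, 1 - 2 ^- n <= r n < 1 /\ 0 < r n) &
   {ae mu, forall t, 0 <= t <= 1 -> cvgn (fun n => Re (f (rad (r n) t)))}.
Proof.
move=> hf B0 fB.
have H n : exists r0 : R, 0 < r0 < 1 /\ forall r s : R, r0 <= r < 1 -> r0 <= s < 1 ->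
    rint (fun t => normc (f (rad r t) - f (rad s t)) ^+ 2) <= 4 ^- n.
  have e0 : 0 < 4 ^- n :> R by rewrite invr_gt0 exprn_gt0.
  by have [r0 r01 Hr] := h2_cauchy hf B0 fB e0; exists r0.
have [q qP] := choice H.
(* The running maximum puts both [rr n] and [rr n.+1] above [q n], so consecutive radii fall under
   the same Cauchy estimate. *)
pose rr := fix rr n := Num.max (Num.max (q n) (1 - 2 ^- n)) (if n is m.+1 then rr m else 0).
have rrS n : rr n.+1 = Num.max (Num.max (q n.+1) (1 - 2 ^- n.+1)) (rr n) by [].
have rr1 n : rr n < 1.
  have P m : Num.max (q m) (1 - 2 ^- m) < 1.
    rewrite gt_max; have [/andP[_ ->] _] := qP m.
    by rewrite gtrBl invr_gt0 exprn_gt0.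
  elim: n => [|n IH]; last by rewrite rrS gt_max P.
  by rewrite [rr 0%N]/(Num.max (Num.max (q 0%N) (1 - 2 ^- 0)) 0) gt_max P/=.
have rrq n : q n <= rr n by case: n => [|n]; rewrite /= !le_max lexx.
have rr2 n : 1 - 2 ^- n <= rr n by case: n => [|n]; rewrite /= !le_max lexx orbT.
have rr0 n : 0 < rr n by apply: lt_le_trans (rrq n); have [/andP[]] := qP n.
have rrmono n : rr n <= rr n.+1 by rewrite rrS le_max lexx orbT.
exists rr; first by move=> n; rewrite rr2 rr1 rr0.
have cf n : contc (fun t => f (rad (rr n) t)) by apply: holo_contc hf _; rewrite rr0 rr1.
pose d n t := normc (f (rad (rr n.+1) t) - f (rad (rr n) t)).
have cd n : cont01 (d n) by apply: cont01_normc; exact: contcB.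
have : {ae mu, forall t, 0 <= t <= 1 -> exists K, forall n, \sum_(0 <= j < n) d j t <= K}.
  apply: ae_bounded_sums => // [n t|n]; first exact: normc_ge0.
  have [_ Hq] := qP n.
  have P2 : 0 < 2 ^+ n :> R by rewrite exprn_gt0.
  have E : rint (fun t => d n t ^+ 2) <= 4 ^- n.
    by apply: Hq; rewrite rr1 andbT ?rrq// (le_trans (rrq n)).
  have cd2 : cont01 (fun t => d n t ^+ 2) by exact: cont01X.
  have c1 : cont01 (fun=> 2 ^- n / 2 : R) by exact: cont01_cst.
  have c2 : cont01 (fun=> 2 ^+ n / 2 : R) by exact: cont01_cst.
  (* The inequality [2 d <= 2^-n + 2^n d^2] converts the bound [4^-n] for the squares into the
     summable bound [2^-n] for [d] itself. *)
  apply: (@le_trans _ _ (rint (fun t => 2 ^- n / 2 + 2 ^+ n / 2 * d n t ^+ 2))).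
    apply: ler_rint => // [|t _]; first by apply: cont01D => //; exact: cont01M.
    have -> : 2 ^- n / 2 + 2 ^+ n / 2 * d n t ^+ 2 = d n t + 2 ^- n / 2 * (1 - 2 ^+ n * d n t) ^+ 2.
      by field; exact: lt0r_neq0.
    by rewrite lerDl mulr_ge0 ?sqr_ge0// divr_ge0// ltW// invr_gt0.
  rewrite rintD//; last exact: cont01M.
  rewrite rint_cst rintZ//.
  have : 2 ^+ n / 2 * rint (fun t => d n t ^+ 2) <= 2 ^+ n / 2 * 4 ^- n.
    by rewrite ler_wpM2l// divr_ge0// ltW.
  have -> : 2 ^+ n / 2 * 4 ^- n = 2 ^- n / 2 :> R.
    rewrite (_ : 4 = 2 ^+ 2 :> R); last by rewrite -natrX.
    by rewrite -exprM mulnC exprM; field; exact: lt0r_neq0.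
  have -> : (2 : R) ^- n = 2 ^- n / 2 + 2 ^- n / 2 by field; exact: lt0r_neq0.
  lra.
apply: ae_mono => t Ht t01; have [K HK] := Ht t01.
apply: (@cvg_of_bounded_sums _ _ (d ^~ t) K) => // n.
by rewrite /d -complexReN -complexReD; exact: ler_normRe.
Qed.

End RadialCauchy.

(** * Approximate identities at Lebesgue points *)

Section KernelBound.
Variable R : realType.
Local Notation mu := (@lebesgue_measure R).
Local Notation D := (`[0%R, 1%R]%classic : set R).

(** A kernel below both [2 / h] and [2 h / s^2] is dominated by a sum of multiples of indicators of
    dyadic balls: on the shell from [2^n h] to [2^(n+1) h] it is at most
    [2 h / (2^n h)^2 = 8 / (4^(n+1) h)], the weight of the outer ball. *)
Lemma dyadic_pointwise (K s h : R) n : 0 < h -> 0 <= K -> K <= 2 / h -> K * s ^+ 2 <= 2 * h ->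
  `|s| < 2 ^+ n * h -> K <= \sum_(j < n.+1) 8 / (4 ^+ j * h) * (`|s| < 2 ^+ j * h)%R%:R.
Proof.
move=> h0 K0 K1 K2; elim: n => [|n IH] sn.
  rewrite big_ord1 sn mulr1 expr0 mul1r; apply: (le_trans K1).
  by rewrite ler_pM2r ?invr_gt0//; lra.
have P j : 0 <= 8 / (4 ^+ j * h) by rewrite divr_ge0// mulr_ge0 ?exprn_ge0// ltW.
rewrite big_ord_recr/= sn mulr1.
have [/IH H|H] := ltP `|s| (2 ^+ n * h).
  by apply: (le_trans H); rewrite lerDl.
rewrite -[leLHS]add0r; apply: lerD.
  by apply: sumr_ge0 => j _; rewrite mulr_ge0.
have p0 : 0 < 2 ^+ n * h by rewrite mulr_gt0// exprn_gt0.
have H2 : (2 ^+ n * h) ^+ 2 <= s ^+ 2.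
  by rewrite -(real_normK (num_real s)); apply: lerXn2r => //; rewrite nnegrE ?normr_ge0// ltW.
have -> : 8 / (4 ^+ n.+1 * h) = 2 * h / (2 ^+ n * h) ^+ 2.
  rewrite exprMn -exprM mulnC exprM (_ : 2 ^+ 2 = 4 :> R); last by rewrite -natrX.
  rewrite exprS; field; rewrite (lt0r_neq0 h0)/=.
  by rewrite expf_neq0// pnatr_eq0.
rewrite ler_pdivlMr ?exprn_gt0//; apply: le_trans K2.
by rewrite ler_wpM2l.
Qed.

Lemma ball_normP (t0 eta t : R) : (t \in (ball t0 eta : set R)) = (`|t - t0| < eta).
Proof.
by apply/idP/idP; rewrite inE /ball/= distrC.
Qed.

Lemma dyadic_scale (h del : R) : 0 < h -> h < del ->
  exists n, del <= 2 ^+ n * h < 2 * del.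
Proof.
move=> h0 hd.
have E : exists n, del <= 2 ^+ n * h.
  have [n Hn] := exprn_big del h0; exists n.
  by rewrite ltW// mulrC -ltr_pdivrMr// exprn_gt0.
have := ex_minnP E; case=> [[|n]] Hn Hmin; first by move: Hn; rewrite expr0 mul1r; lra.
exists n.+1; rewrite Hn/= exprS -mulrA ltr_pM2l// ltNge.
by apply/negP => /Hmin; rewrite ltnn.
Qed.

(** The ball of radius [2^j h] contributes [8 / (4^j h)] times [eps 2^j h], that is [8 eps 2^-j],
    and these sum to less than [16 eps]. All radii used are below [2 * del]; beyond [del] the kernel
    is simply [O(h)]. *)
Lemma dyadic_bound (phi K : R -> R) (t0 h eps del c B : R) :
  bmeas phi -> (forall t, 0 <= phi t) -> (forall t, 0 <= t <= 1 -> phi t <= B) ->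
  bmeas K -> 0 < h -> h < del -> 0 <= eps -> 0 <= c ->
  (forall eta, 0 < eta -> eta < 2 * del -> rint (fun t => phi t * \1_(ball t0 eta : set R) t) <= eps * eta) ->
  (forall t, 0 <= t <= 1 -> 0 <= K t /\ K t <= 2 / h) ->
  (forall t, 0 <= t <= 1 -> `|t - t0| < del -> K t * (t - t0) ^+ 2 <= 2 * h) ->
  (forall t, 0 <= t <= 1 -> del <= `|t - t0| -> K t <= c * h) ->
  rint (fun t => phi t * K t) <= 16 * eps + c * h * B.
Proof.
move=> bphi phi0 phiB bK h0 hdel eps0 c0 small K1 K2 K3.
have [n /andP[n1 n2]] := dyadic_scale h0 hdel.
pose F j t := 8 / (4 ^+ j * h) * (phi t * \1_(ball t0 (2 ^+ j * h) : set R) t).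
have bball j : bmeas (fun t => phi t * \1_(ball t0 (2 ^+ j * h) : set R) t).
  by apply: bmeasM => //; apply: bmeas_indic; exact: measurable_ball.
have bF j : bmeas (F j) := bmeasM (bmeas_cst _) (bball j).
have [bS SE] := brint_sum n.+1 bF.
have bc : bmeas (fun t => c * h * phi t) := bmeasM (bmeas_cst _) bphi.
have bphiK := bmeasM bphi bK.
apply: (@le_trans _ _ (rint (fun t => \sum_(j < n.+1) F j t + c * h * phi t))).
  apply: (ler_brint bphiK (bmeasD bS bc)) => t t01.
  have [Kt0 Kt1] := K1 t t01.
  have F0 : 0 <= \sum_(j < n.+1) F j t.
    apply: sumr_ge0 => j _; apply: mulr_ge0; last by apply: mulr_ge0 => //; rewrite indicE.
    by apply: divr_ge0 => //; apply: mulr_ge0; [exact: exprn_ge0|exact: ltW].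
  have [tn|tf] := ltP `|t - t0| del.
    have := dyadic_pointwise h0 Kt0 Kt1 (K2 t t01 tn) (lt_le_trans tn n1) => H.
    rewrite -[leLHS]addr0; apply: lerD; last by rewrite !mulr_ge0// ltW.
    apply: (le_trans (ler_wpM2l (phi0 t) H)).
    rewrite mulr_sumr; apply: ler_sum => j _.
    by rewrite /F indicE ball_normP mulrCA.
  rewrite -[leLHS]add0r; apply: lerD => //.
  by rewrite mulrC ler_wpM2r// K3.
rewrite (brintD bS bc) SE (brintZ _ bphi); apply: lerD; last first.
  apply: ler_wpM2l; first by rewrite mulr_ge0// ltW.
  by rewrite -[leRHS]rint_cst; apply: (ler_brint bphi (bmeas_cst B)).
apply: (@le_trans _ _ (\sum_(j < n.+1) 8 * eps * 2 ^- j)).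
  apply: ler_sum => j _; rewrite (brintZ _ (bball j)).
  have p0 : 0 < 4 ^+ j * h by rewrite mulr_gt0// exprn_gt0.
  have q0 : 0 < 2 ^+ j :> R by rewrite exprn_gt0.
  have qn : 2 ^+ j * h < 2 * del.
    apply: le_lt_trans n2; rewrite ler_pM2r//.
    by rewrite ler_weXn2l ?ler1n// -ltnS ltn_ord.
  have := small _ (mulr_gt0 q0 h0) qn => H.
  apply: (le_trans (ler_wpM2l (ltW (divr_gt0 _ p0)) H)) => //.
  rewrite le_eqVlt; apply/orP; left; apply/eqP.
  rewrite (_ : 4 = 2 ^+ 2 :> R); last by rewrite -natrX.
  by rewrite -exprM mulnC exprM; field; rewrite !lt0r_neq0.
rewrite -mulr_sumr.
have -> : \sum_(j < n.+1) (2 : R) ^- j = 2 - 2 ^- n.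
  elim: n {n1 n2 bS SE} => [|m IH]; first by rewrite big_ord1 expr0 invr1; ring.
  rewrite big_ord_recr/= IH exprS; field.
  by rewrite expf_neq0// pnatr_eq0.
have : 0 <= (2 : R) ^- n by rewrite invr_ge0 exprn_ge0.
nra.
Qed.

Lemma lebesgue_pt_small (u : R -> R) (t0 eps : R) : measurable_fun setT u ->
  (exists B, forall t, `|u t| <= B) -> lebesgue_pt u t0 -> 0 < eps ->
  exists2 del : R, 0 < del & forall eta, 0 < eta -> eta < del ->
    rint (fun t => `|u t - u t0| * \1_(ball t0 eta : set R) t) <= eps * eta.
Proof.
move=> mu_ [B uB] lu eps0.
(* [davg] divides by the length [2 * eta] of the ball, so a mean below [eps / 2] is an integral
   below [eps * eta]. *)
have e2 : (0 < (eps / 2)%:E)%E by rewrite lte_fin divr_gt0.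
have : \forall eta \near (0:R)^'+, (davg u t0 eta < (eps / 2)%:E)%E.
  have := lu [set y | (y < (eps / 2)%:E)%E] (open_ereal_lt' e2); exact.
rewrite near_withinE => /nbhs_ballP[del /= del0 H].
exists del => // eta eta0 etad.
have {H} : (davg u t0 eta < (eps / 2)%:E)%E.
  by apply: H => //; rewrite /ball/= sub0r normrN gtr0_norm.
rewrite /davg /iavg (lebesgue_measure_ball _ (ltW eta0)) inver mulrn_eq0/= gt_eqF//.
have p0 : 0 < eta *+ 2 by rewrite pmulrn_lgt0.
rewrite lte_pdivrMl// -EFinM => H.
have bu : bmeas u.
  by split; [exact: measurable_funTS|exists B => t _; exact: uB].
have bd : bmeas (fun t => `|u t - u t0|).
  by apply: bmeas_norm; apply: bmeasB => //; exact: bmeas_cst.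
have bi : bmeas (\1_(ball t0 eta : set R) : R -> R) by apply: bmeas_indic; exact: measurable_ball.
rewrite -lee_fin (brint_EFin (bmeasM bd bi)).
apply: (@le_trans _ _ (eta *+ 2 * (eps / 2))%:E); last first.
  by rewrite lee_fin mulr2n; lra.
apply: le_trans (ltW H).
have mn : measurable_fun setT (fun t => (`|u t - u t0|)%:E).
  by apply/measurable_EFinP; apply: measurableT_comp => //; apply: measurable_funB => //.
rewrite [leLHS]integral_mkcond [leRHS]integral_mkcond.
apply: ge0_le_integral => //.
- by move=> t _; apply: erestrict_ge0 => s _; rewrite lee_fin mulr_ge0// indicE.
- apply/(measurable_restrictT _ _).1 => //; apply/measurable_EFinP.
  by have [] := bmeasM bd bi.
- apply/(measurable_restrictT _ _).1; first exact: measurable_ball.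
  exact: measurable_funTS.
move=> t _; rewrite !patchE.
case: ifPn => tD; case: ifPn => tb //=.
- by rewrite lee_fin indicE tb mulr1.
- by rewrite lee_fin indicE (negbTE tb) mulr0.
- by rewrite lee_fin.
Qed.

End KernelBound.

Section Chord.
Variable R : realType.
Local Notation C := R[i].
Local Notation Re := (@complex.Re _).
Local Notation Im := (@complex.Im _).

(** The curve [ec] has speed [2 pi >= 4]; a first order error of at most 2 per unit leaves at least
    2. *)
Lemma chord_near (t0 : R) : exists2 del : R, 0 < del &
  forall t, `|t - t0| < del -> 2 * `|t - t0| <= normc (ec t - ec t0 : C).
Proof.
have [del del0 H] := path_deriv_ec t0 (ltr0n _ 2).
exists del => // t /H; set s := `|t - t0| => Hs.
have := lerB_normc (twopii R * ec t0 * (t - t0)%:C) (twopii R * ec t0 * (t - t0)%:C - (ec t - ec t0)).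
rewrite subKr (normcBC (_ * _) (ec t - ec t0)) !normcM normc_realE normc_ec -/s mulr1.
have -> : normc (twopii R) = 2 * pi.
  by rewrite /twopii /= expr0n/= add0r sqrtr_sqr ger0_norm// mulr_ge0// pi_ge0.
have := pi_ge2 R; have : 0 <= s by exact: normr_ge0.
move: Hs; set A := normc (_ - _) => Hs s0 p2; nra.
Qed.

(** Equal points force [sin (pi * |t - t0|) = 0], while a nonzero difference would put that angle
    strictly between 0 and [pi]. *)
Lemma ec_inj (t t0 : R) : `|t - t0| < 1 -> ec t = ec t0 :> C -> t = t0.
Proof.
move=> tt [c s]; apply/eqP; rewrite -subr_eq0 -normr_eq0; apply: contraT => n0.
have p0 : 0 < `|t - t0| by rewrite lt_def n0 normr_ge0.
have cE : cos (2 * pi * t - 2 * pi * t0) = 1 by rewrite cosB c s -!expr2 cos2Dsin2.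
have : sin (pi * `|t - t0|) ^+ 2 = 0.
  have := cos_mulr2n (pi * `|t - t0|); rewrite cos2sin2.
  have -> : cos ((pi * `|t - t0|) *+ 2) = 1.
    have [h|h] := leP 0 (t - t0).
      by rewrite ger0_norm// -cE; congr cos; rewrite mulr2n; ring.
    by rewrite ltr0_norm// -cE -cosN; congr cos; rewrite mulr2n; ring.
  by rewrite mulr2n; lra.
move/eqP; rewrite sqrf_eq0 => /eqP s0.
have : 0 < sin (pi * `|t - t0|).
  by apply: sin_gt0_pi; rewrite mulr_gt0 ?pi_gt0//= gtr_pMr// pi_gt0.
by rewrite s0 ltxx.
Qed.

(** Compactness; [t0] is interior because [ec] identifies the two endpoints, so that [t0 = 0] would
    have a zero chord at [t = 1]. *)
Lemma chord_far (t0 del : R) : 0 < t0 < 1 -> 0 < del -> exists2 c : R, 0 < c &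
  forall t, 0 <= t <= 1 -> del <= `|t - t0| -> c <= normc (ec t - ec t0 : C).
Proof.
move=> /andP[t00 t01] del0.
(* The added term is positive exactly within [del] of [t0]. This makes the minimum over all of
   [[0, 1]] positive without changing [m] where the bound is wanted. *)
pose m t := normc (ec t - ec t0 : C) + Num.max 0 (del - `|t - t0|).
have cm : cont01 m.
  apply: cont01D.
    by apply: cont01_normc; apply: contcB; [exact: contc_ec|exact: contc_cst].
  move=> t _; apply: (@continuous_comp _ _ _ (fun t : R => del - `|t - t0|) (fun x : R => Num.max 0 x)).
    apply: continuousB; first exact: cst_continuous.
    apply: (@continuous_comp _ _ _ (fun t : R => t - t0) (fun x : R => `|x|)).
      by apply: continuousB; [exact: cvg_id|exact: cst_continuous].
    exact: norm_continuous.
  by apply: continuous_max; [exact: cst_continuous|exact: cvg_id].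
have [c] := EVT_min ler01 (cont01_within cm).
rewrite in_itv/= => c01 Hc.
exists (m c); last first.
  move=> t t01' td; apply: (le_trans (Hc t _)); first by rewrite in_itv.
  by rewrite /m (_ : Num.max _ _ = 0) ?addr0//; apply/max_idPl; rewrite subr_le0.
have M0 : 0 <= Num.max 0 (del - `|c - t0|) by rewrite le_max lexx.
have [h|h] := ltP `|c - t0| del.
  rewrite /m ltr_wpDl ?normc_ge0// lt_max subr_gt0 h orbT//.
rewrite /m ltr_wpDr// normc_gt0 subr_eq0; apply/eqP => /ec_inj E.
have : c = t0 by apply: E; case/andP: c01 => c0 c1; rewrite ltr_norml; apply/andP; split; lra.
by move=> ct; move: h; rewrite ct subrr normr0; lra.
Qed.

End Chord.

(** * Existence of radial limits for bounded holomorphic functions *)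

Section Fatou.
Variable R : realType.
Local Notation mu := (@lebesgue_measure R).
Local Notation D := (`[0%R, 1%R]%classic : set R).
Local Notation C := R[i].
Local Notation Re := (@complex.Re _).
Local Notation Im := (@complex.Im _).
Implicit Types (f g : C -> C) (a b c z : C).

Lemma Re_poisson f z : holo 1 f -> normc z < 1 -> forall r : R, 0 < r < 1 ->
  Re (f (r%:C * z)) = rint (fun t => Re (f (rad r t)) * poisson_kernel z t).
Proof.
move=> hf z1 r /andP[r0 r1].
have rho1 : 1 < r^-1 by rewrite invf_gt1.
have hG : holo r^-1 (fun w => f (r%:C * w)).
  apply: (holo_comp (rho' := 1)) => //.
    by apply: holoM; [exact: holo_cst|exact: holo_id].
  by move=> w; rewrite normcM normc_realE gtr0_norm// mulrC -ltr_pdivlMr// div1r.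
rewrite -(poisson_formula rho1 hG z1) Re_cint; apply: rint_eq => t _.
by rewrite complexReM/= mulr0 subr0.
Qed.

Definition rlim f (t : R) (l : C) := forall e : R, 0 < e -> exists2 del : R, 0 < del &
  forall r : R, 1 - del < r -> r < 1 -> normc (f (rad r t) - l) <= e.

Lemma poisson_kernel_radial_le (r t t0 : R) : 0 < r < 1 -> 0 < poisson_kernel (rad r t0 : C) t /\
  forall q, 0 < q -> q <= normc (ec t - rad r t0 : C) -> poisson_kernel (rad r t0 : C) t * q ^+ 2 <= 2 * (1 - r).
Proof.
move=> /andP[r0 r1].
have nr : normc (rad r t0 : C) = r by rewrite normc_rad gtr0_norm.
split=> [|q q0 qn]; first by apply: poisson_kernel_gt0; rewrite nr.
have n0 : 0 < normc (ec t - rad r t0 : C) by exact: lt_le_trans qn.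
rewrite /poisson_kernel nr mulrAC ler_pdivrMr ?exprn_gt0//.
have : q ^+ 2 <= normc (ec t - rad r t0 : C) ^+ 2.
  by apply: lerXn2r => //; rewrite nnegrE ltW.
have := sqr_ge0 q; move: (normc _ ^+ 2) (q ^+ 2) => Y Q.
have -> : 1 - r ^+ 2 = (1 - r) * (1 + r) by ring.
move=> Q0 QY; rewrite [2 * _]mulrC -!mulrA ler_pM2l ?subr_gt0//; nra.
Qed.

(* [Re f] is the Poisson integral of its limit [us] along a sequence of radii, and it
   tends radially to [us t] at every Lebesgue point [t] of [us]. *)
Lemma fatou_Re f (B : R) : holo 1 f -> 0 <= B -> (forall z, normc z < 1 -> normc (f z) <= B) ->
  {ae mu, forall t, 0 < t < 1 -> exists l : R, forall e : R, 0 < e -> exists2 del : R, 0 < del &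
    forall r : R, 1 - del < r -> r < 1 -> `|Re (f (rad r t)) - l| <= e}.
Proof.
move=> hf B0 fB.
have [r r01 [N [mN N0 NP]]] := radial_subsequence hf B0 fB.
have rr n : 0 < r n < 1 by have [/andP[_ ->] ->] := r01 n.
pose u n t := Re (f (rad (r n) t)).
have cu n : cont01 (u n) by apply: cont01_Re; exact: holo_contc hf (rr n).
have uB n t : `|u n t| <= B.
  apply: (le_trans (ler_normRe _)); apply: fB; rewrite normc_rad gtr0_norm//; by case/andP: (rr n).
pose A := D `\` N.
have mA : measurable A by exact: measurableD.
have cv t : A t -> u ^~ t @ \oo --> limn (u ^~ t).
  move=> [/itv01P tD nN]; apply: contrapT => H; apply: nN; apply: NP => /= H'.
  by apply: H; exact: H' tD.
(* Set to 0 off [A], the limit is Borel on the line and bounded everywhere, so Lebesgue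
   differentiation applies. *)
pose us := (fun t => limn (u ^~ t)) \_ A.
have musA : measurable_fun A (fun t => limn (u ^~ t)).
  apply: (@measurable_fun_cvg _ _ _ A u) => // n.
  by apply: measurable_funS (cont01_measurable (cu n)) => // t [].
have mus : measurable_fun setT us by apply/(measurable_restrictT _ _).1.
have usB t : `|us t| <= B.
  rewrite /us patchE; case: ifPn => [|_]; last by rewrite normr0.
  rewrite inE => /cv H; have Hn : `|u n t| @[n --> \oo] --> `|limn (u ^~ t)|.
    by apply: cvg_comp H _; exact: norm_continuous.
  rewrite -(cvg_lim _ Hn)//; apply: limr_le; first by apply/cvg_ex; eexists; exact: Hn.
  by apply: nearW => n; exact: uB.
have bus : bmeas us.
  by split; [exact: measurable_funTS|exists B => t _; exact: usB].
have PF z : normc z < 1 -> Re (f z) = rint (fun t => us t * poisson_kernel z t).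
  move=> z1.
  have bpk := cont01_bmeas (cont01_poisson_kernel z1).
  have [mpk [M pM]] := bpk.
  have H1 : rint (fun t => u n t * poisson_kernel z t) @[n --> \oo] --> rint (fun t => us t * poisson_kernel z t).
    apply: (@rint_dct _ _ _ (B * M)).
    - by move=> n; apply: measurable_funM => //; exact: cont01_measurable.
    - by apply: measurable_funM => //; exact: measurable_funTS.
    - by move=> n t t01; rewrite normrM; apply: ler_pM => //; exact: pM.
    - exists N; split=> // t /= /not_implyP[/itv01P tD]; apply: contra_notP => nN.
      apply: cvgM; last exact: cvg_cst.
      by rewrite /us patchE mem_set//; exact: cv.
  have H2 : Re (f ((r n)%:C * z)) @[n --> \oo] --> Re (f z).
    apply/cvgrPdist_lt => e e0.
    have [d fd] := hf z z1; have [del del0 Hd] := has_deriv_cts fd e0.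
    have [m Hm] := exprn_big 1 del0.
    exists m => // n /= mn; rewrite distrC -complexReN -complexReD.
    apply: (le_lt_trans (ler_normRe _)); apply: Hd.
    have -> : (r n)%:C * z - z = - ((1 - r n)%:C * z) by rewrite rmorphB rmorph1; ring.
    rewrite normcN normcM normc_realE ger0_norm; last first.
      by rewrite subr_ge0 ltW//; case/andP: (rr n).
    apply: le_lt_trans Hm; have [/andP[+ _] _] := r01 n => Hr.
    apply: (@le_trans _ _ (2 ^- n)).
      rewrite -[leRHS]mulr1; apply: ler_pM; rewrite ?normc_ge0 ?subr_ge0 ?(ltW z1)//.
        by rewrite ltW//; case/andP: (rr n).
      by lra.
    by rewrite div1r lef_pV2 ?posrE ?exprn_gt0// ler_weXn2l// ler1n.
  have E : (fun n => Re (f ((r n)%:C * z))) = (fun n => rint (fun t => u n t * poisson_kernel z t)).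
    by apply/funext => n; exact: Re_poisson.
  rewrite E in H2.
  exact: (cvg_unique _ H2 H1).
have lus : locally_integrable setT us.
  apply: open_integrable_locally; first exact: openT.
  have -> : EFin \o us = (EFin \o us) \_ D.
    apply/funext => t; rewrite !patchE; case: ifPn => // tD.
    rewrite /= /us patchE ifF//; apply/negbTE; apply: contra tD; rewrite !inE.
    by case.
  apply/(integrable_mkcond _ _).1 => //; exact: bmeas_integrable.
have nullN : {ae mu, forall t, ~ N t} by exists N; split => // t /= /contrapT.
have := ae_and nullN (lebesgue_differentiation lus).
apply: ae_mono => t0 [nN lp] t001.
exists (us t0) => e e0.
(* [dyadic_bound] multiplies this by 16, leaving [e / 2] for the part far from [t0]. *)
have e64 : 0 < e / 32 by rewrite divr_gt0.
have [d1 d10 Hsmall] := lebesgue_pt_small mus (ex_intro _ B usB) lp e64.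
have [d2 d20 Hnear] := chord_near t0.
pose del := Num.min d2 (d1 / 2).
have del0 : 0 < del by rewrite lt_min d20 divr_gt0.
have dd2 : del <= d2 by rewrite ge_min lexx.
have dd1 : del <= d1 / 2 by rewrite ge_min lexx orbT.
clearbody del.
have [c c0 Hfar] := chord_far t001 del0.
(* Far from [t0] one has [normc (ec t - z) >= c / 2], so the kernel is at most
   [2 * h / (c / 2) ^+ 2 = k * h]; below, [2 * B] bounds [|us t - us t0|]. *)
pose k := 8 / c ^+ 2.
have k0 : 0 < k by rewrite divr_gt0// exprn_gt0.
have K0 : 0 < k * (2 * B) + 1.
  by apply: ltr_wpDl => //; apply: mulr_ge0; [exact: ltW|exact: mulr_ge0].
exists (Num.min (Num.min 1 del) (e / 2 / (k * (2 * B) + 1))).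
  by rewrite !lt_min ltr01 del0 /=; do 2 apply: divr_gt0 => //.
move=> s; rewrite ltrBlDr -ltrBlDl !lt_min => /andP[/andP[s1 sdel]] se ss.
have s0 : 0 < s by lra.
have s01 : 0 < s < 1 by rewrite s0.
pose h := 1 - s; have h0 : 0 < h by rewrite /h; lra.
pose z : C := rad s t0.
have nz : normc z = s by rewrite normc_rad gtr0_norm.
have z1 : normc z < 1 by rewrite nz.
have bpk := cont01_bmeas (cont01_poisson_kernel z1).
have blc : bmeas (fun=> us t0) := bmeas_cst _.
have bdiff := bmeasB bus blc.
have -> : Re (f z) - us t0 = rint (fun t => (us t - us t0) * poisson_kernel z t).
  rewrite PF//.
  have -> : (fun t => (us t - us t0) * poisson_kernel z t) = (fun t => us t * poisson_kernel z t - us t0 * poisson_kernel z t).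
    by apply/funext => t; rewrite mulrBl.
  have rp : rint (fun t => poisson_kernel z t) = 1 := rint_poisson_kernel z1.
  by rewrite (brintB (bmeasM bus bpk) (bmeasM blc bpk)) (brintZ _ bpk) rp mulr1.
apply: (le_trans (brint_norm (bmeasM bdiff bpk))).
have -> : (fun t => `|(us t - us t0) * poisson_kernel z t|) = (fun t => `|us t - us t0| * poisson_kernel z t).
  by apply/funext => t; rewrite normrM (gtr0_norm (poisson_kernel_gt0 t z1)).
have ge_h t : h <= normc (ec t - z) by rewrite /h -nz -(normc_ec t); exact: lerB_normc.
apply: (@le_trans _ _ (16 * (e / 32) + k * h * (2 * B))); last first.
  have -> : k * h * (2 * B) = h * (k * (2 * B)) by ring.
  move: se; rewrite -/h ltr_pdivlMr//; move: (k * (2 * B)) => x.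
  by rewrite mulrDr mulr1; move: h0; clear; lra.
apply: (@dyadic_bound _ (fun t => `|us t - us t0|) (poisson_kernel z) t0 h (e / 32) del k (2 * B)) => //.
- exact: bmeas_norm.
- move=> t _; apply: (le_trans (ler_normB _ _)).
  by move: (usB t) (usB t0); clear; lra.
- exact: ltW.
- exact: ltW.
- move=> eta eta0 etad; apply: Hsmall => //; apply: (lt_le_trans etad).
  by move: dd1; clear; lra.
- move=> t _; have [p1 p2] := poisson_kernel_radial_le t t0 s01; split; first exact: ltW.
  have := p2 h h0 (ge_h t); rewrite -/z -/h ler_pdivlMr// => H.
  by rewrite -(ler_pM2r h0) -mulrA -expr2.
- move=> t t01 td; have [_ p2] := poisson_kernel_radial_le t t0 s01.
  have [->|tt] := eqVneq t t0; first by rewrite subrr expr0n/= mulr0 mulr_ge0// ltW.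
  (* The point [z] is at distance [h] from [ec t0] and at least [h] from [ec t], so the chord is at
     most twice [normc (ec t - z)]. Being at least [2 * |t - t0|], it makes [q = |t - t0|]
     admissible. *)
  rewrite -real_normK ?num_real//; apply: p2; first by rewrite normr_gt0 subr_eq0.
  have : `|t - t0| < d2 by exact: (lt_le_trans td).
  move=> /Hnear; have := normc_triangle z (ec t) (ec t0).
  have -> : normc (z - ec t0) = h.
    have -> : z - ec t0 = - (h%:C * ec t0) by rewrite /z /rad /h rmorphB rmorph1; ring.
    by rewrite normcN normcM normc_ec normc_realE mulr1 gtr0_norm.
  by have := ge_h t; rewrite -/z; clear; lra.
- move=> t t01 td; have [_ p2] := poisson_kernel_radial_le t t0 s01.
  have := Hfar t t01 td; have := normc_triangle z (ec t) (ec t0).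
  have -> : normc (z - ec t0) = h.
    have -> : z - ec t0 = - (h%:C * ec t0) by rewrite /z /rad /h rmorphB rmorph1; ring.
    by rewrite normcN normcM normc_ec normc_realE mulr1 gtr0_norm.
  move=> T1 T2; have c2 : 0 < c / 2 by rewrite divr_gt0.
  have := p2 _ c2; rewrite -/z -/h => /(_ _) H.
  have {}H : poisson_kernel z t * (c / 2) ^+ 2 <= 2 * h by apply: H; move: (ge_h t) T1 T2; clear; lra.
  rewrite /k mulrAC ler_pdivlMr ?exprn_gt0//.
  move: H; have -> : (c / 2) ^+ 2 = c ^+ 2 / 4 by field.
  by move: (c ^+ 2) => x; clear; lra.
Qed.

(** The imaginary part of [f] is the real part of [- 'i * f]. *)
Lemma fatou f (B : R) : holo 1 f -> 0 <= B -> (forall z, normc z < 1 -> normc (f z) <= B) ->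
  {ae mu, forall t, 0 < t < 1 -> exists l, rlim f t l}.
Proof.
move=> hf B0 fB.
pose g z := - 'i * f z.
have hg : holo 1 g by apply: holoM => //; exact: holo_cst.
have gB z : normc z < 1 -> normc (g z) <= B.
  move=> /fB; rewrite /g normcM; apply: le_trans.
  by rewrite (_ : normc _ = 1) ?mul1r//= oppr0 expr0n/= add0r sqrrN expr1n sqrtr1.
have := ae_and (fatou_Re hf B0 fB) (fatou_Re hg B0 gB).
apply: ae_mono => t [H1 H2] t01.
have [l1 {}H1] := H1 t01; have [l2 {}H2] := H2 t01.
exists (l1 +i* l2) => e e0; have e2 : 0 < e / 2 by rewrite divr_gt0.
have [d1 d10 D1] := H1 _ e2; have [d2 d20 D2] := H2 _ e2.
exists (Num.min d1 d2); first by rewrite lt_min d10.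
move=> r; rewrite ltrBlDr -ltrBlDl lt_min => /andP[r1 r2] rr.
have {}D1 := D1 r; have {}D2 := D2 r.
apply: (le_trans (normc_leD _)); rewrite complexReD complexReN complexImD complexImN /=.
have G : Re (g (rad r t)) = Im (f (rad r t)) by rewrite /g complexReM/=; ring.
rewrite G in D2.
have : 1 - d1 < r by lra. move=> /D1/(_ rr) A1.
have : 1 - d2 < r by lra. move=> /D2/(_ rr) A2.
lra.
Qed.

End Fatou.

(** * Vitali's theorem and tails of iterated function systems *)

Section Vitali.
Variable R : realType.
Local Notation C := R[i].
Local Notation Re := (@complex.Re _).
Local Notation Im := (@complex.Im _).
Implicit Types (f g : C -> C) (a b c z w : C).

(** Only an upper bound is asked for: the sequences concerned are moduli and sums of moduli. *)
Definition cvg0 (u : nat -> R) := forall e : R, 0 < e -> exists N, forall n, (N <= n)%N -> u n <= e.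

Lemma cvg0D u v : cvg0 u -> cvg0 v -> cvg0 (fun n => u n + v n).
Proof.
move=> hu hv e e0; have e2 : 0 < e / 2 by rewrite divr_gt0.
have [M HM] := hu _ e2; have [N HN] := hv _ e2.
exists (maxn M N) => n; rewrite geq_max => /andP[/HM a /HN b]; lra.
Qed.

Lemma cvg0_sum k (u : nat -> nat -> R) : (forall i, (i < k)%N -> cvg0 (u i)) ->
  cvg0 (fun n => \sum_(i < k) u i n).
Proof.
elim: k => [|k IH] hu.
  by move=> e e0; exists 0%N => n _; rewrite big_ord0 ltW.
have h : cvg0 (fun n => \sum_(i < k) u i n + u k n).
  by apply: cvg0D; [apply: IH => i ik; apply: hu; rewrite ltnW|exact: hu].
by move=> e /h[N HN]; exists N => n /HN; rewrite big_ord_recr.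
Qed.

Lemma rad_bound f (B r : R) : (forall z, normc z < 1 -> normc (f z) <= B) -> 0 < r < 1 ->
  forall t : R, 0 <= t <= 1 -> normc (f (rad r t)) <= B.
Proof. by move=> fB /andP[r0 r1] t _; apply: fB; rewrite normc_rad gtr0_norm. Qed.

(* Induction on [k]: at a small point [s], the expansion of order [k] divided by [s^k]
   bounds the [k]-th coefficient by the previous ones and by [O(|s|)]. *)
Lemma vitali_coef (v : nat -> C -> C) (B : R) : (forall n, holo 1 (v n)) -> 0 <= B ->
  (forall n z, normc z < 1 -> normc (v n z) <= B) ->
  (forall rho : R, 0 < rho -> exists2 s : C, 0 < normc s < rho & cvg0 (fun n => normc (v n s))) ->
  forall k, cvg0 (fun n => normc (taylor_coef (v n) k)).
Proof.
move=> hv B0 vB acc k; elim/ltn_ind: k => k IH e e0.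
(* For [normc s < 1/4] the remainder on the circle of radius [1/2] is at most
   [B (2 normc s)^(k+1) 2]. Divided by [normc s ^+ k] it is [M * normc s], which the choice of [s]
   makes at most [e / 2]. *)
pose M := 2 * B * 2 ^+ k.+1.
have M0 : 0 <= M by rewrite !mulr_ge0// exprn_ge0.
have M1 : 0 < 2 * (M + 1) by lra.
have rho0 : 0 < Num.min 4^-1 (e / (2 * (M + 1))).
  by rewrite lt_min invr_gt0 ltr0n divr_gt0.
have [s /andP[s0 srho] vs] := acc _ rho0; have := srho; rewrite (lt_min (normc s) 4^-1 (e / (2 * (M + 1)))) => /andP[s4 se].
have sk : 0 < normc s ^+ k by rewrite exprn_gt0.
have : cvg0 (fun n => normc (v n s) + \sum_(i < k) normc (taylor_coef (v n) i)).
  by apply: cvg0D => //; apply: (@cvg0_sum k (fun i n => normc (taylor_coef (v n) i))).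
have e2 : 0 < e / 2 * normc s ^+ k by rewrite mulr_gt0// divr_gt0.
move=> /(_ _ e2)[N HN]; exists N => n /HN; set S := \sum_(i < k) _ => HS.
have ar : normc s < (2^-1 : R) < 1 by apply/andP; split; lra.
have h2 : 0 < (2^-1 : R) < 1 by rewrite half_gt0 half_lt1.
have := taylor_remainder k.+1 (hv n) ar (rad_bound (vB n) h2).
rewrite big_ord_recr/=; set P := \sum_(i < k) _ => T.
have PS : normc P <= S.
  apply: (le_trans (@ler_normc_sum R k _)); apply: ler_sum => i _.
  by rewrite normcM normcX ler_piMr ?normc_ge0// exprn_ile1 ?normc_ge0//; lra.
have T2 : normc (taylor_coef (v n) k) * normc s ^+ k <= normc (v n s) + S +
    B * ((normc s / 2^-1) ^+ k.+1 * (2^-1 / (2^-1 - normc s))).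
  rewrite -normcX -normcM.
  have -> : taylor_coef (v n) k * s ^+ k = v n s - P - (v n s - (P + taylor_coef (v n) k * s ^+ k)) by ring.
  apply: (le_trans (le_normcB _ _)); apply: lerD => //.
  by apply: (le_trans (le_normcB _ _)); rewrite lerD2l.
have T3 : B * ((normc s / 2^-1) ^+ k.+1 * (2^-1 / (2^-1 - normc s))) <= normc s ^+ k * (M * normc s).
  have -> : normc s ^+ k * (M * normc s) = B * ((normc s / 2^-1) ^+ k.+1 * 2).
    by rewrite /M invrK exprMn !exprS; ring.
  rewrite ler_wpM2l// ler_wpM2l ?exprn_ge0 ?divr_ge0 ?normc_ge0//.
  by rewrite ler_pdivrMr; lra.
have T4 : M * normc s <= e / 2.
  by move: se; rewrite ltr_pdivlMr// => H; have := normc_ge0 s; nra.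
rewrite -(ler_pM2r sk); apply: (le_trans T2).
have : normc s ^+ k * (M * normc s) <= normc s ^+ k * (e / 2) by rewrite ler_pM2l.
lra.
Qed.

(** Finitely many Taylor coefficients tend to 0 by [vitali_coef], and the remainder is small
    uniformly in [n]. *)
Lemma vitali0 (v : nat -> C -> C) (B : R) : (forall n, holo 1 (v n)) -> 0 <= B ->
  (forall n z, normc z < 1 -> normc (v n z) <= B) ->
  (forall rho : R, 0 < rho -> exists2 s : C, 0 < normc s < rho & cvg0 (fun n => normc (v n s))) ->
  forall z, normc z < 1 -> cvg0 (fun n => normc (v n z)).
Proof.
move=> hv B0 vB acc z z1 e e0; have z0 := normc_ge0 z.
have ck := vitali_coef hv B0 vB acc.
pose r := (1 + normc z) / 2.
have zr : normc z < r < 1 by rewrite /r; apply/andP; split; lra.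
have /andP[zr0 r1] := zr; have r0 : 0 < r by lra.
have q01 : 0 <= normc z / r < 1 by rewrite divr_ge0 ?(ltW r0)//= ltr_pdivrMr// mul1r.
pose K := B * (r / (r - normc z)) + 1.
have K0 : 0 < K by rewrite ltr_wpDl// mulr_ge0// divr_ge0 ?(ltW r0)// subr_ge0 ltW.
have e2 : 0 < e / 2 by rewrite divr_gt0.
have [k /(_ k (leqnn _)) Hk] := exprn_to0 q01 (divr_gt0 e2 K0).
have : cvg0 (fun n => \sum_(i < k) normc (taylor_coef (v n) i)).
  by apply: (@cvg0_sum k (fun i n => normc (taylor_coef (v n) i))).
move=> /(_ _ e2)[N HN]; exists N => n /HN HS.
have r01 : 0 < r < 1 by rewrite r0.
have := taylor_remainder k (hv n) zr (rad_bound (vB n) r01); set P := \sum_(i < k) _ => T.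
have PS : normc P <= e / 2.
  apply: le_trans HS; apply: (le_trans (@ler_normc_sum R k _)); apply: ler_sum => i _.
  by rewrite normcM normcX ler_piMr ?normc_ge0// exprn_ile1 ?normc_ge0// ltW.
have T2 : B * ((normc z / r) ^+ k * (r / (r - normc z))) <= e / 2.
  move: Hk; rewrite ltr_pdivlMr// /K => /ltW; apply: le_trans.
  by rewrite mulrCA; apply: ler_wpM2l; [rewrite exprn_ge0//; case/andP: q01|rewrite lerDl].
rewrite -(subrK P (v n z)); apply: (le_trans (le_normcD _ _)); lra.
Qed.

(** On a small circle the positive moments of a constant vanish, which kills every Taylor
    coefficient but the first; these coefficients determine [f] on the whole disc. *)
Lemma holo_const_near f (del : R) : holo 1 f -> 0 < del ->
  (forall z, normc z < del -> f z = f 0) -> forall z, normc z < 1 -> f z = f 0.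
Proof.
move=> hf del0 fc z z1.
pose s := Num.min del 2^-1 / 2.
have m0 : 0 < Num.min del 2^-1 by rewrite lt_min del0 half_gt0.
have md : Num.min del 2^-1 <= del by rewrite ge_min lexx.
have mh : Num.min del 2^-1 <= 2^-1 by rewrite ge_min lexx orbT.
have s01 : 0 < s < 1 by rewrite /s; apply/andP; split; lra.
have fs t : f (rad s t) = f 0.
  by apply: fc; rewrite normc_rad gtr0_norm /s; lra.
have c0 k : taylor_coef f k.+1 = 0.
  have := taylor_coef_moment k.+1 hf s01.
  rewrite (@cint_eq _ _ (fun t => f 0 * (ec t)^-1 ^+ k.+1)); last by move=> t _; rewrite fs.
  rewrite cintZ; last exact: contc_ecVX.
  rewrite cint_ecVX mulr0 => /esym/eqP; rewrite mulf_eq0 => /orP[/eqP//|].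
  by rewrite expf_eq0/= => /negPn; rewrite real_neq0//; case/andP: s01.
have main w : normc w < 1 -> f w = taylor_coef f 0.
  move=> w1; have w0 := normc_ge0 w.
  apply/eqP; rewrite -subr_eq0 -normc_eq0; apply/eqP/le_anti; rewrite normc_ge0 andbT.
  apply/ler_addgt0Pr => e e0; rewrite add0r.
  pose r := (1 + normc w) / 2.
  have zr : normc w < r < 1 by rewrite /r; apply/andP; split; lra.
  have /andP[zr0 r1] := zr; have r0 : 0 < r by lra.
  have [B HB] : exists B, forall t : R, 0 <= t <= 1 -> normc (f (rad r t)) <= B.
    by apply: holo_bounded hf _; rewrite r0.
  have B0 : 0 <= B by apply: le_trans (HB 0 _); rewrite ?normc_ge0// lexx ler01.
  have q01 : 0 <= normc w / r < 1 by rewrite divr_ge0 ?(ltW r0)//= ltr_pdivrMr// mul1r.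
  pose K := B * (r / (r - normc w)) + 1.
  have K0 : 0 < K by rewrite ltr_wpDl// mulr_ge0// divr_ge0 ?(ltW r0)// subr_ge0 ltW.
  have [k /(_ k.+1 (leqnSn _)) Hk] := exprn_to0 q01 (divr_gt0 e0 K0).
  have := taylor_remainder k.+1 hf zr HB; rewrite big_ord_recl expr0 mulr1 big1 ?addr0; last first.
    by move=> i _; rewrite c0 mul0r.
  move/le_trans; apply; move: Hk; rewrite ltr_pdivlMr// /K => /ltW; apply: le_trans.
  by rewrite mulrCA; apply: ler_wpM2l; [rewrite exprn_ge0//; case/andP: q01|rewrite lerDl].
by rewrite !main// normc0.
Qed.

Definition moebius a z : C := (z + a) / (1 + a^* * z).

Lemma moebius_den a z : normc a < 1 -> normc z < 1 -> 1 + a^* * z != 0.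
Proof.
move=> a1 z1; rewrite -normc_gt0.
have := lerB_normcD 1 (a^* * z); rewrite normcM normcJE normc1.
have := normc_ge0 a; have := normc_ge0 z; nra.
Qed.

Lemma holo_moebius a : normc a < 1 -> holo 1 (moebius a).
Proof.
move=> a1; apply: holoM; first by apply: holoD; [exact: holo_id|exact: holo_cst].
apply: holoV; last by move=> z; exact: moebius_den.
apply: holoD; first exact: holo_cst.
by apply: holoM; [exact: holo_cst|exact: holo_id].
Qed.

Lemma moebius_disc a z : normc a < 1 -> normc z < 1 -> normc (moebius a z) < 1.
Proof.
move=> a1 z1; have d0 := moebius_den a1 z1.
rewrite /moebius normcf_div ltr_pdivrMr ?normc_gt0// mul1r.
rewrite -(@ltr_pXn2r _ 2)// ?nnegrE ?normc_ge0// -subr_gt0.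
have -> : normc (1 + a^* * z) ^+ 2 - normc (z + a) ^+ 2 = (1 - normc a ^+ 2) * (1 - normc z ^+ 2).
  by rewrite !sqr_normcE; case: a z {a1 z1 d0} => x y [p q] /=; ring.
by rewrite mulr_gt0// subr_gt0 expr_lt1// normc_ge0.
Qed.

Lemma moebiusK a w : normc a < 1 -> normc w < 1 -> moebius a (moebius (- a) w) = w.
Proof.
move=> a1 w1; have na : normc (- a) < 1 by rewrite normcN.
have d0 := moebius_den na w1.
have d1 := moebius_den a1 (moebius_disc na w1).
have E : (- a)^* = - a^* by apply: complexP; rewrite ?complexReJ ?complexReN ?complexImJ ?complexImN ?complexReJ ?complexImJ.
move: d0 d1; rewrite /moebius E => d0 d1.
have aa : 1 - a * a^* != 0.
  have -> : 1 - a * a^* = (1 - normc a ^+ 2)%:C by rewrite rmorphB rmorph1/= sqr_normc_re.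
  by rewrite real_neq0// subr_gt0 expr_lt1// normc_ge0.
move: (a^*) d0 d1 aa => b d0 d1 aa.
have F : 1 + b * ((w - a) / (1 + - b * w)) = (1 - a * b) / (1 + - b * w) by field.
by rewrite F; field; rewrite d0.
Qed.

(* The image of [F] accumulates at [F 0], which a Moebius map moves to the origin. *)
Lemma vitali_image (H : nat -> C -> C) F z0 : (forall n, holo 1 (H n)) ->
  (forall n z, normc z < 1 -> normc (H n z) < 1) -> normc z0 < 1 ->
  holo 1 F -> (forall z, normc z < 1 -> normc (F z) < 1) ->
  (forall z, normc z < 1 -> cvg0 (fun n => normc (H n (F z) - z0))) ->
  (exists2 z, normc z < 1 & F z != F 0) ->
  forall w, normc w < 1 -> cvg0 (fun n => normc (H n w - z0)).
Proof.
move=> hH H1 z01 hF F1 cF [zz zz1 Fzz] w w1.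
have n01 : normc (0 : C) < 1 by rewrite normc0.
set a := F 0; have a1 : normc a < 1 by exact: F1.
have na1 : normc (- a) < 1 by rewrite normcN.
pose v n z := H n (moebius a z) - z0.
have hv n : holo 1 (v n).
  apply: holoB; last exact: holo_cst.
  apply: holo_comp (holo_moebius a1) _ (hH n) => z; exact: moebius_disc.
have vB n z : normc z < 1 -> normc (v n z) <= 2.
  move=> z1; apply: (le_trans (le_normcB _ _)).
  have := H1 n _ (moebius_disc a1 z1); lra.
suff : cvg0 (fun n => normc (v n (moebius (- a) w))) by rewrite /v moebiusK.
apply: (vitali0 hv (ler0n _ 2) vB) (moebius_disc na1 w1) => rho rho0.
have hMF : holo 1 (fun z => moebius (- a) (F z)) by exact: holo_comp (holo_moebius na1).
have [d /has_deriv_cts/(_ rho rho0)[del del0 Hdel]] := hMF 0 n01.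
(* By [holo_const_near] a nonconstant [F] is not constant near 0, so it takes values other than [a]
   there. Their Moebius images are nonzero and small. *)
have [z [z1 zd Fz]] : exists z, [/\ normc z < 1, normc z < del & F z != a].
  apply: contrapT => no.
  have m0 : 0 < Num.min 1 del by rewrite lt_min ltr01.
  have := holo_const_near hF m0 _ zz1 => E; move: Fzz; rewrite E ?eqxx// => y.
  rewrite lt_min => /andP[y1 yd]; apply/eqP; apply: contraT => ny.
  by exfalso; apply: no; exists y.
exists (moebius (- a) (F z)); last first.
  by rewrite /v moebiusK//; [exact: cF|exact: F1].
have M0 : moebius (- a) (F 0) = 0 by rewrite /moebius subrr mul0r.
apply/andP; split.
  rewrite normc_gt0 /moebius mulf_neq0 ?subr_eq0// invr_eq0.
  by apply: moebius_den => //; exact: F1.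
by have := Hdel z; rewrite M0 !subr0; apply.
Qed.

(** Indices start at 0, so [left_iterate f N] already contains [N.+1] maps and the tail begins with
    [f N.+1]. *)
Lemma left_iterate_shift (f : nat -> C -> C) N j z :
  left_iterate f (N.+1 + j) z = left_iterate (fun i => f (N.+1 + i)%N) j (left_iterate f N z).
Proof.
elim: j => [|j IH]; first by rewrite [RHS]/= !addn0.
rewrite addnS; set F := left_iterate f N z.
by rewrite -[LHS]/(f (N.+1 + j).+1%N (left_iterate f (N.+1 + j) z)) IH -addnS.
Qed.

Lemma left_iterate_disc (f : nat -> C -> C) n : (forall n, holo 1 (f n)) ->
  (forall n z, normc z < 1 -> normc (f n z) < 1) ->
  holo 1 (left_iterate f n) /\ (forall z, normc z < 1 -> normc (left_iterate f n z) < 1).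
Proof.
move=> hf f1; elim: n => [|n [h i]]; first by split; [exact: hf|exact: f1].
by split=> [|z z1] /=; [apply: (holo_comp h i); exact: hf|apply: f1; exact: i].
Qed.

(** If [F_N] is nonconstant, convergence on its image spreads to the disc by [vitali_image]. If it
    is constant, the image is a single point from which nothing spreads, and the implication on [w]
    places [w] at that point. *)
Lemma left_iterate_tail (f : nat -> C -> C) N z0 w : (forall n, holo 1 (f n)) ->
  (forall n z, normc z < 1 -> normc (f n z) < 1) -> normc z0 < 1 ->
  (forall z, normc z < 1 -> cvg0 (fun n => normc (left_iterate f n z - z0))) ->
  normc w < 1 -> ((forall z, normc z < 1 -> left_iterate f N z = left_iterate f N 0) -> w = left_iterate f N 0) ->
  cvg0 (fun j => normc (left_iterate (fun i => f (N.+1 + i)%N) j w - z0)).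
Proof.
move=> hf f1 z01 cF w1 wc.
pose H := left_iterate (fun i => f (N.+1 + i)%N).
have HF z : normc z < 1 -> cvg0 (fun j => normc (H j (left_iterate f N z) - z0)).
  move=> /cF c e /c[M HM]; exists M => j Mj; rewrite /H -left_iterate_shift.
  by apply: HM; exact: leq_trans (leq_addl _ _).
have n01 : normc (0 : C) < 1 by rewrite normc0.
have [F h1] := left_iterate_disc N hf f1.
have [[zz zz1 Fzz]|no] := pselect (exists2 z, normc z < 1 & left_iterate f N z != left_iterate f N 0).
  apply: (@vitali_image H (left_iterate f N) z0) => //.
  - by move=> n; have [] := @left_iterate_disc (fun i => f (N.+1 + i)%N) n (fun i => hf _) (fun i => f1 _).
  - by move=> n; have [] := @left_iterate_disc (fun i => f (N.+1 + i)%N) n (fun i => hf _) (fun i => f1 _).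
  - by exists zz.
rewrite wc; first exact: HF.
move=> z z1; apply/eqP; apply: contraT => nz; exfalso; apply: no; by exists z.
Qed.

End Vitali.

(** * The boundary inequality *)

Section Boundary.
Variable R : realType.
Local Notation mu := (@lebesgue_measure R).
Local Notation D := (`[0%R, 1%R]%classic : set R).
Local Notation C := R[i].
Local Notation Re := (@complex.Re _).
Local Notation Im := (@complex.Im _).
Implicit Types (f g : C -> C) (a b c z w l : C) (u : nat -> C).

Definition ccvg u l := cvg0 (fun n => normc (u n - l)).

Lemma ccvg_Re u l : ccvg u l -> Re (u n) @[n --> \oo] --> Re l.
Proof.
move=> h; apply/cvgrPdist_le => e /h[N HN]; exists N => // n /HN; apply: le_trans.
by rewrite distrC -complexReN -complexReD ler_normRe.
Qed.

Lemma ccvg_Im u l : ccvg u l -> Im (u n) @[n --> \oo] --> Im l.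
Proof.
move=> h; apply/cvgrPdist_le => e /h[N HN]; exists N => // n /HN; apply: le_trans.
by rewrite distrC -complexImN -complexImD ler_normIm.
Qed.

Lemma ccvg_sqr u l k : ccvg u l ->
  normc (u n - k) ^+ 2 @[n --> \oo] --> normc (l - k) ^+ 2.
Proof.
move=> h; rewrite sqr_normcE; under eq_fun do rewrite sqr_normcE.
rewrite !complexReD !complexImD; under eq_fun do rewrite complexReD complexImD.
have cR := ccvg_Re h; have cI := ccvg_Im h.
by apply: (@cvgD _ _ _ _ _ (fun n => (Re (u n) + Re (- k)) ^+ 2) (fun n => (Im (u n) + Im (- k)) ^+ 2));
  rewrite !expr2; apply: cvgM; apply: cvgD => //; exact: cvg_cst.
Qed.

Lemma ccvg_sqr0 u l : ccvg u l -> normc (u n) ^+ 2 @[n --> \oo] --> normc l ^+ 2.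
Proof. by move=> h; have := @ccvg_sqr u l 0 h; under eq_fun do rewrite subr0; rewrite subr0. Qed.

Lemma ccvg_cts f u l : cts f l -> ccvg u l -> ccvg (fun n => f (u n)) (f l).
Proof.
move=> cf ul e /cf[del del0 H]; have [N HN] := ul _ (divr_gt0 del0 (ltr0n _ 2)).
exists N => n /HN A; apply/ltW/H; lra.
Qed.

(** The exponent is shifted by one to keep the first radius positive. *)
Definition rho_ (j : nat) : R := 1 - 2^-1 ^+ j.+1.

Lemma rho_01 j : 0 < rho_ j < 1.
Proof.
have h : 0 < (2^-1 : R) ^+ j.+1 by rewrite exprn_gt0// half_gt0.
have h1 : (2^-1 : R) ^+ j.+1 < 1 by rewrite exprn_ilt1// ?half_lt1// ltW// half_gt0.
by rewrite /rho_; apply/andP; split; lra.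
Qed.

Lemma rho_near (del : R) : 0 < del -> exists N, forall j, (N <= j)%N -> 1 - del < rho_ j.
Proof.
move=> del0.
have h : 0 <= (2^-1 : R) < 1 by rewrite half_lt1 ltW// half_gt0.
have [N HN] := exprn_to0 h del0; exists N => j Nj.
by rewrite /rho_; have := HN _ (leq_trans Nj (leqnSn j)); lra.
Qed.

Lemma rlim_rho f (t : R) l : rlim f t l -> ccvg (fun j => f (rad (rho_ j) t)) l.
Proof.
move=> h e /h[del /rho_near[N HN] H]; exists N => j /HN rj; apply: H => //.
by case/andP: (rho_01 j).
Qed.

Lemma ccvg_unique u l l' : ccvg u l -> ccvg u l' -> l = l'.
Proof.
move=> h h'; apply/eqP; rewrite -subr_eq0 -normc_eq0; apply/eqP/le_anti; rewrite normc_ge0 andbT.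
apply/ler_addgt0Pr => e e0; rewrite add0r.
have e2 : 0 < e / 2 by rewrite divr_gt0.
have [N HN] := h _ e2; have [M HM] := h' _ e2.
have A := HN _ (leq_maxl N M); have B := HM _ (leq_maxr N M).
apply: (le_trans (normc_triangle (u (maxn N M)) _ _)); rewrite normcBC; lra.
Qed.

Lemma rlim_unique f (t : R) l l' : rlim f t l -> rlim f t l' -> l = l'.
Proof. by move=> /rlim_rho h /rlim_rho; exact: ccvg_unique. Qed.

Lemma rlim_comp f g (t : R) l : rlim f t l -> cts g l -> rlim (fun z => g (f z)) t (g l).
Proof.
move=> fl cg e /cg[del del0 H].
have [d d0 Hd] := fl _ (divr_gt0 del0 (ltr0n _ 2)).
by exists d => // r r1 r2; apply/ltW/H; have := Hd r r1 r2; lra.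
Qed.

Lemma rlim_cst f (t : R) k : (forall z, normc z < 1 -> f z = k) -> rlim f t k.
Proof.
move=> fk e e0; exists 1 => // r r0 r1; rewrite fk ?subrr ?normc0 ?ltW//.
by rewrite normc_rad ltr_norml; apply/andP; split; lra.
Qed.

Lemma rlim_normc_le f (t B : R) l : (forall z, normc z < 1 -> normc (f z) <= B) ->
  rlim f t l -> normc l <= B.
Proof.
move=> fB fl; apply/ler_addgt0Pr => e /fl[del del0 H].
have [N HN] := rho_near del0; have /andP[r0 r1] := rho_01 N.
have A := H _ (HN _ (leqnn N)) r1.
have B1 : normc (f (rad (rho_ N) t)) <= B by apply: fB; rewrite normc_rad gtr0_norm.
by rewrite -(subrK (f (rad (rho_ N) t)) l) (le_trans (le_normcD _ _))// normcBC; lra.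
Qed.

(* On [A] the function [b] is the radial limit; off [A] it is [0], so that it is Borel. *)
Lemma boundary_function f (A : set R) : measurable A -> holo 1 f ->
  (forall z, normc z < 1 -> normc (f z) <= 1) -> (forall t, A t -> exists l, rlim f t l) ->
  exists b : R -> C, [/\ measurable_fun D (fun t => Re (b t)), measurable_fun D (fun t => Im (b t)),
    (forall t, normc (b t) <= 1), (forall t, A t -> rlim f t (b t)) & forall t, ~ A t -> b t = 0].
Proof.
move=> mA hf f1 fA.
have /choice[b bP] t : exists l, (A t -> rlim f t l) /\ (~ A t -> l = 0).
  have [/[dup] At /fA[l Hl]|nA] := pselect (A t); first by exists l.
  by exists 0.
have cA : measurable_fun D (\1_A : R -> R) by exact: measurable_indic.
have bA t : A t -> rlim f t (b t) by case: (bP t).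
have b0 t : ~ A t -> b t = 0 by case: (bP t).
have cb j : contc (fun t => f (rad (rho_ j) t)) by apply: holo_contc hf _; exact: rho_01.
exists b; split=> //.
- apply: (@measurable_fun_cvg _ _ _ D (fun j t => Re (f (rad (rho_ j) t)) * \1_A t)) => [j|t _].
    by apply: measurable_funM => //; apply: cont01_measurable; case: (cb j).
  have [At|nA] := pselect (A t).
    rewrite indicE mem_set//; under eq_fun do rewrite mulr1.
    by apply: ccvg_Re; apply: rlim_rho; exact: bA.
  by rewrite indicE memNset// b0//; under eq_fun do rewrite mulr0; exact: cvg_cst.
- apply: (@measurable_fun_cvg _ _ _ D (fun j t => Im (f (rad (rho_ j) t)) * \1_A t)) => [j|t _].
    by apply: measurable_funM => //; apply: cont01_measurable; case: (cb j).
  have [At|nA] := pselect (A t).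
    rewrite indicE mem_set//; under eq_fun do rewrite mulr1.
    by apply: ccvg_Im; apply: rlim_rho; exact: bA.
  by rewrite indicE memNset// b0//; under eq_fun do rewrite mulr0; exact: cvg_cst.
- move=> t; have [/bA|/b0->] := pselect (A t); first exact: rlim_normc_le.
  by rewrite normc0 ler01.
Qed.

Lemma bmeas_sqr (b : R -> C) (B : R) k : measurable_fun D (fun t => Re (b t)) ->
  measurable_fun D (fun t => Im (b t)) -> (forall t, normc (b t) <= B) ->
  bmeas (fun t => normc (b t - k) ^+ 2).
Proof.
move=> mR mI bB; have B0 : 0 <= B := le_trans (normc_ge0 _) (bB 0).
have bR : bmeas (fun t => Re (b t)) by split=> //; exists B => t _; apply: le_trans (bB t); exact: ler_normRe.
have bI : bmeas (fun t => Im (b t)) by split=> //; exists B => t _; apply: le_trans (bB t); exact: ler_normIm.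
under eq_fun do rewrite sqr_normcE complexReD complexImD.
have h1 := bmeasD bR (bmeas_cst (Re (- k))); have h2 := bmeasD bI (bmeas_cst (Im (- k))).
exact: (bmeasD (bmeasM h1 h1) (bmeasM h2 h2)).
Qed.

Lemma bmeasX (v : R -> R) n : bmeas v -> bmeas (fun t => v t ^+ n).
Proof.
move=> bv; elim: n => [|n IH]; first exact: bmeas_cst.
by under eq_fun do rewrite exprS; exact: bmeasM.
Qed.

End Boundary.

(** * The key inequality for radial limits *)

Section BoundaryInequality.
Variable R : realType.
Local Notation mu := (@lebesgue_measure R).
Local Notation D := (`[0%R, 1%R]%classic : set R).
Local Notation C := R[i].
Local Notation Re := (@complex.Re _).
Local Notation Im := (@complex.Im _).
Implicit Types (a z w l : C).

(** A bounded measurable representative defined at every parameter, as dominated convergence wants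
    it, for radial limits known to exist only on [A]. *)
Definition boundary_of (A : set R) (f : C -> C) (b : R -> C) :=
  [/\ measurable_fun D (fun t => Re (b t)), measurable_fun D (fun t => Im (b t)),
    (forall t, normc (b t) <= 1) & (forall t, A t -> rlim f t (b t))].

Lemma sqr_normc01 z : normc z <= 1 -> 0 <= normc z ^+ 2 <= 1.
Proof. by move=> z1; rewrite exprn_ge0 ?normc_ge0//= exprn_ile1 ?normc_ge0. Qed.

Lemma onem_exp01 (x : R) m : 0 <= x <= 1 -> 0 <= 1 - x ^+ m <= 1.
Proof.
move=> /andP[x0 x1]; have h0 : 0 <= x ^+ m by exact: exprn_ge0.
have h1 : x ^+ m <= 1 by exact: exprn_ile1.
by apply/andP; split; lra.
Qed.

Lemma sqr_normc_diff z a : normc z <= 1 -> normc a < 1 -> 0 <= normc (z - a) ^+ 2 <= 4.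
Proof.
move=> z1 a1; rewrite exprn_ge0 ?normc_ge0//=.
have -> : 4 = 2 ^+ 2 :> R by rewrite -natrX.
apply: lerXn2r; rewrite ?nnegrE ?normc_ge0//.
by apply: (le_trans (le_normcB _ _)); lra.
Qed.

Lemma sqr_normcX z m : normc (z ^+ m) ^+ 2 = (normc z ^+ 2) ^+ m.
Proof. by rewrite normcX -!exprM mulnC. Qed.

Lemma bmeas_boundary A (f : C -> C) b k : boundary_of A f b -> bmeas (fun t => normc (b t - k) ^+ 2).
Proof. by case=> m1 m2 b1 _; exact: bmeas_sqr m1 m2 b1. Qed.

Lemma bmeas_boundary0 A (f : C -> C) b : boundary_of A f b -> bmeas (fun t => normc (b t) ^+ 2).
Proof. by move=> /(bmeas_boundary 0) h; under eq_fun do rewrite -[b _]subr0. Qed.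

Lemma bmeas_onem A (f : C -> C) b m : boundary_of A f b ->
  bmeas (fun t => 1 - (normc (b t) ^+ 2) ^+ m).
Proof.
by move=> /bmeas_boundary0 h; apply: bmeasB; [exact: bmeas_cst|exact: bmeasX].
Qed.

Lemma norm_le_of01 (x B : R) : 0 <= x <= B -> `|x| <= B.
Proof. by case/andP=> x0; rewrite ger0_norm. Qed.

Lemma mul_onem_bound (x y : R) : 0 <= x <= 1 -> 0 <= y <= 4 -> `|x * y| <= 4.
Proof.
move=> /andP[x0 x1] /andP[y0 y4]; rewrite ger0_norm ?(mulr_ge0 x0 y0)//.
by rewrite -[leRHS]mul1r ler_pM.
Qed.

Lemma cvgnB (u v : nat -> R) (a b : R) : u n @[n --> \oo] --> a -> v n @[n --> \oo] --> b ->
  u n - v n @[n --> \oo] --> a - b.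
Proof. exact: cvgB. Qed.

Lemma cvgnM (u v : nat -> R) (a b : R) : u n @[n --> \oo] --> a -> v n @[n --> \oo] --> b ->
  u n * v n @[n --> \oo] --> a * b.
Proof. exact: cvgM. Qed.

Lemma cvg_onemX (v : nat -> R) (l : R) m : v n @[n --> \oo] --> l ->
  1 - v n ^+ m @[n --> \oo] --> 1 - l ^+ m.
Proof.
move=> vl; have h : v n ^+ m @[n --> \oo] --> l ^+ m.
  exact: (@cvg_comp _ _ _ v (fun x : R => x ^+ m) _ _ _ vl (@exprn_continuous R m l)).
have h1 : (fun=> (1 : R)) n @[n --> \oo] --> (1 : R) by exact: cvg_cst.
exact: (cvgnB h1 h).
Qed.

(** Dominated convergence is used twice: [R0] tends to 1 at fixed [r], where [g] acts at interior
    points, and then [r] tends to 1. The threshold [n0] is drawn from [key_inequality] before [g] is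
    chosen, so it serves every [m]. *)
Lemma boundary_key (f : nat -> C -> C) z0 (rho : R) (A : set R) (b c : nat -> R -> C) :
  (forall n, holo 1 (f n)) -> (forall n z, normc z < 1 -> normc (f n z) < 1) ->
  normc z0 < 1 -> 0 < rho < 1 ->
  (forall del : R, 0 < del -> exists n0, forall n, (n0 <= n)%N ->
     forall z, normc z <= rho -> normc (left_iterate f n z - z0) <= del) ->
  {ae mu, forall t, 0 <= t <= 1 -> A t} ->
  (forall n, boundary_of A (left_iterate f n) (b n)) -> (forall n, boundary_of A (f n) (c n)) ->
  forall N (eps : R), 0 < eps -> exists n0, forall n, (n0 <= n)%N -> forall m,
  (1 - normc z0) / (1 + normc z0) * rint (fun s => 1 - (normc (c n.+1 s) ^+ 2) ^+ m) *
    rint (fun t => normc (b N t - z0) ^+ 2) - eps <=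
  rint (fun t => (1 - (normc (b n.+1 t) ^+ 2) ^+ m) * normc (b N t - z0) ^+ 2).
Proof.
move=> hf f1 z01 rho01 unif aeA hb hc N eps eps0.
have hF n : holo 1 (left_iterate f n) by have [] := left_iterate_disc n hf f1.
have F1 n z : normc z < 1 -> normc (left_iterate f n z) < 1.
  by have [_] := left_iterate_disc n hf f1; exact.
have radlt (r t : R) : 0 < r < 1 -> normc (rad r t) < 1.
  by move=> /andP[r0 r1]; rewrite normc_rad gtr0_norm.
pose w z := left_iterate f N z - z0.
have hw : holo 1 w by apply: holoB; [exact: hF|exact: holo_cst].
have w2 z : normc z < 1 -> normc (w z) <= 2.
  by move=> /(F1 N) h; apply: (le_trans (le_normcB _ _)); lra.
have [n0 Hn0] := key_inequality hw w2 hF F1 z01 rho01 unif eps0.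
exists n0 => n nn m.
set kap := (1 - normc z0) / (1 + normc z0) in Hn0 *; clearbody kap.
pose g z := f n.+1 z ^+ m.
have hg : holo 1 g by apply: holoX; exact: hf.
have g1 z : normc z < 1 -> normc (g z) <= 1.
  move=> /(f1 n.+1) h; rewrite normcX exprn_ile1 ?normc_ge0//; exact: ltW.
have {}Hn0 := Hn0 n nn g hg g1.
have W4 (r t : R) : 0 < r < 1 -> 0 <= normc (w (rad r t)) ^+ 2 <= 4.
  by move=> r01; apply: sqr_normc_diff => //; apply: ltW; apply: F1; exact: radlt.
have cW (r : R) : 0 < r < 1 -> cont01 (fun t => normc (w (rad r t)) ^+ 2).
  by move=> r01; apply: cont01_sqr_normc; exact: holo_contc hw r01.
have onemc h (r : R) : holo 1 h -> 0 < r < 1 -> cont01 (fun t => 1 - normc (h (rad r t)) ^+ 2).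
  move=> hh r01; apply: (cont01B (@cont01_cst R 1)).
  by apply: cont01_sqr_normc; exact: holo_contc hh r01.
have L1 : rint (fun s => 1 - normc (g (rad (rho_ R j) s)) ^+ 2) @[j --> \oo] -->
    rint (fun s => 1 - (normc (c n.+1 s) ^+ 2) ^+ m).
  apply: (@rint_dct _ _ _ 1).
  - by move=> j; apply: cont01_measurable; apply: onemc hg _; exact: rho_01.
  - by have [] := bmeas_onem m (hc n.+1).
  - move=> j t t01; apply: norm_le_of01; apply: (@onem_exp01 _ 1%N).
    by apply: sqr_normc01; apply: g1; apply: radlt; exact: rho_01.
  apply: ae_mono aeA => t At /At{}At.
  have [_ _ _ /(_ t At)/rlim_rho h] := hc n.+1.
  under eq_fun do rewrite sqr_normcX.
  apply: cvg_onemX; exact: ccvg_sqr0.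
have key (r : R) : 0 < r < 1 ->
    kap * rint (fun s => 1 - (normc (c n.+1 s) ^+ 2) ^+ m) * rint (fun t => normc (w (rad r t)) ^+ 2) - eps
    <= rint (fun t => (1 - (normc (left_iterate f n.+1 (rad r t)) ^+ 2) ^+ m) * normc (w (rad r t)) ^+ 2).
  move=> r01.
  pose J (R0 : R) t := (1 - normc (g (R0%:C * left_iterate f n (rad r t))) ^+ 2) * normc (w (rad r t)) ^+ 2.
  have L2 : rint (J (rho_ R j)) @[j --> \oo] -->
      rint (fun t => (1 - (normc (left_iterate f n.+1 (rad r t)) ^+ 2) ^+ m) * normc (w (rad r t)) ^+ 2).
    have R0F (j : nat) z : normc z < 1 -> normc ((rho_ R j)%:C * left_iterate f n z) < 1.
      move=> /(F1 n) h; have /andP[r0 r1] := rho_01 R j; rewrite normcM normc_realE gtr0_norm//.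
      by have := normc_ge0 (left_iterate f n z); nra.
    apply: (@rint_dct _ _ _ 4).
    - move=> j; apply: cont01_measurable; apply: (cont01M _ (cW r r01)).
      apply: (onemc (fun z => g ((rho_ R j)%:C * left_iterate f n z))) => //.
      apply: (holo_comp (rho' := 1)) hg; last exact: R0F.
      by apply: holoM; [exact: holo_cst|exact: hF].
    - apply: cont01_measurable; apply: (cont01M _ (cW r r01)).
      under eq_fun do rewrite -sqr_normcX.
      apply: (onemc (fun z => left_iterate f n.+1 z ^+ m)) => //; apply: holoX; exact: hF.
    - move=> j t t01; apply: mul_onem_bound; last exact: W4.
      apply: (@onem_exp01 _ 1%N); apply: sqr_normc01; apply: g1; apply: R0F; exact: radlt.
    apply: aeW => t t01; apply: cvgnM; last exact: cvg_cst.
    rewrite -sqr_normcX; apply: (@cvg_onemX _ _ 1%N).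
    (* [g] at [left_iterate f n z] is by definition [left_iterate f n.+1 z ^+ m]; since [r < 1],
       continuity of [g] inside the disc suffices. *)
    apply: (@ccvg_sqr0 _ (fun j => g ((rho_ R j)%:C * left_iterate f n (rad r t))) (g (left_iterate f n (rad r t)))).
    apply: (@ccvg_cts _ g); first by apply: (holo_cts hg); apply: F1; exact: radlt.
    move=> e e0; have [M HM] := rho_near e0; exists M => j /HM rj.
    have -> : (rho_ R j)%:C * left_iterate f n (rad r t) - left_iterate f n (rad r t) = (rho_ R j - 1)%:C * left_iterate f n (rad r t).
      by move: (rho_ R j) => q; rewrite rmorphB rmorph1 mulrBl mul1r.
    have /andP[r0 r1] := rho_01 R j.
    rewrite normcM normc_realE ltr0_norm ?subr_lt0//.
    have := F1 n _ (radlt r t r01); have := normc_ge0 (left_iterate f n (rad r t)); nra.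
  apply: (ler_cvg_to _ L2); last first.
    by apply: nearW => j; apply: (Hn0 r (rho_ R j)) => //; exact: rho_01.
  apply: cvgnB; last exact: cvg_cst.
  apply: cvgnM; last exact: cvg_cst.
  by apply: cvgnM; [exact: cvg_cst|exact: L1].
have LW : rint (fun t => normc (w (rad (rho_ R j) t)) ^+ 2) @[j --> \oo] -->
    rint (fun t => normc (b N t - z0) ^+ 2).
  apply: (@rint_dct _ _ _ 4).
  - by move=> j; apply: cont01_measurable; apply: cW; exact: rho_01.
  - by have [] := bmeas_boundary z0 (hb N).
  - by move=> j t t01; apply: norm_le_of01; apply: W4; exact: rho_01.
  apply: ae_mono aeA => t At /At{}At.
  have [_ _ _ /(_ t At)/rlim_rho h] := hb N.
  exact: (@ccvg_sqr _ _ _ z0 h).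
have LR : rint (fun t => (1 - (normc (left_iterate f n.+1 (rad (rho_ R j) t)) ^+ 2) ^+ m) *
      normc (w (rad (rho_ R j) t)) ^+ 2) @[j --> \oo] -->
    rint (fun t => (1 - (normc (b n.+1 t) ^+ 2) ^+ m) * normc (b N t - z0) ^+ 2).
  apply: (@rint_dct _ _ _ 4).
  - move=> j; apply: cont01_measurable; apply: (cont01M _ (cW _ (rho_01 R j))).
    under eq_fun do rewrite -sqr_normcX.
    by apply: (onemc (fun z => left_iterate f n.+1 z ^+ m)); [apply: holoX; exact: hF|exact: rho_01].
  - by have [] := bmeasM (bmeas_onem m (hb n.+1)) (bmeas_boundary z0 (hb N)).
  - move=> j t t01; apply: mul_onem_bound; last by apply: W4; exact: rho_01.
    apply: onem_exp01; apply: sqr_normc01; apply: ltW; apply: F1; apply: radlt; exact: rho_01.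
  apply: ae_mono aeA => t At /At{}At.
  have [_ _ _ /(_ t At)/rlim_rho h] := hb N.
  have [_ _ _ /(_ t At)/rlim_rho h'] := hb n.+1.
  apply: cvgnM; last exact: (@ccvg_sqr _ _ _ z0 h).
  apply: cvg_onemX; exact: ccvg_sqr0.
apply: (ler_cvg_to _ LR); last by apply: nearW => j; apply: key; exact: rho_01.
apply: cvgnB; last exact: cvg_cst.
by apply: cvgnM; [exact: cvg_cst|exact: LW].
Qed.

End BoundaryInequality.

(** * Null sets and convergence almost everywhere on the circle *)

Section BoundaryConvergence.
Variable R : realType.
Local Notation mu := (@lebesgue_measure R).
Local Notation D := (`[0%R, 1%R]%classic : set R).
Local Notation C := R[i].
Local Notation Re := (@complex.Re _).
Local Notation Im := (@complex.Im _).
Implicit Types (a z w l : C).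

(** The Lebesgue measure is computed by the outer measure, so monotonicity holds for arbitrary sets.
    Sets defined by radial limits are thereby compared without proving them Borel. *)
Lemma le_lebesgue (A B : set R) : A `<=` B -> (mu A <= mu B)%E.
Proof. exact: (@le_outer_measure _ _ ((wlength (@idfun R))^*%mu)). Qed.

Lemma null_setU (A B : set R) : mu A = 0%E -> mu B = 0%E -> mu (A `|` B) = 0%E.
Proof.
move=> A0 B0; apply/eqP; rewrite eq_le measure_ge0 andbT.
apply: le_trans (outer_measureU2 ((wlength (@idfun R))^*%mu) A B) _.
by apply: (@le_trans _ _ (mu A + mu B)%E) => //; rewrite A0 B0 adde0.
Qed.

(** Cutting a test set by [A] leaves one piece of outer measure 0 and one no larger than the test
    set. *)
Lemma caratheodory_null (A : set R) : mu A = 0%E ->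
  (wlength (@idfun R))^*%mu.-cara.-measurable A.
Proof.
move=> A0; apply: le_caratheodory_measurable => X.
rewrite -[leRHS]add0e; apply: leeD; last by apply: le_outer_measure => x [].
by rewrite -A0; apply: le_lebesgue => x [].
Qed.

Lemma rint_indic (A : set R) : measurable A -> A `<=` D -> (rint (\1_A))%:E = mu A.
Proof.
move=> mA AD; rewrite (brint_EFin (bmeas_indic mA)) integral_indic//.
by congr (mu _); apply/seteqP; split=> [x []//|x Ax]; split => //; exact: AD.
Qed.

Lemma measurable_level (u : R -> R) : measurable_fun D u -> measurable (D `&` [set t | u t = 1]).
Proof.
move=> mu_; have := @measurable_fun_eqr _ _ R D u (fun=> 1) mu_ (measurable_cst _).
move=> /(_ (measurable_itv _) [set true]) => /(_ I).
rewrite (_ : _ @^-1` _ = [set t | u t = 1])//.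
by apply/seteqP; split=> t /= /eqP.
Qed.

Lemma measurable_sublevel (u : R -> R) : measurable_fun D u -> measurable (D `&` [set t | u t < 1]).
Proof.
move=> mu_; have := @measurable_fun_ltr _ _ R D u (fun=> 1) mu_ (measurable_cst _).
by move=> /(_ (measurable_itv _) [set true]) => /(_ I).
Qed.

(** From the interior point [b N t] on, the later maps are continuous along the orbit. So the
    boundary values follow the tail of the system, and [left_iterate_tail] applies. *)
Lemma boundary_tail (f : nat -> C -> C) z0 (A : set R) (b : nat -> R -> C) t N :
  (forall n, holo 1 (f n)) -> (forall n z, normc z < 1 -> normc (f n z) < 1) ->
  normc z0 < 1 -> (forall z, normc z < 1 -> cvg0 (fun n => normc (left_iterate f n z - z0))) ->
  (forall n, boundary_of A (left_iterate f n) (b n)) -> A t -> normc (b N t) < 1 ->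
  ccvg (b ^~ t) z0.
Proof.
move=> hf f1 z01 pw hb At bN.
have bl n : rlim (left_iterate f n) t (b n t) by have [_ _ _ bl] := hb n; exact: bl.
have H := @left_iterate_tail _ f N z0 (b N t) hf f1 z01 pw bN.
have {H} : cvg0 (fun j => normc (left_iterate (fun i => f (N.+1 + i)%N) j (b N t) - z0)).
  (* A constant [F_N] has its constant value as its only radial limit. *)
  by apply: H => c; apply: (rlim_unique (bl N)); apply: rlim_cst.
move=> H e /H[M HM]; exists (N.+1 + M)%N => n Mn.
have [j Ej] : exists j, n = (N.+1 + j)%N.
  by exists (n - N.+1)%N; rewrite subnKC// (leq_trans (leq_addr M _)).
rewrite Ej leq_add2l in Mn *.
have [hH _] := @left_iterate_disc _ (fun i => f (N.+1 + i)%N) j (fun i => hf _) (fun i => f1 _).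
have E := rlim_comp (bl N) (holo_cts hH bN).
have -> : b (N.+1 + j)%N t = left_iterate (fun i => f (N.+1 + i)%N) j (b N t).
  apply: (rlim_unique (bl _)); move: E; congr (rlim _ _ _).
  by apply/funext => z; rewrite left_iterate_shift.
exact: HM.
Qed.

Lemma ae_radial_limits (f : nat -> C -> C) :
  (forall n, holo 1 (f n)) -> (forall n z, normc z < 1 -> normc (f n z) < 1) ->
  exists A : set R, [/\ measurable A, A `<=` D, mu (D `\` A) = 0%E &
    forall t n, A t -> exists l, rlim (f n) t l].
Proof.
move=> hf f1.
have : {ae mu, forall t, forall n, 0 < t < 1 -> exists l, rlim (f n) t l}.
  apply: ae_foralln => n; apply: (@fatou _ (f n) 1) => // z z1; apply: ltW; exact: f1.
move=> [N [mN N0 NP]].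
(* [fatou] treats interior parameters, so both endpoints join the null set. *)
exists (`]0, 1[ `\` N); split.
- by apply: measurableD.
- by move=> t [/=]; rewrite !in_itv/= => /andP[t0 t1] _; rewrite !ltW.
- apply/eqP; rewrite eq_le measure_ge0 andbT.
  apply: (@le_trans _ _ (mu ([set 0] `|` [set 1] `|` N))).
    apply: le_lebesgue => t [/=]; rewrite !in_itv/= => /andP[t0 t1] H.
    have [->|n0] := eqVneq t 0; first by left; left.
    have [->|n1] := eqVneq t 1; first by left; right.
    right; apply: contrapT => nN; apply: H; split => //.
    by rewrite lt_neqAle eq_sym n0 t0/= lt_neqAle n1.
  by rewrite le_eqVlt null_setU ?eqxx//; apply: null_setU => //; exact: lebesgue_measure_set1.
- move=> t n [/=]; rewrite in_itv/= => t01 nN; apply: contrapT => H; apply: nN; apply: NP => /= K.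
  by apply: H; exact: K.
Qed.

(** Powers of a number in [[0, 1]] tend to 0 unless it is 1, so in the limit every boundary value
    inside the disc has weight 1, however close to the circle. *)
Lemma rint_onem_lim (A : set R) (f : C -> C) (c : R -> C) : boundary_of A f c ->
  rint (fun s => 1 - (normc (c s) ^+ 2) ^+ m) @[m --> \oo] -->
  rint (\1_(D `&` [set t | normc (c t) ^+ 2 < 1])).
Proof.
move=> hc; have [_ _ c1 _] := hc.
have mc : measurable_fun D (fun t => normc (c t) ^+ 2).
  by have [] := bmeas_boundary0 hc.
apply: (@rint_dct _ _ _ 1).
- by move=> m; have [] := bmeas_onem m hc.
- by apply: measurable_indic; exact: measurable_sublevel.
- by move=> m t _; apply: norm_le_of01; apply: onem_exp01; exact: sqr_normc01.
apply: aeW => t t01; have /andP[x0 x1] := sqr_normc01 (c1 t).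
have [xlt|xge] := ltP (normc (c t) ^+ 2) 1.
  have tL : (D `&` [set t | normc (c t) ^+ 2 < 1]) t by split => //; exact/itv01P.
  rewrite indicE (mem_set tL) /=.
  rewrite -[X in _ --> X](subr0 (1 : R)).
  apply: (@cvgnB R (fun=> 1) (fun m => (normc (c t) ^+ 2) ^+ m)); first exact: cvg_cst.
  by apply: cvg_expr; rewrite ger0_norm.
have tL : ~ (D `&` [set t | normc (c t) ^+ 2 < 1]) t by case=> _ /=; rewrite ltNge xge.
rewrite indicE (memNset tL) /=.
rewrite (_ : normc (c t) ^+ 2 = 1); last by apply/le_anti; rewrite x1.
by under eq_fun do rewrite expr1n subrr; exact: cvg_cst.
Qed.

Lemma boundary_convergence (f : nat -> C -> C) z0 (rho c : R) :
  (forall n, holo 1 (f n)) -> (forall n z, normc z < 1 -> normc (f n z) < 1) ->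
  normc z0 < 1 -> 0 < rho < 1 ->
  (forall del : R, 0 < del -> exists n0, forall n, (n0 <= n)%N ->
     forall z, normc z <= rho -> normc (left_iterate f n z - z0) <= del) ->
  (forall z, normc z < 1 -> cvg0 (fun n => normc (left_iterate f n z - z0))) ->
  0 < c -> (forall n0, exists2 n, (n0 <= n)%N & (c%:E <=
    mu [set t | (0 <= t <= 1)%R /\ exists2 l, rlim (f n) t l & (normc l < 1)%R])%E) ->
  exists2 N : set R, mu N = 0%E & forall t, 0 <= t <= 1 -> ~ N t ->
    exists b : nat -> C, (forall n, rlim (left_iterate f n) t (b n)) /\ ccvg b z0.
Proof.
move=> hf f1 z01 rho01 unif pw c0 big.
have F1 n z : normc z < 1 -> normc (left_iterate f n z) < 1.
  by have [_] := left_iterate_disc n hf f1; exact.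
have hF n : holo 1 (left_iterate f n) by have [] := left_iterate_disc n hf f1.
have [A1 [mA1 A1D A10 A1P]] := ae_radial_limits hf f1.
have [A2 [mA2 A2D A20 A2P]] := ae_radial_limits hF F1.
pose A := A1 `&` A2.
have mA : measurable A by exact: measurableI.
have A0 : mu (D `\` A) = 0%E.
  by rewrite setDIr; exact: null_setU.
have aeA : {ae mu, forall t, 0 <= t <= 1 -> A t}.
  exists (D `\` A); split => //; first exact: measurableD.
  by move=> t /= H; apply: contrapT => nDA; apply: H => /itv01P tD; apply: contrapT => nA; apply: nDA.
have /choice[b hb] n : exists b, boundary_of A (left_iterate f n) b.
  have F1' z : normc z < 1 -> normc (left_iterate f n z) <= 1 by move=> /(F1 n)/ltW.
  have lF t : A t -> exists l, rlim (left_iterate f n) t l by move=> [_ /(A2P t n)].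
  have [b [b1 b2 b3 b4 _]] := boundary_function mA (hF n) F1' lF.
  by exists b; split.
have /choice[d hd] n : exists g, boundary_of A (f n) g.
  have f1' z : normc z < 1 -> normc (f n z) <= 1 by move=> /(f1 n)/ltW.
  have lf t : A t -> exists l, rlim (f n) t l by move=> [/(A1P t n)].
  have [g [b1 b2 b3 b4 _]] := boundary_function mA (hf n) f1' lf.
  by exists g; split.
have b1 n t : normc (b n t) <= 1 by have [] := hb n.
pose L n := D `&` [set t | normc (d n t) ^+ 2 < 1].
pose P := \bigcap_n (D `&` [set t | normc (b n t) ^+ 2 = 1]).
have mX n k : bmeas (fun t => normc (b n t - k) ^+ 2) by exact: bmeas_boundary (hb n).
have mX0 n : measurable_fun D (fun t => normc (b n t) ^+ 2).
  by have [] := bmeas_boundary0 (hb n).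
have md0 n : measurable_fun D (fun t => normc (d n t) ^+ 2).
  by have [] := bmeas_boundary0 (hd n).
have mP : measurable P by apply: bigcap_measurable => // n _; exact: measurable_level.
have PD : P `<=` D by move=> t /(_ 0%N I)[].
have mL n : measurable (L n) by exact: measurable_sublevel.
have LD n : L n `<=` D by move=> t [].
have tail t : A t -> ~ P t -> ccvg (b ^~ t) z0.
  move=> At nP; have [n nn] : exists n, normc (b n t) < 1.
    apply: contrapT => H; apply: nP => n _; split; first by case: At => /A1D.
    have /eqP nb : normc (b n t) == 1; last by rewrite /= nb expr1n.
    rewrite eq_le b1/= leNgt; apply/negP => K; apply: H; by exists n.
  exact: boundary_tail hf f1 z01 pw hb At nn.
(* The set of the hypothesis comes without measurability. Uniqueness of radial limits puts it inside
   the Borel set [L n] up to the null set where [A] fails. *)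
have Lc n : (c%:E <= mu [set t | (0 <= t <= 1)%R /\ exists2 l, rlim (f n) t l & (normc l < 1)%R])%E ->
    c <= rint (\1_(L n)).
  rewrite -lee_fin rint_indic// => /le_trans; apply.
  apply: (@le_trans _ _ (mu (L n `|` (D `\` A)))); last first.
    apply: le_trans (outer_measureU2 ((wlength (@idfun R))^*%mu) _ _) _.
    by apply: (@le_trans _ _ (mu (L n) + mu (D `\` A))%E) => //; rewrite A0 adde0.
  apply: le_lebesgue => t /= [/itv01P tD [l tl l1]].
  have [At|nA] := pselect (A t); last by right.
  left; split => //=; have [_ _ _ /(_ t At) bl] := hd n.
  by rewrite (rlim_unique bl tl) expr_lt1// normc_ge0.
pose X N t := normc (b N t - z0) ^+ 2.
pose Q t := 1 - \1_P t : R.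
have bQ : bmeas Q := bmeasB (bmeas_cst 1) (bmeas_indic mP).
pose kap := (1 - normc z0) / (1 + normc z0).
have kap0 : 0 < kap by rewrite divr_gt0//; have := normc_ge0 z0; lra.
have Q01 t : 0 <= Q t <= 1.
  by rewrite /Q indicE; case: (_ \in _); rewrite ?subrr ?subr0 lexx ler01.
have X04 N t : 0 <= X N t <= 4 by exact: sqr_normc_diff.
have main N : kap * c * rint (X N) <= rint (fun t => Q t * X N t).
  apply/ler_addgt0Pr => eps eps0.
  have [n0 Hn0] := boundary_key hf f1 z01 rho01 unif aeA hb hd N eps0.
  (* Asking for an index above [n0.+1] yields a successor, since [boundary_key] at [n] concerns the
     map [f n.+1]. *)
  have [n nn /Lc cn] := big n0.+1.
  case: n nn cn => // n nn cn; have {}Hn0 := Hn0 n nn.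
  rewrite -/kap in Hn0.
  have le m : kap * rint (fun s => 1 - (normc (d n.+1 s) ^+ 2) ^+ m) * rint (X N) <=
      rint (fun t => Q t * X N t) + eps.
    rewrite -lerBlDr; apply: (le_trans (Hn0 m)).
    apply: ler_brint.
    - exact: bmeasM (bmeas_onem m (hb n.+1)) (mX N z0).
    - exact: bmeasM bQ (mX N z0).
    move=> t t01; apply: ler_wpM2r; first by case/andP: (X04 N t).
    rewrite /Q indicE; have [Pt|nP] := pselect (P t).
      by rewrite mem_set//=; have [_ /= ->] := Pt n.+1 I; rewrite expr1n.
    rewrite memNset//= subr0; have /andP[_] := onem_exp01 m (sqr_normc01 (b1 n.+1 t)).
    by [].
  have RX : 0 <= rint (X N) by apply: brint_ge0 => t _; case/andP: (X04 N t).
  apply: (@le_trans _ _ (kap * rint (\1_(L n.+1)) * rint (X N))).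
    by apply: ler_wpM2r => //; apply: ler_wpM2l => //; exact: ltW.
  have l1 := rint_onem_lim (hd n.+1).
  have l2 : kap * rint (fun s => 1 - (normc (d n.+1 s) ^+ 2) ^+ m) * rint (X N) @[m --> \oo] -->
      kap * rint (\1_(L n.+1)) * rint (X N).
    apply: cvgnM; last exact: cvg_cst.
    by apply: cvgnM l1; exact: cvg_cst.
  exact: (@ler_cvg_to _ \oo _ _ _ _ _ _ l2 (cvg_cst _) (nearW _ le)).
have QX : rint (fun t => Q t * X N t) @[N --> \oo] --> rint (fun=> 0 : R).
  apply: (@rint_dct _ _ _ 4).
  - by move=> N; have [] := bmeasM bQ (mX N z0).
  - exact: measurable_cst.
  - by move=> N t _; exact: mul_onem_bound.
  apply: ae_mono aeA => t At /At{}At; rewrite /Q indicE.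
  have [Pt|nP] := pselect (P t).
    by rewrite mem_set//= subrr; under eq_fun do rewrite mul0r; exact: cvg_cst.
  rewrite memNset//= subr0; under eq_fun do rewrite mul1r.
  have := @ccvg_sqr _ _ _ z0 (tail t At nP).
  by rewrite subrr normc0 expr0n.
pose q := (1 - normc z0) ^+ 2.
have q0 : 0 < q by rewrite exprn_gt0// subr_gt0.
have XP N : q * rint (\1_P) <= rint (X N).
  rewrite -(brintZ q (bmeas_indic mP)); apply: ler_brint.
  - by apply: bmeasM; [exact: bmeas_cst|exact: bmeas_indic].
  - exact: mX.
  move=> t t01; rewrite indicE; have [Pt|nP] := pselect (P t); last first.
    by rewrite memNset//= mulr0; case/andP: (X04 N t).
  rewrite mem_set//= mulr1; have [_ /= bt] := Pt N I.
  have bt1 : normc (b N t) = 1.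
    by apply/eqP; rewrite -(@eqrXn2 _ 2)// ?normc_ge0// bt expr1n.
  apply: lerXn2r; rewrite ?nnegrE ?normc_ge0// ?subr_ge0; first exact: ltW.
  have := lerB_normc (b N t) z0; rewrite bt1; lra.
have P0 : rint (\1_P) = 0.
  apply/le_anti; rewrite [X in _ && X]brint_ge0 ?andbT; last by move=> t _; rewrite indicE.
  have h : (fun=> kap * c * (q * rint (\1_P))) n @[n --> \oo] --> kap * c * (q * rint (\1_P)).
    exact: cvg_cst.
  have le N : kap * c * (q * rint (\1_P)) <= rint (fun t => Q t * X N t).
    by apply: le_trans (main N); apply: ler_wpM2l => //; rewrite mulr_ge0 ?ltW.
  have := @ler_cvg_to _ \oo _ _ _ _ _ _ h QX (nearW _ le).
  have k0 : 0 < kap * c * q := mulr_gt0 (mulr_gt0 kap0 c0) q0.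
  by rewrite rint_cst (mulrA (kap * c)) (pmulr_rle0 _ k0); apply; exact: _.
exists ((D `\` A) `|` P).
  by apply: null_setU => //; rewrite -rint_indic// P0.
move=> t /itv01P tD nN; have At : A t by apply: contrapT => nA; apply: nN; left.
have nP : ~ P t by move=> Pt; apply: nN; right.
exists (b ^~ t); split; last exact: tail.
by move=> n; have [_ _ _ bl] := hb n; exact: bl.
Qed.

End BoundaryConvergence.

(** * Limits in the complex plane as a normed module *)

Section Bridges.
Variable R : realType.
Local Notation C := (Cplx R).
Implicit Types (f : C -> C) (z w l : C).

Lemma normc_norm z : `|z| = (normc z)%:C :> C.
Proof. by case: z => a b; rewrite normc_def. Qed.

Lemma unit_discE z : unit_disc z <-> normc z < 1.
Proof. by rewrite /unit_disc/= normc_norm -[1 in X in X <-> _]/(1%:C) ltcR. Qed.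

Lemma complex_pos (e : R[i]) : 0 < e -> exists2 d : R, 0 < d & e = d%:C.
Proof.
case: e => a b; rewrite ltcE/= => /andP[/eqP b0 a0]; exists a => //.
by apply: complexP => /=; rewrite ?b0.
Qed.

Lemma nbhs_normc z (P : set C) : nbhs z P <->
  exists2 d : R, 0 < d & forall w, normc (w - z) < d -> P w.
Proof.
split=> [/nbhs_ballP[e /= /complex_pos[d d0 ->] H]|[d d0 H]].
  exists d => // w wz; apply: H; rewrite -ball_normE/= distrC normc_norm.
  by rewrite ltcR.
apply/nbhs_ballP; exists d%:C; first by rewrite /= -[0]/(0%:C) ltcR.
move=> w; rewrite -ball_normE/= distrC normc_norm ltcR; exact: H.
Qed.

Lemma cvg_normc (T : Type) (F : set_system T) {FF : Filter F} (u : T -> C) l :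
  u @ F --> l <-> forall e : R, 0 < e -> \forall x \near F, normc (u x - l) <= e.
Proof.
split=> [/cvgrPdist_le H e e0|H].
  have e0' : 0 < e%:C :> C by rewrite -[0]/(0%:C) ltcR.
  by have := H _ e0'; apply: filterS => x; rewrite distrC normc_norm lecR.
apply/cvgrPdist_le => e /complex_pos[d d0 ->].
by have := H _ d0; apply: filterS => x; rewrite distrC normc_norm lecR.
Qed.

Lemma derivable_has_deriv f z : derivable f z 1 -> exists d, has_deriv f z d.
Proof.
move=> /cvg_ex[l /cvg_normc Hl]; exists l => e e0.
have := Hl _ e0; rewrite /dnbhs => /nbhs_normc[d d0 H].
exists d => // w wz; have [->|nwz] := eqVneq w z.
  by rewrite !subrr mulr0 subrr normc0 mulr0.
have wz0 : w - z != 0 by rewrite subr_eq0.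
have := H (w - z); rewrite subr0 => /(_ wz wz0) /=.
rewrite -[_ *: 1]/((w - z) * 1) mulr1 subrK -[_ *: _]/((w - z)^-1 * (f w - f z)) => K.
have -> : f w - f z - l * (w - z) = ((w - z)^-1 * (f w - f z) - l) * (w - z).
  by field.
by rewrite normcM ler_wpM2r ?normc_ge0.
Qed.

Lemma disc_selfmap_holo f : disc_selfmap f ->
  holo 1 f /\ forall z, normc z < 1 -> normc (f z) < 1.
Proof.
move=> [df f1]; split=> z /unit_discE z1; first exact: derivable_has_deriv (df z z1).
by apply/unit_discE; exact: f1.
Qed.

Lemma luc_normc (F : nat -> C -> C) z0 z :
  locally_uniform_cvg (@unit_disc R) F (fun=> z0) -> normc z < 1 ->
  exists2 d : R, 0 < d & forall e : R, 0 < e -> exists n0, forall n, (n0 <= n)%N ->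
    forall w, normc w < 1 -> normc (w - z) < d -> normc (F n w - z0) <= e.
Proof.
move=> luc /unit_discE z1; have [V /nbhs_normc[d d0 HV] H] := luc z z1.
exists d => // e e0.
have eC : 0 < e%:C :> C by rewrite -[0]/(0%:C) ltcR.
have : nbhs (F @ \oo) [set h : C -> C | forall y, (V `&` @unit_disc R) y -> ball z0 (e%:C) (h y)].
  apply: H; apply/uniform_nbhs; exists [set xy | ball xy.1 (e%:C) xy.2].
  by split=> //; apply: entourage_ball (PosNum eC).
move=> [n0 _ Hn]; exists n0 => n nn w w1 wz.
have := Hn n nn w; rewrite /= => /(_ (conj (HV w wz) ((unit_discE w).2 w1))).
by rewrite -ball_normE/= distrC normc_norm ltcR => /ltW.
Qed.

Lemma at_left1P (P : R -> Prop) : (\forall r \near 1^'-, P r) <->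
  exists2 del : R, 0 < del & forall r : R, 1 - del < r -> r < 1 -> P r.
Proof.
split=> [/nbhs_ballP[e /= e0 H]|[del del0 H]].
  exists e => // r r1 r2; apply: H => //.
  by rewrite -ball_normE/= gtr0_norm ?subr_gt0//; lra.
near=> r; apply: H; last by near: r; exact: nbhs_left_lt.
by near: r; apply: nbhs_left_gt; lra.
Unshelve. all: by end_near. Qed.

Lemma rlimE f (t : R) l : rlim f t l <-> on_radius f (ec t) r @[r --> 1^'-] --> l.
Proof.
rewrite cvg_normc; split=> H e /H; first by move=> K; apply/at_left1P.
by move/at_left1P.
Qed.

Lemma rlim_has f (t : R) l : rlim f t l ->
  has_radial_limit f (ec t) /\ radial_limit f (ec t) = l.
Proof.
move=> /rlimE H; split; first by apply/cvg_ex; exists l.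
by apply: cvg_lim H; exact: (@norm_hausdorff _ C).
Qed.

Lemma has_rlim f (t : R) : has_radial_limit f (ec t) -> rlim f t (radial_limit f (ec t)).
Proof. by move=> H; apply/rlimE. Qed.

End Bridges.

(** The limit superior is the infimum of the suprema over tails. A constant strictly below it, half
    of it or 1 if it is infinite, is exceeded in every tail. *)
Lemma limn_esup_gt0 (R : realType) (u : nat -> \bar R) : (0 < limn_esup u)%E ->
  exists2 c : R, 0 < c & forall n0, exists2 n, (n0 <= n)%N & (c%:E <= u n)%E.
Proof.
move=> u0; have [c c0 cu] : exists2 c : R, 0 < c & (c%:E < limn_esup u)%E.
  case: (limn_esup u) u0 => [r| |] //=; rewrite ?lte_fin => r0.
    by exists (r / 2); rewrite ?lte_fin; lra.
  by exists 1; rewrite ?ltr01// ltry.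
exists c => // n0.
have : (c%:E < ereal_sup (u @` [set n | (n0 <= n)%N]))%E.
  apply: (lt_le_trans cu); apply: ereal_inf_lbound.
  by exists [set n | (n0 <= n)%N] => //; exists n0.
by move=> /ereal_sup_gt[_ [n /= nn <-] /ltW]; exists n.
Qed.

Theorem theorem1p1 (R : realType) (f : nat -> Cplx R -> Cplx R) (z0 : Cplx R)
  (f_selfmap : forall n, disc_selfmap (f n))
  (z0_disc : unit_disc z0)
  (F_cvg : locally_uniform_cvg (@unit_disc R) (left_iterate f) (fun=> z0))
  (nk : nat -> nat)
  (nk_incr : {homo nk : j k / (j < k)%N})
  (E : nat -> set (Cplx R))
  (E_circle : forall k, E k `<=` @unit_circle R)
  (E_measurable : forall k, circle_measurable (E k))
  (E_limsup : (0 < limn_esup (fun k => circle_measure (E k)))%E)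
  (E_inside : forall k zeta, E k zeta ->
    has_radial_limit (f (nk k)) zeta /\ `|radial_limit (f (nk k)) zeta| < 1) :
  circle_ae (fun zeta =>
    (forall n, has_radial_limit (left_iterate f n) zeta) /\
    radial_limit (left_iterate f n) zeta @[n --> \oo] --> z0).
Proof.
have hf n := (disc_selfmap_holo (f_selfmap n)).1.
have f1 n := (disc_selfmap_holo (f_selfmap n)).2.
have z01 := (unit_discE z0).1 z0_disc.
have n01 : normc (0 : R[i]) < 1 by rewrite normc0.
have [d d0 Hd] := luc_normc F_cvg n01.
(* Locally uniform convergence at the origin is uniform on the closed disc of radius [rho]; halving
   keeps it strictly inside both the neighbourhood and the unit disc. *)
pose rho := Num.min d 1 / 2.
have m0 : 0 < Num.min d 1 by rewrite lt_min d0 ltr01.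
have md : Num.min d 1 <= d by rewrite ge_min lexx.
have m1 : Num.min d 1 <= 1 by rewrite ge_min lexx orbT.
have rho01 : 0 < rho < 1 by rewrite /rho; apply/andP; split; lra.
have unif (del : R) : 0 < del -> exists n0, forall n, (n0 <= n)%N ->
     forall z, normc z <= rho -> normc (left_iterate f n z - z0) <= del.
  move=> /Hd[n0 Hn]; exists n0 => n nn z zr.
  by apply: Hn => //; rewrite ?subr0; apply: le_lt_trans zr _; rewrite /rho; lra.
have pw z : normc z < 1 -> cvg0 (fun n => normc (left_iterate f n z - z0)).
  move=> z1; have [e e0 He] := luc_normc F_cvg z1.
  move=> del /He[n0 Hn]; exists n0 => n nn.
  by apply: Hn => //; rewrite subrr normc0.
have [c c0 Hc] := limn_esup_gt0 E_limsup.
(* Large sets [E k] occur for arbitrarily late [k], and this carries them to arbitrarily late maps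
   of the original sequence. *)
have nk_ge k : (k <= nk k)%N.
  by elim: k => // k IH; apply: leq_ltn_trans IH _; exact: nk_incr.
have [|N N0 HN] := boundary_convergence hf f1 z01 rho01 unif pw c0.
  move=> n0; have [k kn Ek] := Hc n0; exists (nk k); first exact: leq_trans kn (nk_ge k).
  apply: (le_trans Ek); apply: le_lebesgue => t [/=]; rewrite in_itv/= => /andP[t0 t1].
  move=> /E_inside[/has_rlim h l1]; split; first by rewrite t0 ltW.
  by exists (radial_limit (f (nk k)) (ec t)) => //; exact: (unit_discE _).1 l1.
(* The exceptional set is the exact set of failures. Its preimage has outer measure 0 and is
   therefore Caratheodory measurable, whatever its Borel structure. *)
pose Z : set (Cplx R) := [set zeta | ~ ((forall n, has_radial_limit (left_iterate f n) zeta) /\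
    radial_limit (left_iterate f n) zeta @[n --> \oo] --> z0)].
have Z0 : lebesgue_measure (circle_preimage Z) = 0%E.
  apply/eqP; rewrite eq_le measure_ge0 andbT -N0; apply: le_lebesgue => t [/=].
  rewrite in_itv/= => /andP[t0 t1] Zt; apply: contrapT => nN; apply: Zt.
  have t01 : 0 <= t <= 1 by rewrite t0 ltW.
  have [b [bl bz]] := HN t t01 nN.
  have h n : has_radial_limit (left_iterate f n) (ec t) /\ radial_limit (left_iterate f n) (ec t) = b n.
    by apply: rlim_has; exact: bl.
  split=> [n|]; first exact: (h n).1.
  rewrite (_ : (fun n => _) = b); last by apply/funext => n; exact: (h n).2.
  by apply/cvg_normc => e /bz[M HM]; exists M.
exists Z; split => //.
  exact: caratheodory_null.
by move=> zeta _ nZ; exact: contrapT.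
Qed.
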